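(* Let $d=2$. For any $1\le q<\infty$ and $r>1/q$, $$ \sigma_m(\mathbf W^r_q)_\infty \gg m^{-r} (\log m)^{1/2}. $$
   Context: $\mathbb T^2=[0,2\pi)^2$ (functions are $2\pi$-periodic in each variable) carries the normalized Lebesgue measure; $\|\cdot\|_p$ is the norm of $L_p(\mathbb T^2)$, $\|\cdot\|_\infty$ is the uniform norm, and $(f\ast g)(\mathbf x)=(2\pi)^{-2}\int_{\mathbb T^2}f(\mathbf y)g(\mathbf x-\mathbf y)\,d\mathbf y$. For $r>0$ let $F_r(x):=1+2\sum_{k=1}^\infty k^{-r}\cos(kx-r\pi/2)$ (univariate), $F_r(x_1,x_2):=F_r(x_1)F_r(x_2)$, and $\mathbf W^r_q:=\{f: f=\varphi\ast F_r,\ \|\varphi\|_q\le 1\}$. Best $m$-term trigonometric approximation: $$\sigma_m(f)_\infty:=\inf\Big\{\Big\|f-\sum_{j=1}^m c_je^{i(\mathbf k^j,\mathbf x)}\Big\|_\infty:\ \mathbf k^j\in\mathbb Z^2,\ c_j\in\mathbb C\Big\},\qquad \sigma_m(\mathbf W)_\infty:=\sup_{f\in\mathbf W}\sigma_m(f)_\infty .$$ $a_m\gg b_m$ means $a_m\ge cb_m$ for all integers $m\ge2$ with $c>0$ independent of $m$ (it may depend on $r,q$). *)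

(* Defs.v *)
From HB Require Import structures.
From mathcomp Require Import all_boot all_order all_algebra.
From mathcomp Require Import all_classical all_reals all_analysis.
From mathcomp Require Import complex.

Set Implicit Arguments.
Unset Strict Implicit.
Unset Printing Implicit Defensive.

Import Order.TTheory GRing.Theory Num.Theory.
Import numFieldNormedType.Exports.

Local Open Scope classical_set_scope.
Local Open Scope ring_scope.
Local Open Scope complex_scope.

(* Functions on T^2 are the functions R * R -> R[i] that are 2 pi-periodic in
   each variable. *)

Section Torus.
Context {R : realType}.

Definition torus : set (measurableTypeR R * measurableTypeR R) :=
  `[0, 2 * pi[ `*` `[0, 2 * pi[.

Lemma measurable_torus : measurable torus.
Proof. by apply: measurableX; exact: measurable_itv. Qed.

Lemma torus_scale_ge0 : 0 <= (2 * pi : R) ^- 2.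
Proof. by rewrite invr_ge0 exprn_ge0// mulr_ge0// pi_ge0. Qed.

(* (2 pi)^-2 times the planar Lebesgue measure, carried by [0, 2 pi)^2 *)
Definition torus_measure :
    {measure set (measurableTypeR R * measurableTypeR R) -> \bar R} :=
  mscale (NngNum torus_scale_ge0)
    (mrestr (@lebesgue_measure R \x @lebesgue_measure R)%E measurable_torus).

Definition periodic2 (f : R * R -> R[i]) : Prop :=
  forall x1 x2, f (x1 + 2 * pi, x2) = f (x1, x2) /\
                f (x1, x2 + 2 * pi) = f (x1, x2).

(* `|z| has type R[i]; [cmod z] is the same number in R.  Plain Re and Im are
   the operators of numClosedFieldType, also valued in R[i], hence the
   qualified projections complex.Re and complex.Im below. *)
Definition cmod (z : R[i]) : R := complex.Re `|z|.

(* Borel measurability.  Every class in L_q(T^2) has a Borel representative and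
   convolutions do not depend on the representative. *)
Definition cmeasurable (f : R * R -> R[i]) : Prop :=
  measurable_fun [set: measurableTypeR R * measurableTypeR R]
    (fun x => complex.Re (f x)) /\
  measurable_fun [set: measurableTypeR R * measurableTypeR R]
    (fun x => complex.Im (f x)).

Definition Lq_norm (q : R) (f : R * R -> R[i]) : \bar R :=
  'N[torus_measure]_(q%:E)[(fun x => (cmod (f x))%:E)]%E.

Definition sup_norm (f : R * R -> R[i]) : \bar R :=
  ereal_sup [set (cmod (f x))%:E | x in torus].

Definition cintegral (f : R * R -> R[i]) : R[i] :=
  (\int[torus_measure]_x complex.Re (f x)) +i*
  (\int[torus_measure]_x complex.Im (f x)).

Definition convolution (f g : R * R -> R[i]) (x : R * R) : R[i] :=
  cintegral (fun y => f y * g (x.1 - y.1, x.2 - y.2)).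

(* The series converges whenever r > 0 and x is not a multiple of 2 pi; at the
   multiples of 2 pi it may diverge, and [limn] is then an arbitrary value,
   which affects no convolution since these points form a null set. *)
Definition F1 (r x : R) : R :=
  1 + 2 * limn (fun n => \sum_(1 <= k < n)
                   (k%:R `^ (- r)) * cos (k%:R * x - r * pi / 2)).

Definition F2 (r : R) (x : R * R) : R[i] := (F1 r x.1 * F1 r x.2)%:C.

Definition classW (r q : R) : set (R * R -> R[i]) :=
  [set f | exists phi : R * R -> R[i],
     [/\ periodic2 phi, cmeasurable phi, (Lq_norm q phi <= 1)%E
       & f = convolution phi (F2 r)]].

Definition character (k : int * int) (x : R * R) : R[i] :=
  let t := k.1%:~R * x.1 + k.2%:~R * x.2 in cos t +i* sin t.

Definition sigma (m : nat) (f : R * R -> R[i]) : \bar R :=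
  ereal_inf [set e | exists (k : 'I_m -> int * int) (c : 'I_m -> R[i]),
    e = sup_norm (fun x => f x - \sum_(j < m) c j * character (k j) x)].

Definition sigma_class (m : nat) (W : set (R * R -> R[i])) : \bar R :=
  ereal_sup [set sigma m f | f in W].

End Torus.

(* Main.v *)
Require Import Defs.
From HB Require Import structures.
From mathcomp Require Import all_boot all_order all_algebra.
From mathcomp Require Import all_classical all_reals all_analysis.
From mathcomp Require Import complex measurable_realfun.
From mathcomp Require Import zify ring lra.

(** The proof exhibits, for each [m], a function of the class that is far from
    all [m]-term sums.  Fix [n] with [16 ^ n] comparable to [m].  On the level
    [s <= n] consider [16 ^ s * 16 ^ (n - s) = 16 ^ n] flat kernels,
    localized at the points of a 16^s x 16^(n-s) grid, with positive frequencies
    of sizes [16 ^ s] and [16 ^ (n - s)].  Put a sign in front of each kernel and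
    sum over all nodes and levels: this gives a polynomial [phi] for each choice
    of the [(n + 1) * 16 ^ n] signs.

    The moduli of the kernels of one level add up to at most one
    ([sum_cmod_ker_prod]).  So every level is bounded by one, and the squares of
    all kernels add up to at most [n + 1]; by a Khinchine inequality
    ([sum_sign_powR]) half of the sign choices satisfy
    [||phi||_q <= C_q * sqrt (n + 1)] ([good_signs]).  Convolution with the
    Bernoulli kernel turns [phi] into a polynomial [f] with the same spectrum and
    coefficients smaller by a factor of order [16 ^ (- r n)]
    ([convolution_trig]).  It rests on the Fourier coefficients of the
    kernel, for which the partial sums of the series have to be dominated
    ([series_bound], [integral_cos_F1]).

    If two sign choices differ in a fixed proportion of the signs, the
    polynomials [f] and [f'] differ in uniform norm by a multiple of
    [16 ^ (- r n) * (n + 1)], hence by much more than what the [L_2] norm gives.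
    As in the small ball inequality this is seen by testing against the Riesz
    product of the factors [1 + Re H_s], where [H_s] is the block of level [s]
    of half the difference of the sign vectors, suitably rotated ([dual]).  The
    product is nonnegative with mean one, and by lacunarity in the two variables only
    its first-order terms correlate with [f - f'] ([grid_sum_block_riesz],
    [far_grid_sum]).

    Suppose now that each [f] had an [m]-term approximant with a much smaller
    error.  All tests are averages over a finite grid, so only the
    frequencies modulo the size of the grid matter, and the coefficients can be
    rounded; thus the approximants are described by [O (n * m)] bits.  When [m]
    is a small multiple of [16 ^ n] this is less than a small proportion of
    the number of signs, and two far sign choices share the same description
    ([far_pair]), a contradiction ([sparse_lower_bound]).  After division by
    [sqrt (n + 1)] the error is of order [16 ^ (- r n) * sqrt (n + 1)], which
    is the stated bound. *)

Set Implicit Arguments.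
Unset Strict Implicit.
Unset Printing Implicit Defensive.

Import Order.TTheory GRing.Theory Num.Theory.
Import numFieldNormedType.Exports.

Local Open Scope classical_set_scope.
Local Open Scope ring_scope.

(** * Points of the unit circle and the complex modulus *)

Section Cis.
Context {R : realType}.
Implicit Types (x y : R) (z : R[i]) (n : nat).
Local Open Scope complex_scope.

(** The point of angle [x] on the unit circle. *)
Definition cis x : R[i] := cos x +i* sin x.

Lemma cisD x y : cis (x + y) = cis x * cis y.
Proof.
by rewrite /cis cosD sinD; apply/eqP; rewrite eq_complex /= eqxx/= addrC.
Qed.

Lemma cis0 : cis 0 = 1.
Proof. by rewrite /cis cos0 sin0. Qed.

(** [conjc] is the conjugation of the concrete type [R[i]]; the generic
    [Num.conj] is not used below. *)
Lemma cisN x : cis (- x) = conjc (cis x).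
Proof. by rewrite /cis cosN sinN. Qed.

Lemma cisMn n x : cis (n%:R * x) = cis x ^+ n.
Proof.
elim: n => [|n IH]; first by rewrite mul0r cis0 expr0.
by rewrite -natr1 mulrDl mul1r cisD IH exprSr.
Qed.

Lemma cis2pi : cis (2 * pi) = 1.
Proof. by rewrite /cis mulr_natl cos2pi sin2pi. Qed.

Lemma normr_cis x : `|cis x| = 1.
Proof. by rewrite normc_def /cis /= cos2Dsin2 sqrtr1. Qed.

Lemma cis_neq0 x : cis x != 0.
Proof. by rewrite -normr_gt0 normr_cis. Qed.

Lemma cisV x : cis (- x) = (cis x)^-1.
Proof.
apply: (mulfI (cis_neq0 x)).
by rewrite -cisD subrr cis0 divff// cis_neq0.
Qed.

Lemma cisMz (k : int) x : cis (k%:~R * x) = cis x ^ k.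
Proof.
case: k => n; first by rewrite -pmulrn cisMn.
by rewrite NegzE mulrNz mulNr -pmulrn cisV cisMn exprnN.
Qed.

Lemma cis_neq1 x : 0 < x < 2 * pi -> cis x != 1.
Proof.
move=> /andP[x0 x2]; apply/eqP => -[] + _.
have -> : x = x / 2 + x / 2 by rewrite -splitr.
rewrite cosD -!expr2 cos2sin2 => h.
have s0 : 0 < sin (x / 2).
  by apply: sin_gt0_pi; rewrite divr_gt0//= ltr_pdivrMr// mulrC.
by have := exprn_gt0 2 s0; lra.
Qed.

(** The norm of [R[i]] is valued in [R[i]]; [cmod] is its real version. *)
Lemma cmodE z : `|z| = (cmod z)%:C.
Proof. by rewrite /cmod normc_def. Qed.

Lemma cmod_ge0 z : 0 <= cmod z.
Proof. by rewrite -lecR -cmodE; exact: normr_ge0. Qed.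

Lemma cmodM z z' : cmod (z * z') = cmod z * cmod z'.
Proof. by apply: complexI; rewrite rmorphM /= -!cmodE normrM. Qed.

Lemma cmodD z z' : cmod (z + z') <= cmod z + cmod z'.
Proof. by rewrite -lecR rmorphD /= -!cmodE ler_normD. Qed.

Lemma cmod_sum (I : Type) (s : seq I) (P : pred I) (f : I -> R[i]) :
  cmod (\sum_(i <- s | P i) f i) <= \sum_(i <- s | P i) cmod (f i).
Proof.
rewrite -lecR -cmodE (le_trans (ler_norm_sum _ _ _))//.
by rewrite rmorph_sum /=; apply: ler_sum => i _; rewrite cmodE.
Qed.

Lemma cmod0 : cmod 0 = 0 :> R.
Proof. by apply: complexI; rewrite -cmodE normr0. Qed.

Lemma cmodN z : cmod (- z) = cmod z.
Proof. by rewrite /cmod normrN. Qed.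

Lemma cmod_real x : cmod x%:C = `|x|.
Proof. by rewrite /cmod normc_def /= expr0n addr0 sqrtr_sqr. Qed.

Lemma cmod_cis x : cmod (cis x) = 1.
Proof. by rewrite /cmod normr_cis. Qed.

Lemma cmod_conj z : cmod (conjc z) = cmod z.
Proof. by case: z => a b; rewrite /cmod !normc_def /= sqrrN. Qed.

Lemma mulc_conj z : z * conjc z = (cmod z ^+ 2)%:C.
Proof.
rewrite rmorphXn /= -cmodE -add_Re2_Im2; case: z => a b /=.
by apply/eqP; rewrite eq_complex /=; apply/andP; split; apply/eqP; ring.
Qed.

Lemma ler_Re_cmod z : `|complex.Re z| <= cmod z.
Proof.
case: z => a b; rewrite /cmod normc_def /= -sqrtr_sqr ler_wsqrtr//.
by rewrite lerDl sqr_ge0.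
Qed.

Lemma ler_Im_cmod z : `|complex.Im z| <= cmod z.
Proof.
case: z => a b; rewrite /cmod normc_def /= -sqrtr_sqr ler_wsqrtr//.
by rewrite lerDr sqr_ge0.
Qed.

Lemma cmod_le_ReIm z : cmod z <= `|complex.Re z| + `|complex.Im z|.
Proof.
case: z => a b; rewrite /cmod normc_def /=.
rewrite -(@ger0_norm _ (`|a| + `|b|)) ?addr_ge0// -sqrtr_sqr ler_wsqrtr//.
rewrite sqrrD !real_normK ?num_real// -addrA [_ *+ 2 + _]addrC addrA lerDl.
by rewrite mulrn_wge0// mulr_ge0.
Qed.

Lemma conjcM z z' : conjc (z * z') = conjc z * conjc z'.
Proof. exact: rmorphM. Qed.

Lemma conjc_sum (I : Type) (s : seq I) (P : pred I) (f : I -> R[i]) :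
  conjc (\sum_(i <- s | P i) f i) = \sum_(i <- s | P i) conjc (f i).
Proof. exact: rmorph_sum. Qed.

End Cis.
Arguments cis {R} x : simpl never.
Arguments cmod {R} z : simpl never.
Arguments conjc {R} x : simpl never.

(** * Pointwise bounds for the partial sums of the kernel *)

Section Abel.
Context {R : realType}.
Implicit Types (r u : R).
Local Open Scope complex_scope.

(** Abel summation with weights [v k ^+ 2].  As
    [v k ^+ 2 - v k.+1 ^+ 2 <= 2 v k (v k - v k.+1)], partial sums of size
    [B / v k] still give a telescoping bound. *)
Lemma abel_bound (v c : nat -> R) (B : R) (M N : nat) : (M <= N)%N ->
    (forall k, (M <= k)%N -> 0 <= v k.+1 <= v k) -> 
    (forall k, (M <= k)%N -> `|\sum_(M <= j < k.+1) c j| * v k <= B) ->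
  `|\sum_(M <= k < N) v k ^+ 2 * c k| <= 2 * B * v M.
Proof.
move=> MN vdec hB.
pose C k := \sum_(M <= j < k) c j.
have C0 : C M = 0 by rewrite /C big_geq.
have v0 k : (M <= k)%N -> 0 <= v k by move=> /vdec/andP[a b]; apply: le_trans b.
have B0 : 0 <= B by apply: le_trans (hB M (leqnn _)); rewrite mulr_ge0// v0.
have E : \sum_(M <= k < N) v k ^+ 2 * c k =
    \sum_(M <= k < N) (v k ^+ 2 - v k.+1 ^+ 2) * C k.+1 + v N ^+ 2 * C N.
  rewrite -(subnKC MN); elim: (N - M)%N => [|d IH].
    by rewrite addn0 !big_geq// C0 mulr0 addr0.
  rewrite addnS !big_nat_recr ?leq_addr//= IH.
  have -> : C (M + d).+1 = C (M + d)%N + c (M + d)%N.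
    by rewrite /C big_nat_recr// leq_addr.
  ring.
have last : `|v N ^+ 2 * C N| <= B * v N.
  move: MN; rewrite leq_eqVlt => /orP[/eqP<-|].
    by rewrite C0 mulr0 normr0 mulr_ge0// v0.
  case: (N) => // n; rewrite ltnS => Mn.
  have /andP[vn0 vn] := vdec _ Mn.
  rewrite normrM ger0_norm ?sqr_ge0// expr2 -mulrA mulrC ler_wpM2r//.
  apply: le_trans (hB _ Mn); rewrite mulrC ler_wpM2l//.
have main : \sum_(M <= k < N) `|(v k ^+ 2 - v k.+1 ^+ 2) * C k.+1|
    <= \sum_(M <= k < N) 2 * B * (v k - v k.+1).
  rewrite big_seq [leRHS]big_seq; apply: ler_sum => k.
  rewrite mem_index_iota => /andP[Mk _].
  have /andP[vk0 vk] := vdec _ Mk; have h : `|C k.+1| * v k <= B by exact: hB.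
  rewrite normrM subr_sqr normrM (@ger0_norm _ (v k - _)) ?subr_ge0//.
  rewrite (@ger0_norm _ (v k + _)) ?addr_ge0 ?v0 ?leqW//.
  rewrite [leRHS]mulrC -!mulrA ler_wpM2l ?subr_ge0//.
  have := ler_wpM2r (normr_ge0 (C k.+1)) vk => h'.
  by rewrite mulrDl; lra.
rewrite E (le_trans (ler_normD _ _))//.
have T : \sum_(M <= k < N) 2 * B * (v k - v k.+1) = 2 * B * (v M - v N).
  rewrite -big_distrr /=; congr (_ * _).
  rewrite -[RHS]opprB -telescope_sumr// -sumrN.
  by apply: eq_bigr => k _; rewrite opprB.
have := le_trans (ler_norm_sum _ _ _) main; rewrite T => h.
have := mulr_ge0 B0 (v0 _ MN); lra.
Qed.

Lemma cos_phase_sumE (a b : nat) u al :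
  \sum_(a <= k < b) cos (k%:R * u - al) =
  complex.Re (cis (- al) * \sum_(a <= k < b) cis u ^+ k).
Proof.
rewrite big_distrr /= (raddf_sum (@complex.Re R : Rcomplex R -> R)).
by apply: eq_bigr => k _; rewrite -cisMn -cisD addrC.
Qed.

(** The trivial bound, and the bound by the inverse chord that holds away from
    the multiples of [2 pi]. *)
Lemma cos_phase_sum_le_card (a b : nat) u al :
  `|\sum_(a <= k < b) cos (k%:R * u - al)| <= (b - a)%:R.
Proof.
apply: le_trans (ler_norm_sum _ _ _) _.
rewrite -(sumr_const_nat b a 1).
by apply: ler_sum => k _; rewrite ler_norml cos_geN1 cos_le1.
Qed.

Lemma cos_phase_sum_le (a b : nat) u al : cis u != 1 ->
  `|\sum_(a <= k < b) cos (k%:R * u - al)| <= 2 / cmod (cis u - 1).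
Proof.
move=> u1.
have d0 : 0 < cmod (cis u - 1).
  by rewrite lt0r cmod_ge0 andbT; apply: contra u1 => /eqP h; rewrite -subr_eq0 -normr_eq0 cmodE h.
have [ba|ab] := leqP b a.
  by rewrite big_geq// normr0 divr_ge0// ltW.
rewrite cos_phase_sumE (le_trans (ler_Re_cmod _))// cmodM cmod_cis mul1r.
rewrite ler_pdivlMr// -cmodM.
have -> : (\sum_(a <= k < b) cis u ^+ k) * (cis u - 1) = cis u ^+ b - cis u ^+ a.
  rewrite big_distrl /= -(telescope_sumr (fun k => cis u ^+ k)) ?(ltnW ab)//.
  by apply: eq_bigr => k _; rewrite mulrBr mulr1 exprSr.
rewrite (le_trans (cmodD _ _))// cmodN -!cisMn !cmod_cis; lra.
Qed.

Lemma powR_nat_dec r (k : nat) : 0 <= r -> (1 <= k)%N ->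
  0 <= (k.+1%:R : R) `^ (- r) <= k%:R `^ (- r).
Proof.
move=> r0 k1; rewrite powR_ge0/= !powRN lef_pV2 ?posrE ?powR_gt0 ?ltr0n//.
by apply: ge0_ler_powR; rewrite ?nnegrE ?ler0n// ler_nat.
Qed.

Lemma powR_half_sq r (k : nat) : (k%:R : R) `^ (- r / 2) ^+ 2 = k%:R `^ (- r).
Proof. by rewrite -powR_mulrn ?powR_ge0// -powRrM divfK. Qed.

(** Interpolating the two bounds of the Dirichlet kernel with weight [th], and
    summing by parts with [v k = k `^ (- r / 2)], bounds all partial sums by
    a power of the inverse chord with exponent less than one as soon as
    [0 < th].  This holds for every [r > 0], although the series of the
    coefficients diverges when [r <= 1]. *)
Lemma series_bound r al u (th : R) (N : nat) :
    0 < r -> 0 <= th <= 1 -> th <= r / 2 -> cis u != 1 ->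
  `|\sum_(1 <= k < N) k%:R `^ (- r) * cos (k%:R * u - al)| <=
  2 * (2 / cmod (cis u - 1)) `^ (1 - th).
Proof.
move=> r0 /andP[th0 th1] thr u1.
have [N1|N1] := leqP N 1.
  by rewrite big_geq// normr0 mulr_ge0// powR_ge0.
under eq_bigr do rewrite -powR_half_sq.
apply: le_trans (@abel_bound (fun k => k%:R `^ (- r / 2)) _ ((2 / cmod (cis u - 1)) `^ (1 - th)) _ _ _ _ _) _ => //.
- exact: ltnW.
- by move=> k k1; rewrite mulNr powR_nat_dec// divr_ge0// ltW.
- move=> k k1; set C := `|_|.
  have C1 : C <= k%:R by apply: le_trans (cos_phase_sum_le_card _ _ _ _) _; rewrite subn1.
  have C2 : C <= 2 / cmod (cis u - 1) by exact: cos_phase_sum_le.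
  have C0 : 0 <= C by exact: normr_ge0.
  have -> : C = C `^ th * C `^ (1 - th).
    rewrite -powRD; last by rewrite subrKC oner_eq0.
    by rewrite subrKC powRr1.
  have h1 : C `^ th <= k%:R `^ th by apply: ge0_ler_powR; rewrite ?nnegrE ?ler0n.
  have h2 : C `^ (1 - th) <= (2 / cmod (cis u - 1)) `^ (1 - th).
    by apply: ge0_ler_powR; rewrite ?nnegrE ?subr_ge0 ?divr_ge0 ?cmod_ge0.
  have h3 : k%:R `^ th * k%:R `^ (- r / 2) <= 1 :> R.
    rewrite -powRD; last by apply/implyP => _; rewrite pnatr_eq0 -lt0n.
    rewrite -[leRHS](powRr0 k%:R); apply: ler_powR; first by rewrite ler1n.
    by rewrite mulNr subr_le0.
  rewrite mulrAC -[leRHS]mul1r ler_pM ?mulr_ge0 ?powR_ge0//.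
  by apply: le_trans h3; rewrite ler_wpM2r ?powR_ge0.
- by rewrite powR1 mulr1.
Qed.

Lemma series_cvg r al u : 0 < r -> cis u != 1 ->
  cvgn (fun n => \sum_(1 <= k < n) k%:R `^ (- r) * cos (k%:R * u - al)).
Proof.
move=> r0 u1.
pose w k := (k%:R : R) `^ (- r) * cos (k%:R * u - al).
rewrite (_ : (fun n => _) = series w); last first.
  (* the term of index 0 vanishes because 0 `^ (- r) = 0 *)
  apply/funext => -[|n]; first by rewrite /series /= !big_geq.
  by rewrite /series /= [in RHS]big_nat_recl// /w powR0 ?oppr_eq0 ?gt_eqF// mul0r add0r big_add1.
apply/cauchy_cvgP/cauchy_seriesP => e e0.
set K := 2 / cmod (cis u - 1).
have K0 : 0 <= K by rewrite divr_ge0 ?cmod_ge0.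
have tail M N : (1 <= M)%N -> `|\sum_(M <= k < N) w k| <= 2 * K * (M%:R) `^ (- r).
  move=> M1; have [NM|MN] := leqP N M.
    by rewrite big_geq// normr0 mulr_ge0 ?powR_ge0// mulr_ge0.
  rewrite /w; under eq_bigr do rewrite -powR_half_sq.
  apply: le_trans (@abel_bound (fun k => k%:R `^ (- r / 2)) _ (K * M%:R `^ (- r / 2)) _ _ _ _ _) _.
  - exact: ltnW.
  - move=> k Mk; rewrite mulNr powR_nat_dec//; last exact: leq_trans Mk.
    by rewrite divr_ge0// ltW.
  - move=> k Mk; apply: ler_pM; rewrite ?powR_ge0//; first exact: cos_phase_sum_le.
    rewrite mulNr !powRN lef_pV2 ?posrE ?powR_gt0 ?ltr0n ?(leq_trans M1)//.
    by apply: ge0_ler_powR; rewrite ?nnegrE ?ler0n ?ler_nat// divr_ge0// ltW.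
  - by rewrite -powR_half_sq expr2 !mulrA.
have [M M1 hM] : exists2 M, (1 <= M)%N & forall m, (M <= m)%N -> 2 * K * (m%:R : R) `^ (- r) < e.
  pose X := (2 * K / e + 1) `^ r^-1.
  have X0 : 0 <= X by exact: powR_ge0.
  exists (Num.truncn X).+1 => // m Mm.
  have Xm : X < m%:R by apply: lt_le_trans (truncnS_gt _) _; rewrite ler_nat.
  have p1 : 0 < 2 * K / e + 1.
    have q1 : 0 <= 2 * K / e by apply: divr_ge0; [exact: mulr_ge0|exact: ltW].
    by lra.
  have : 2 * K / e + 1 < m%:R `^ r.
    have : X `^ r < m%:R `^ r.
      by apply: gt0_ltr_powR => //; rewrite nnegrE.
    by rewrite /X -powRrM mulVf ?gt_eqF// powRr1 // ltW.
  set P := _ `^ r => hP; have P0 : 0 < P by exact: lt_trans hP.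
  rewrite powRN -/P ltr_pdivrMr// [ltRHS]mulrC -ltr_pdivrMr//.
  by apply: lt_trans hP; rewrite ltrDl.
exists ([set n | (M <= n)%N], [set n | (M <= n)%N]) => /=.
  by split; exists M.
case=> a b /= [Ma Mb].
apply: le_lt_trans (tail _ _ _) (hM _ _) => //; exact: leq_trans Ma.
Qed.

End Abel.

(** * The singularity of the kernel is integrable *)

Section Chord.
Context {R : realType}.
Implicit Types (u v : R).
Local Open Scope complex_scope.

Lemma cos_pi4 : 2^-1 <= cos (pi / 4 : R).
Proof.
have p0 := @pi_gt0 R.
have c0 : 0 <= cos (pi / 4 : R) by apply: cos_ge0_pihalf; lra.
have : cos (pi / 4 + pi / 4 : R) = 0.
  by rewrite -[RHS](@cos_pihalf R); congr cos; lra.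
rewrite cosD -!expr2 sin2cos2; set c := cos _ => h.
by rewrite -(@ler_pXn2r _ 2) ?nnegrE ?invr_ge0// ; lra.
Qed.

Lemma sin_ge_quarter v : 0 <= v <= pi / 2 -> v / 4 <= sin v.
Proof.
move=> /andP[v0 v2]; have p0 := @pi_gt0 R; have p2 := @pihalf_lt2 R.
have [v4|v4] := leP v (pi / 4).
  have dsin x : x \in `]0, v[%R -> is_derive x 1 (@sin R) (cos x).
    by move=> _; exact: is_derive_sin.
  have csin : {within `[0, v], continuous (@sin R)}.
    by apply: continuous_subspaceT => x; exact: continuous_sin.
  have [c + E] := MVT_segment v0 dsin csin.
  rewrite in_itv/= => /andP[c0 cv].
  have : sin v = cos c * v by move: E; rewrite sin0 !subr0.
  move=> ->; rewrite mulrC ler_wpM2r//.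
  apply: (@le_trans _ _ (cos (pi / 4))).
    by apply: le_trans cos_pi4; lra.
  rewrite leNgt ltr_cos ?in_itv/= -?leNgt; lra.
apply: (@le_trans _ _ (sin (pi / 4))); last first.
  by rewrite ltW// ltr_sin ?in_itv/=; lra.
have -> : sin (pi / 4) = cos (pi / 4 : R).
  by rewrite -cosBpihalf -cosN; congr cos; lra.
by apply: le_trans cos_pi4; lra.
Qed.

(** The chord is at least a quarter of the arc. *)
Lemma chord_ge u : `|u| <= pi -> `|u| / 4 <= cmod (cis u - 1).
Proof.
move=> up.
have h0 : 0 <= `|u| by [].
have h : `|u| / 8 <= sin (`|u| / 2).
  by have := @sin_ge_quarter (`|u| / 2); lra.
have E : (`|u| / 4) ^+ 2 <= cmod (cis u - 1) ^+ 2.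
  have -> : cmod (cis u - 1) ^+ 2 = 4 * sin (`|u| / 2) ^+ 2.
    apply: complexI; rewrite rmorphXn /= -cmodE -add_Re2_Im2.
    congr (_%:C) => /=.
    have -> : sin (`|u| / 2) ^+ 2 = sin (u / 2) ^+ 2.
      have [_|_] := ger0P u => //.
      by rewrite mulNr sinN sqrrN.
    have -> : u = u / 2 + u / 2 by rewrite -splitr.
    rewrite cosD sinD -!splitr; have := cos2Dsin2 (u / 2).
    set s := sin _; set c := cos _ => cs.
    have -> : c * c = 1 - s ^+ 2 by rewrite -cs; ring.
    have -> : (s * c + c * s - 0) ^+ 2 = 4 * s ^+ 2 * (c * c) by ring.
    have -> : c * c = 1 - s ^+ 2 by rewrite -cs; ring.
    by ring.
  have -> : 4 * sin (`|u| / 2) ^+ 2 = (2 * sin (`|u| / 2)) ^+ 2 by ring.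
  by rewrite ler_pXn2r ?nnegrE//; lra.
by move: E; rewrite ler_pXn2r ?nnegrE ?cmod_ge0 ?divr_ge0.
Qed.

Lemma cis_period u (k : int) : cis (u - k%:~R * (2 * pi)) = cis u.
Proof. by rewrite cisD -mulNr -mulrNz cisMz cis2pi exp1rz mulr1. Qed.

(** An upper bound for the reciprocal of the chord, for differences of two
    points of [0, 2 pi); the three summands account for the three possible
    nearest multiples of [2 pi]. *)
Lemma inv_chord_le (al u : R) : 0 <= al -> `|u| < 2 * pi -> cis u != 1 ->
  (2 / cmod (cis u - 1)) `^ al <=
  (8 / `|u|) `^ al + ((8 / `|u - 2 * pi|) `^ al + (8 / `|u + 2 * pi|) `^ al).
Proof.
move=> al0 u2 u1; have p0 := @pi_gt0 R.
have key (k : int) : `|u - k%:~R * (2 * pi)| <= pi ->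
    (2 / cmod (cis u - 1)) `^ al <= (8 / `|u - k%:~R * (2 * pi)|) `^ al.
  set w := u - _ => wp; have := chord_ge wp; rewrite cis_period => h.
  have w0 : w != 0.
    apply: contra u1 => /eqP w0; rewrite -(cis_period u k) -/w w0; exact/eqP/cis0.
  have aw0 : 0 < `|w| by rewrite normr_gt0.
  apply: ge0_ler_powR => //; rewrite ?nnegrE ?divr_ge0 ?cmod_ge0//.
  have -> : 8 / `|w| = 2 / (`|w| / 4) by field; rewrite normr_eq0.
  by rewrite ler_pM2l// lef_pV2 ?posrE ?divr_gt0//; apply: lt_le_trans h; rewrite divr_gt0.
have P (z : R) : 0 <= (8 / `|z|) `^ al by exact: powR_ge0.
have [h1|h1] := leP `|u| pi.
  have := key 0; rewrite mul0r subr0 => /(_ h1) h.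
  by have := P (u - 2 * pi); have := P (u + 2 * pi); lra.
have [u0|u0] := leP 0 u.
  have := key 1; rewrite mul1r => h.
  have /h : `|u - 2 * pi| <= pi.
    by move: u2 h1; rewrite ger0_norm// => ? ?; rewrite ler_norml; lra.
  by have := P u; have := P (u + 2 * pi); lra.
have := key (-1); rewrite mulrNz mulNr mul1r opprK => h.
have /h : `|u + 2 * pi| <= pi.
  by move: u2 h1; rewrite ltr0_norm// => ? ?; rewrite ler_norml; lra.
by have := P u; have := P (u - 2 * pi); lra.
Qed.

End Chord.
Section Singularity.
Context {R : realType}.
Notation mu := (@lebesgue_measure R).

Lemma measurable_dist_powR (a p : R) (D : set (measurableTypeR R)) :
  measurable_fun D (fun y : R => `|y - a| `^ p).
Proof.
apply: measurable_funTS.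
apply: (measurableT_comp (@measurable_powR R p)).
apply: (measurableT_comp (@normr_measurable R setT)).
exact: measurable_funB.
Qed.

(** [`|y - a| `^ - al] with [al < 1] is dominated by the sum over [j] of
    [(2 `^ al) ^+ j] on the ball of radius [16 / 2 ^+ j]. *)
Lemma integrable_dist_powR (D : set (measurableTypeR R)) (a al : R) :
    measurable D -> 0 <= al < 1 -> (forall y, D y -> `|y - a| < 16) ->
  mu.-integrable D (fun y => (`|y - a| `^ (- al))%:E).
Proof.
move=> mD /andP[al0 al1] hD; apply/integrableP; split.
  by apply/measurable_EFinP; exact: measurable_dist_powR.
pose q := 2 `^ al : R.
have q0 : 0 < q by rewrite powR_gt0.
have q1 : 1 <= q by rewrite -(powRr0 2) ler_powR// ler1n.
have q2 : q / 2 < 1.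
  rewrite ltr_pdivrMr// mul1r /q /powR pnatr_eq0/=.
  by rewrite -[ltRHS](@lnK R 2) ?posrE// ltr_expR gtr_pMl// ln_gt0// ltr1n.
pose B j := (ball a (16 / 2 ^+ j) : set (measurableTypeR R)).
have mB j : measurable (B j) by exact: measurable_ball.
pose h j y := ((q ^+ j)%:E * (\1_(B j) y)%:E : \bar R)%E.
have h0 j y : (0 <= h j y)%E by rewrite mule_ge0// lee_fin ?exprn_ge0// ltW.
have mh j : measurable_fun D (h j).
  apply/measurable_EFinP; exact: measurable_funM.
apply: (@le_lt_trans _ _ (\int[mu]_(y in D) \sum_(0 <= j <oo) h j y)%E).
  apply: ge0_le_integral => //=.
  - by apply/measurable_EFinP/measurableT_comp => //; exact: measurable_dist_powR.
  - by apply: ge0_emeasurable_sum.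
  move=> y Dy; rewrite ger0_norm ?powR_ge0//.
  suff [j hj] : exists j, ((`|y - a| `^ (- al))%:E <= h j y)%E.
    apply: (le_trans hj).
    have := @nneseries_lim_ge _ (fun j => h j y) xpredT 0%N j.+1 (fun j _ _ => h0 j y).
    apply: le_trans; rewrite big_nat_recr//= leeDr//.
    by apply: sume_ge0 => i _; exact: h0.
  (* at [y = a] the left-hand side is [0 `^ (- al) <= 1] *)
  have [->|ya] := eqVneq y a.
    exists 0%N; rewrite /h expr0 mul1e indicE mem_set; last first.
      by apply: ballxx; rewrite divr_gt0.
    rewrite subrr normr0 lee_fin; have [->|] := eqVneq al 0.
      by rewrite oppr0 powRr0.
    by move=> al00; rewrite powR0// oppr_eq0.
  have t0 : 0 < `|y - a| by rewrite normr_gt0 subr_eq0.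
  have exj : exists j, 8 / 2 ^+ j <= `|y - a|.
    exists (Num.truncn (8 / `|y - a|)).+1.
    rewrite ler_pdivrMr ?exprn_gt0// mulrC -ler_pdivrMr//.
    apply: (le_trans (ltW (truncnS_gt _))).
    by rewrite -natrX ler_nat ltnW// ltn_expl.
  (* the least [j] with [8 / 2 ^+ j <= |y - a|] gives the innermost ball *)
  case: (ex_minnP exj) => j hj jmin; exists j.
  rewrite /h -EFinM indicE mem_set; last first.
    rewrite /B -ball_normE/= distrC; case: j hj jmin => [|j] hj jmin.
      by rewrite expr0 divr1 hD.
    rewrite ltNge; apply/negP => k.
    suff : (j.+1 <= j)%N by rewrite ltnn.
    apply: jmin; apply: le_trans k.
    by rewrite exprS invfM mulrA; apply: ler_wpM2r; rewrite ?invr_ge0 ?exprn_ge0//; lra.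
  rewrite mulr1 lee_fin /q -powR_mulrn ?powR_ge0// -powRrM mulrC powRrM powR_mulrn//.
  have c0 : 0 < (2 ^+ j : R) by rewrite exprn_gt0.
  have -> : `|y - a| `^ (- al) = `|y - a|^-1 `^ al.
    by rewrite -powR_inv1// -powRrM mulN1r.
  apply: ge0_ler_powR; rewrite ?nnegrE ?invr_ge0 ?(ltW c0)//.
  rewrite -[leRHS]invrK lef_pV2 ?posrE ?invr_gt0//.
  apply: le_trans hj; rewrite ler_peMl ?invr_ge0 ?(ltW c0)//; lra.
rewrite integral_nneseries//.
apply: (@le_lt_trans _ _ (\sum_(0 <= j <oo) (32 * (q / 2) ^+ j)%:E)%E).
  apply: lee_nneseries => j _; first by move=> _; exact: integral_ge0.
  rewrite ge0_integralZl//; last 2 first.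
  - by apply/measurable_EFinP; exact: measurable_indic.
  - by rewrite lee_fin exprn_ge0// ltW.
  rewrite integral_indic//.
  apply: (@le_trans _ _ ((q ^+ j)%:E * mu (B j))%E).
    rewrite lee_wpmul2l ?lee_fin ?exprn_ge0 ?(ltW q0)//.
    by apply: le_measure; rewrite ?inE//; exact: measurableI.
  rewrite lebesgue_measure_ball ?divr_ge0 ?exprn_ge0// -EFinM lee_fin.
  by rewrite expr_div_n -mulr_natl le_eqVlt; apply/orP; left; apply/eqP; field; rewrite expf_neq0.
apply: (@le_lt_trans _ _ (32 / (1 - q / 2))%:E); last by rewrite ltry.
apply: lime_le.
  by apply: is_cvg_nneseries => n _ _; rewrite lee_fin mulr_ge0// exprn_ge0// divr_ge0// ltW.
apply: nearW => n /=; rewrite sumEFin lee_fin.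
have := @geometric_le_lim R n 32 (q / 2).
apply => //; first by rewrite divr_gt0.
by rewrite gtr0_norm// divr_gt0.
Qed.

End Singularity.

(** * Integrals of trigonometric functions over a period *)

Section TrigIntegrals.
Context {R : realType}.
Notation mu := (@lebesgue_measure R).
Notation D := (`[0, 2 * pi[%classic : set (measurableTypeR R)).

Lemma cosMcos (u v : R) :
  cos u * cos v = 2^-1 * cos (u + v) + 2^-1 * cos (u - v).
Proof. by rewrite cosB cosD -mulrDr addrACA addNr addr0; lra. Qed.

Lemma is_derive_cos_affine (a b y : R) :
  is_derive y 1 (fun y : R => sin (a * y + b)) (a * cos (a * y + b)).
Proof.
have h : is_derive y 1 (fun y : R => a * y + b) a.
  have := is_deriveD (is_deriveZ a (is_derive_id y 1)) (is_derive_cst b y 1).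
  by rewrite addr0 /GRing.scale /= mulr1.
have := @is_derive1_comp R sin (fun y => a * y + b) y _ _ (is_derive_sin _) h.
  by rewrite mulrC.
Qed.

Lemma continuous_cos_affine (a b : R) : continuous (fun y : R => cos (a * y + b)).
Proof.
move=> y; apply: continuous_comp; last exact: continuous_cos.
by apply: cvgD; [exact: mulrl_continuous|exact: cvg_cst].
Qed.

Lemma integral_cos_affine (n : int) (b : R) :
  (\int[mu]_(y in D) (cos (n%:~R * y + b))%:E =
   (if n == 0 then 2 * pi * cos b else 0)%:E)%E.
Proof.
have p0 : 0 < 2 * pi :> R by rewrite mulr_gt0// pi_gt0.
case: eqVneq => [->|n0].
  under eq_integral do rewrite mul0r add0r.
  rewrite integral_cst//= lebesgue_measure_itv/= lte_fin p0 -EFinB -EFinM.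
  by congr (_%:E); ring.
have nR : n%:~R != 0 :> R by rewrite intr_eq0.
rewrite integral_itv_bndo_bndc; last first.
  apply: measurable_funTS; apply/measurable_EFinP.
  by apply: continuous_measurable_fun; exact: continuous_cos_affine.
rewrite (@continuous_FTC2 _ _ (fun y => n%:~R^-1 * sin (n%:~R * y + b)))//.
- rewrite mulr0 add0r -EFinB; congr (_%:E).
  have -> : sin (n%:~R * (2 * pi) + b) = sin b.
    have := cisMz n (2 * pi : R); rewrite cis2pi exp1rz => -[c s].
    by rewrite sinD c s mul1r mul0r add0r.
  by rewrite subrr.
- by apply: continuous_subspaceT => y; exact: continuous_cos_affine.
- have dF (y : R) : is_derive y 1 (fun y : R => n%:~R^-1 * sin (n%:~R * y + b)) (cos (n%:~R * y + b)).
    have := is_deriveZ (n%:~R^-1) (is_derive_cos_affine n%:~R b y).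
    by rewrite /GRing.scale/= mulrA mulVf// mul1r.
  have cF : continuous (fun y : R => n%:~R^-1 * sin (n%:~R * y + b)).
    move=> y; apply: differentiable_continuous; apply/derivable1_diffP.
    exact: ex_derive.
  split.
  + by move=> y _; exact: ex_derive.
  + by apply: cvg_at_right_filter; exact: cF.
  + by apply: cvg_at_left_filter; exact: cF.
- move=> y _; rewrite derive1E.
  have := is_deriveZ (n%:~R^-1) (is_derive_cos_affine n%:~R b y).
  rewrite /GRing.scale/= mulrA mulVf// mul1r => h.
  exact: derive_val.
Qed.

Lemma integrable_continuous_torus1 (f : R -> R) : continuous f ->
  mu.-integrable D (EFin \o f).
Proof.
move=> cf; apply: (@integrableS _ _ _ mu `[0, 2 * pi]%classic D (EFin \o f)) => //.
  by move=> y /=; rewrite !in_itv/= => /andP[-> /ltW].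
apply: continuous_compact_integrable; first exact: segment_compact.
exact: continuous_subspaceT.
Qed.

Lemma integral_cos_cos (k l : nat) (al b x : R) : (0 < k)%N -> (0 < l)%N ->
  (\int[mu]_(y in D) (cos (k%:R * y + b) * cos (l%:R * (x - y) - al))%:E =
   (if k == l then pi * cos (k%:R * x - al + b) else 0)%:E)%E.
Proof.
move=> k0 l0.
pose c1 := b + l%:R * x - al; pose c2 := b - l%:R * x + al.
transitivity (\int[mu]_(y in D) ((2^-1 * cos ((k%:Z - l%:Z)%:~R * y + c1))%:E
  + (2^-1 * cos ((k%:Z + l%:Z)%:~R * y + c2))%:E))%E.
  apply: eq_integral => y _; rewrite -EFinD; congr (_%:E).
  have -> : (k%:Z - l%:Z)%:~R * y + c1 = (k%:R * y + b) + (l%:R * (x - y) - al).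
    by rewrite /c1 intrB -!pmulrn; ring.
  have -> : (k%:Z + l%:Z)%:~R * y + c2 = (k%:R * y + b) - (l%:R * (x - y) - al).
    by rewrite /c2 intrD -!pmulrn; ring.
  exact: cosMcos.
have int n c : mu.-integrable D (fun y => (2^-1 * cos (n%:~R * y + c))%:E).
  apply: integrable_continuous_torus1 => y.
  by apply: cvgM; [exact: cvg_cst|exact: continuous_cos_affine].
have I n c : (\int[mu]_(y in D) (2^-1 * cos (n%:~R * y + c))%:E =
   (2^-1 * (if n == 0 then 2 * pi * cos c else 0))%:E)%E.
  under eq_integral do rewrite EFinM.
  rewrite integralZl//; last first.
    by apply: integrable_continuous_torus1; exact: continuous_cos_affine.
  by rewrite integral_cos_affine -EFinM.
rewrite integralD// !I -EFinD; congr (_%:E).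
have -> : (k%:Z + l%:Z == 0) = false by lia.
rewrite mulr0 addr0 subr_eq0 eqz_nat.
case: eqP => [->|_]; last by rewrite mulr0.
rewrite mulrA mulrA mulVf// mul1r; congr (_ * cos _); rewrite /c1; ring.
Qed.

End TrigIntegrals.

(** * Fourier coefficients of the kernel *)

Section BernoulliKernel.
Context {R : realType}.
Variables (r : R) (r0 : 0 < r).
Notation mu := (@lebesgue_measure R).
Notation D := (`[0, 2 * pi[%classic : set (measurableTypeR R)).
Implicit Types (u x y : R).

(** Partial sums of the Bernoulli kernel [F1 r]. *)
Definition F1_partial (N : nat) u : R :=
  1 + 2 * \sum_(1 <= k < N) (k%:R `^ (- r)) * cos (k%:R * u - r * pi / 2).

Lemma F1_partial_cvg u : cis u != 1 -> F1_partial ^~ u @ \oo --> F1 r u.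
Proof.
move=> u1; apply: cvgD; first exact: cvg_cst.
apply: cvgM; first exact: cvg_cst.
exact: series_cvg.
Qed.

(** At the multiples of [2 pi] the value of [F1 r] is arbitrary, but it is the
    same at all of them; this is what makes [F1 r] measurable. *)
Lemma F1_cis1 u : cis u = 1 -> F1 r u = F1 r 0.
Proof.
move=> u1; rewrite /F1.
suff -> : (fun n => \sum_(1 <= k < n) k%:R `^ (- r) * cos (k%:R * u - r * pi / 2)) =
  (fun n => \sum_(1 <= k < n) k%:R `^ (- r) * cos (k%:R * 0 - r * pi / 2)) by [].
apply/funext => n; apply: eq_bigr => k _; congr (_ * _).
have E : cis (k%:R * u) = 1 by rewrite cisMn u1 expr1n.
case: E => c s; rewrite mulr0 !cosB c s cos0 sin0; ring.
Qed.

Lemma measurable_F1_partial (N : nat) : measurable_fun [set: measurableTypeR R] (F1_partial N).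
Proof.
apply: measurable_funD => //; apply: measurable_funM => //.
apply: measurable_sum => k; apply: measurable_funM => //.
by apply: continuous_measurable_fun; exact: continuous_cos_affine.
Qed.

Lemma measurable_F1 : measurable_fun [set: measurableTypeR R] (F1 r).
Proof.
pose h N u := if cis u == 1 then F1 r 0 else F1_partial N u.
apply: (@measurable_fun_cvg _ _ _ _ h) => [N|u _]; last first.
  rewrite /h; case: eqP => [u1|/eqP u1]; last exact: F1_partial_cvg.
  rewrite F1_cis1//; exact: cvg_cst.
apply: measurable_fun_ifT => //; last exact: measurable_F1_partial.
rewrite (_ : (fun _ => _) = (fun u => (cos u == 1) && (sin u == 0))); last first.
  by apply/funext => u; rewrite eq_complex.
apply: measurable_and; apply: measurable_fun_eqr => //.
- by apply: continuous_measurable_fun; exact: continuous_cos.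
- by apply: continuous_measurable_fun; exact: continuous_sin.
Qed.

Lemma cis_diff_neq1 x y : D x -> D y -> x != y -> cis (x - y) != 1.
Proof.
rewrite /= !in_itv/= => /andP[x0 x2] /andP[y0 y2] xy.
have [xy'|xy'|E] := ltgtP x y; last by rewrite E eqxx in xy.
- rewrite -opprB cisN; apply/eqP => h.
  have : cis (y - x) = 1 by rewrite -[LHS]conjcK h conjc1.
  by apply/eqP; apply: cis_neq1; lra.
- by apply: cis_neq1; lra.
Qed.

(** The Fourier coefficients of [F1 r] are the expected ones: term by term
    integration is justified by dominated convergence. *)
Lemma integral_cos_F1 (k : nat) (b x : R) : (0 < k)%N -> D x ->
  mu.-integrable D (fun y => (cos (k%:R * y + b) * F1 r (x - y))%:E) /\
  (\int[mu]_(y in D) (cos (k%:R * y + b) * F1 r (x - y))%:E =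
   (2 * pi * (k%:R `^ (- r) * cos (k%:R * x - r * pi / 2 + b)))%:E)%E.
Proof.
move=> k0 Dx; have p0 := @pi_gt0 R.
have mD : measurable D by exact: measurable_itv.
have mfun (f : R -> R) : measurable_fun [set: measurableTypeR R] f ->
    measurable_fun D (fun y => (cos (k%:R * y + b) * f (x - y))%:E).
  move=> mf; apply: measurable_funTS; apply/measurable_EFinP.
  apply: measurable_funM.
    by apply: continuous_measurable_fun; exact: continuous_cos_affine.
  by apply: measurableT_comp => //; exact: measurable_funB.
(* any exponent in (0, 1] that is at most [r / 2] would do *)
pose th := Order.min (r / 2) 1.
have th0 : 0 < th by rewrite lt_min divr_gt0// ltr01.
have th1 : th <= 1 by rewrite ge_min lexx orbT.
have thr : th <= r / 2 by rewrite ge_min lexx.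
pose al := 1 - th.
have al0 : 0 <= al by rewrite subr_ge0.
have al1 : al < 1 by rewrite /al; lra.
pose S (a y : R) := `|y - a| `^ (- al).
pose g (y : R) := 1 + 4 * (8 `^ al * (S x y + (S (x - 2 * pi) y + S (x + 2 * pi) y))).
have intS a : (forall y, D y -> `|y - a| < 16) -> mu.-integrable D (fun y => (S a y)%:E).
  by move=> h; apply: integrable_dist_powR => //; rewrite al0.
have pi2 : pi < 4 :> R by have := @pihalf_lt2 R; lra.
move: (Dx); rewrite /= in_itv/= => /andP[x0 x2].
have ig : mu.-integrable D (EFin \o g).
  rewrite (_ : _ \o _ = fun y => ((cst 1 y)%:E + ((4 * 8 `^ al)%:E * ((S x y)%:E + ((S (x - 2 * pi) y)%:E + (S (x + 2 * pi) y)%:E))))%E); last first.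
    by apply/funext => y; rewrite /= /g mulrA.
  apply: integrableD => //.
    by apply: integrable_continuous_torus1; exact: cst_continuous.
  apply: integrableZl => //; apply: integrableD => //; first by
    apply: intS => y; rewrite /= in_itv/= => /andP[y0 y2]; rewrite ltr_norml; lra.
  by apply: integrableD => //; apply: intS => y; rewrite /= in_itv/= => /andP[y0 y2]; rewrite ltr_norml; lra.
have aeP (P : R -> Prop) : (forall y, y != x -> P y) -> {ae mu, forall y, P y}.
  move=> h; exists [set x]; split => //; first exact: lebesgue_measure_set1.
  move=> y /= nP; apply: contrapT => /eqP yx; exact/nP/h.
have bound (N : nat) y : D y -> y != x -> `|F1_partial N (x - y)| <= g y.
  move=> Dy yx; have u1 : cis (x - y) != 1 by apply: cis_diff_neq1 => //; rewrite eq_sym.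
  rewrite (le_trans (ler_normD _ _))// normr1 lerD2l normrM ger0_norm//.
  have -> : 4 * (8 `^ al * (S x y + (S (x - 2 * pi) y + S (x + 2 * pi) y))) =
     2 * (2 * (8 `^ al * (S x y + (S (x - 2 * pi) y + S (x + 2 * pi) y)))) by ring.
  rewrite ler_wpM2l//.
  have hth : 0 <= th <= 1 by rewrite (ltW th0).
  apply: (le_trans (series_bound _ _ r0 hth thr u1)).
  rewrite ler_wpM2l// -/al.
  have xy2 : `|x - y| < 2 * pi.
    by move: Dy; rewrite /= in_itv/= => /andP[y0 y2]; rewrite ltr_norml; lra.
  apply: (le_trans (inv_chord_le al0 xy2 u1)).
  have E w : (8 / `|w|) `^ al = 8 `^ al * `|w| `^ (- al) :> R.
    by rewrite powRM ?invr_ge0// -powR_inv1// -powRrM mulN1r.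
  have -> : x - y - 2 * pi = - (y - (x - 2 * pi)) by ring.
  have -> : x - y + 2 * pi = - (y - (x + 2 * pi)) by ring.
  by rewrite !E -!mulrDr /S !normrN distrC.
pose f_ N y := (cos (k%:R * y + b) * F1_partial N (x - y))%:E.
pose f y := (cos (k%:R * y + b) * F1 r (x - y))%:E.
have Nyx y : y != x -> x != y by rewrite eq_sym.
have f_f : {ae mu, forall y, D y -> f_ ^~ y @ \oo --> f y}.
  apply: aeP => y /Nyx yx Dy; apply: cvg_EFin; first exact: nearW.
  apply: cvgM; first exact: cvg_cst.
  exact/F1_partial_cvg/cis_diff_neq1.
have f_g : {ae mu, forall y n, D y -> (`|f_ n y| <= (EFin \o g) y)%E}.
  apply: aeP => y yx N Dy; rewrite lee_fin normrM -[leRHS]mul1r.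
  by apply: ler_pM => //; [rewrite ler_norml cos_geN1 cos_le1|exact: bound].
have [intf _ cvgf] := dominated_convergence mD
  (fun N => mfun _ (measurable_F1_partial N)) (mfun _ measurable_F1) f_f ig f_g.
split => //.
have If N : (k < N)%N -> (\int[mu]_(y in D) f_ N y =
    (2 * pi * (k%:R `^ (- r) * cos (k%:R * x - r * pi / 2 + b)))%:E)%E.
  move=> kN.
  transitivity (\int[mu]_(y in D) ((cos (k%:Z%:~R * y + b))%:E +
      \sum_(i <- index_iota 1 N) (2 * i%:R `^ (- r) *
        (cos (k%:R * y + b) * cos (i%:R * (x - y) - r * pi / 2)))%:E))%E.
    apply: eq_integral => y _; rewrite /f_ /F1_partial sumEFin -EFinD; congr (_%:E).
    rewrite mulrDr mulr1 -pmulrn; congr (_ + _).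
    rewrite !big_distrr /=; apply: eq_bigr => i _; ring.
  have intc i : mu.-integrable D (fun y => (cos (k%:R * y + b) * cos (i%:R * (x - y) - r * pi / 2))%:E).
    have cc : continuous (fun y => cos (i%:R * (x - y) - r * pi / 2)).
      rewrite (_ : (fun _ => _) = (fun y => cos (- i%:R * y + (i%:R * x - r * pi / 2)))).
        exact: continuous_cos_affine.
      by apply/funext => z; congr cos; ring.
    by apply: integrable_continuous_torus1 => y; apply: cvgM; [exact: continuous_cos_affine|exact: cc].
  have intc2 i : mu.-integrable D (fun y => (2 * i%:R `^ (- r) *
        (cos (k%:R * y + b) * cos (i%:R * (x - y) - r * pi / 2)))%:E).
    rewrite (_ : (fun _ => _) = (fun y => ((2 * i%:R `^ (- r))%:E * (cos (k%:R * y + b) * cos (i%:R * (x - y) - r * pi / 2))%:E)%E)) //.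
    exact: integrableZl.
  rewrite integralD//; last 2 first.
  - by apply: integrable_continuous_torus1; exact: continuous_cos_affine.
  - by apply: integrable_sum.
  rewrite integral_cos_affine eqz_nat gtn_eqF// add0e.
  rewrite integral_sum//.
  under eq_big_seq => i.
    rewrite mem_index_iota => /andP[i1 _].
    under eq_integral do rewrite EFinM.
    rewrite integralZl// integral_cos_cos// -EFinM.
    over.
  rewrite sumEFin; congr (_%:E).
  rewrite (bigD1_seq k) ?iota_uniq//=; last by rewrite mem_index_iota k0.
  rewrite eqxx big1 ?addr0; first by ring.
  by move=> i /negPf ik; rewrite eq_sym ik mulr0.
rewrite -(cvg_lim (@ereal_hausdorff R) cvgf); apply: cvg_lim; first exact: ereal_hausdorff.
apply: cvg_near_cst; exists k.+1 => // N /= kN; exact: If.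
Qed.

End BernoulliKernel.

(** * Integration over the torus *)

Section ScaledRestriction.
Context d (T : measurableType d) (R : realType).
Variables (m : {measure set T -> \bar R}) (E : set T) (mE : measurable E).
Variable k : {nonneg R}.
Implicit Types f : T -> \bar R.

Lemma ge0_integral_mrestr f :
    measurable_fun [set: T] f -> (forall x, 0 <= f x)%E ->
  (\int[mrestr m mE]_x f x = \int[m]_(x in E) f x)%E.
Proof.
move=> mf f0; have mC : measurable (~` E) by exact: measurableC.
have := @ge0_integral_setU _ T R (mrestr m mE) E (~` E) mE mC f.
rewrite setUv => -> //; last by apply/disj_setPCl.
rewrite (@null_set_integral _ _ _ (mrestr m mE) (~` E)) ?adde0//.
- by apply: eq_measure_integral => A mA AT; rewrite /= /mrestr setIidl.
- exact: measurable_funTS.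
- by rewrite /= /mrestr setICl measure0.
Qed.

Lemma ge0_integral_scaled_restr f :
    measurable_fun [set: T] f -> (forall x, 0 <= f x)%E ->
  (\int[mscale k (mrestr m mE)]_x f x = k%:num%:E * \int[m]_(x in E) f x)%E.
Proof. by move=> mf f0; rewrite ge0_integral_mscale// ge0_integral_mrestr. Qed.

Lemma integrable_scaled_restr f : measurable_fun [set: T] f ->
  m.-integrable E f -> (mscale k (mrestr m mE)).-integrable [set: T] f.
Proof.
move=> mf /integrableP[_ h]; apply/integrableP; split => //.
rewrite ge0_integral_scaled_restr//; last exact: measurableT_comp.
by rewrite lte_mul_pinfty// lee_fin.
Qed.

Lemma integral_scaled_restr f : measurable_fun [set: T] f ->
    m.-integrable E f ->
  (\int[mscale k (mrestr m mE)]_x f x = k%:num%:E * \int[m]_(x in E) f x)%E.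
Proof.
move=> mf intf; rewrite [LHS]integralE [X in (_ = _ * X)%E]integralE.
rewrite !ge0_integral_scaled_restr//;
  do ?[exact: measurable_funeneg | exact: measurable_funepos].
have fp : (\int[m]_(x in E) f^\+ x \is a fin_num)%E.
  by apply: integrable_fin_num => //; exact: integrable_funepos.
move: fp; move: (integral m E (f^\+)%E) (integral m E (f^\-)%E) => ip im fp.
by rewrite muleBr//; exact: fin_num_adde_defr.
Qed.

End ScaledRestriction.

Section TorusIntegrals.
Context {R : realType}.
Notation mu := (@lebesgue_measure R).
Notation D := (`[0, 2 * pi[%classic : set (measurableTypeR R)).
Notation R2 := (measurableTypeR R * measurableTypeR R)%type.
Notation mu2 := (mu \x mu)%E.
Notation tm := (@torus_measure R).
Implicit Types f : R2 -> R.

Lemma restrict_tensor (U V : R -> R) :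
  (fun x : R2 => (U x.1 * V x.2)%:E) \_ torus =
  (fun x : R2 => ((U \_ D) x.1 * (V \_ D) x.2)%:E).
Proof.
apply/funext => -[x1 x2]; rewrite /patch /torus in_setX/=.
by do 2 case: (_ \in _); rewrite /= ?mulr0 ?mul0r.
Qed.

Lemma integral_tensor (U V : R -> R) :
    measurable_fun [set: measurableTypeR R] U ->
    measurable_fun [set: measurableTypeR R] V ->
    mu.-integrable D (EFin \o U) -> mu.-integrable D (EFin \o V) ->
  tm.-integrable [set: R2] (fun x => (U x.1 * V x.2)%:E) /\
  \int[tm]_x (U x.1 * V x.2) =
    (2 * pi) ^- 2 * ((\int[mu]_(x in D) U x) * (\int[mu]_(x in D) V x)).
Proof.
move=> mU mV iU iV; have mT := @measurable_torus R.
have mD : measurable D by exact: measurable_itv.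
have mUV : measurable_fun [set: R2] (fun x : R2 => (U x.1 * V x.2)%:E).
  apply/measurable_EFinP; apply: measurable_funM.
    exact: (measurableT_comp mU measurable_fst).
  exact: (measurableT_comp mV measurable_snd).
pose u := U \_ D; pose v := V \_ D.
have mu_ : measurable_fun [set: measurableTypeR R] u.
  by apply/(measurable_restrictT _ _).1 => //; exact: measurable_funTS.
have mv_ : measurable_fun [set: measurableTypeR R] v.
  by apply/(measurable_restrictT _ _).1 => //; exact: measurable_funTS.
have iu : mu.-integrable [set: measurableTypeR R] (EFin \o u).
  by have := iU; rewrite integrable_mkcond// restrict_EFin.
have iv : mu.-integrable [set: measurableTypeR R] (EFin \o v).
  by have := iV; rewrite integrable_mkcond// restrict_EFin.
have muv : measurable_fun [set: R2] (fun x : R2 => (u x.1 * v x.2)%:E).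
  apply/measurable_EFinP; apply: measurable_funM.
    exact: (measurableT_comp mu_ measurable_fst).
  exact: (measurableT_comp mv_ measurable_snd).
have fu := integrable_fin_num measurableT iu.
have fv := integrable_fin_num measurableT iv.
have iuv : mu2.-integrable [set: R2] (fun x : R2 => (u x.1 * v x.2)%:E).
  apply/integrable12ltyP => //=.
  under eq_integral => x _.
    under eq_integral do rewrite /= normrM EFinM.
    rewrite ge0_integralZl//; last by do 2 apply: measurableT_comp => //.
    over.
  have fav : (\int[mu]_y `|v y|%:E \is a fin_num)%E.
    by rewrite ge0_fin_numE ?integral_ge0//; case/integrableP : iv.
  pose I := (fine (\int[mu]_y `|v y|%:E))%E.
  apply: (@le_lt_trans _ _ (\int[mu]_x (I%:E * `|u x|%:E))%E).
    rewrite le_eqVlt; apply/orP; left; apply/eqP.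
    by apply: eq_integral => x _; rewrite /I fineK// muleC.
  rewrite ge0_integralZl//; last 2 first.
  - by do 2 apply: measurableT_comp => //.
  - by rewrite lee_fin fine_ge0 ?integral_ge0.
  by rewrite lte_mul_pinfty ?lee_fin ?fine_ge0 ?integral_ge0//; case/integrableP : iu.
have iT : mu2.-integrable torus (fun x : R2 => (U x.1 * V x.2)%:E).
  by apply/integrable_mkcond => //; rewrite restrict_tensor.
split; first exact: (integrable_scaled_restr measurable_torus _ mUV iT).
rewrite /Rintegral (integral_scaled_restr measurable_torus _ mUV iT).
rewrite fineM//; last exact: integrable_fin_num.
congr (_ * _).
rewrite integral_mkcond restrict_tensor -/u -/v -integral12_prod_meas1//.
pose I := fine (\int[mu]_y (v y)%:E).
have -> : (\int[mu]_x fubini_F mu (fun x : R2 => (u x.1 * v x.2)%:E) x =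
    \int[mu]_x (I%:E * (u x)%:E))%E.
  apply: eq_integral => x _; rewrite /fubini_F /I fineK// muleC -integralZl//.
rewrite integralZl// fineM// /I mulrC.
have E (W : R -> R) : fine (\int[mu]_(x in D) (W x)%:E) = fine (\int[mu]_x ((W \_ D) x)%:E).
  by rewrite integral_mkcond restrict_EFin.
by rewrite !E.
Qed.
End TorusIntegrals.

Section ComplexIntegral.
Context {R : realType}.
Notation R2 := (measurableTypeR R * measurableTypeR R)%type.
Notation tm := (@torus_measure R).
Local Open Scope complex_scope.
Implicit Types f g : R * R -> R[i].

(** Integrability of the real and imaginary parts over the torus. *)
Definition cintegrable f : Prop :=
  tm.-integrable [set: R2] (fun x => (complex.Re (f x))%:E) /\
  tm.-integrable [set: R2] (fun x => (complex.Im (f x))%:E).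

Lemma ReD (z w : R[i]) : complex.Re (z + w) = complex.Re z + complex.Re w.
Proof. by case: z; case: w. Qed.

Lemma ImD (z w : R[i]) : complex.Im (z + w) = complex.Im z + complex.Im w.
Proof. by case: z; case: w. Qed.

Lemma ReM (z w : R[i]) : complex.Re (z * w) =
  complex.Re z * complex.Re w + - complex.Im z * complex.Im w.
Proof. by case: z; case: w => a b c d /=; rewrite mulNr. Qed.

Lemma ImM (z w : R[i]) : complex.Im (z * w) =
  complex.Re z * complex.Im w + complex.Im z * complex.Re w.
Proof. by case: z; case: w => a b c d /=. Qed.

Lemma cintegralD f g : cintegrable f -> cintegrable g ->
  cintegrable (fun x => f x + g x) /\
  cintegral (fun x => f x + g x) = cintegral f + cintegral g.
Proof.
move=> [f1 f2] [g1 g2]; split.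
  split.
  - rewrite (_ : (fun _ => _) = (fun x => (complex.Re (f x))%:E + (complex.Re (g x))%:E)%E).
      exact: integrableD.
    by apply/funext => x; rewrite ReD EFinD.
  - rewrite (_ : (fun _ => _) = (fun x => (complex.Im (f x))%:E + (complex.Im (g x))%:E)%E).
      exact: integrableD.
    by apply/funext => x; rewrite ImD EFinD.
rewrite /cintegral; apply/eqP; rewrite eq_complex /=; apply/andP; split; apply/eqP.
- rewrite -RintegralD//; apply: eq_Rintegral => x _; exact: ReD.
- rewrite -RintegralD//; apply: eq_Rintegral => x _; exact: ImD.
Qed.

Lemma integrable_lin (a b : R) (u v : R2 -> R) :
    tm.-integrable [set: R2] (EFin \o u) -> tm.-integrable [set: R2] (EFin \o v) ->
  tm.-integrable [set: R2] (fun x => (a * u x + b * v x)%:E) /\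
  \int[tm]_x (a * u x + b * v x) = a * (\int[tm]_x u x) + b * (\int[tm]_x v x).
Proof.
move=> iu iv.
have Z c (w : R2 -> R) : tm.-integrable [set: R2] (EFin \o w) ->
    tm.-integrable [set: R2] (EFin \o (fun x => c * w x)).
  move=> iw; rewrite (_ : _ \o _ = (fun x => c%:E * (w x)%:E)%E) //.
  exact: integrableZl.
split.
  rewrite (_ : (fun _ => _) = (fun x => (a * u x)%:E + (b * v x)%:E)%E) //.
  by apply: integrableD => //; exact: Z.
rewrite RintegralD//; [|exact: Z|exact: Z].
by rewrite !RintegralZl.
Qed.

Lemma cintegralZ (c : R[i]) f : cintegrable f ->
  cintegrable (fun x => c * f x) /\
  cintegral (fun x => c * f x) = c * cintegral f.
Proof.
move=> [f1 f2].
have [r1 r2] := integrable_lin (complex.Re c) (- complex.Im c) f1 f2.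
have [i1 i2] := integrable_lin (complex.Re c) (complex.Im c) f2 f1.
have eR : (fun x : R2 => complex.Re (c * f x)) = (fun x =>
    complex.Re c * complex.Re (f x) + - complex.Im c * complex.Im (f x)).
  by apply/funext => x; rewrite ReM.
have eI : (fun x : R2 => complex.Im (c * f x)) = (fun x =>
    complex.Re c * complex.Im (f x) + complex.Im c * complex.Re (f x)).
  by apply/funext => x; rewrite ImM.
have e (u v : R2 -> R) : u = v -> (fun x => (u x)%:E) = (fun x => (v x)%:E) by move=> ->.
split; first by split; [rewrite (e _ _ eR)|rewrite (e _ _ eI)].
rewrite /cintegral eR eI r2 i2; apply/eqP; rewrite eq_complex ReM ImM /=.
by rewrite !eqxx.
Qed.

Lemma cintegral_sum (I : Type) (s : seq I) (F : I -> R * R -> R[i]) :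
    (forall i, cintegrable (F i)) ->
  cintegrable (fun x => \sum_(i <- s) F i x) /\
  cintegral (fun x => \sum_(i <- s) F i x) = \sum_(i <- s) cintegral (F i).
Proof.
move=> iF; elim: s => [|i s [IH1 IH2]].
  under eq_fun do rewrite big_nil.
  rewrite big_nil; split.
    by split; exact: integrable0.
  by rewrite /cintegral /Rintegral /= integral0.
under eq_fun do rewrite big_cons.
have [h1 h2] := cintegralD (iF i) IH1.
by rewrite big_cons; split => //; rewrite h2 IH2.
Qed.

End ComplexIntegral.

(** * Convolution of a trigonometric polynomial with the kernel *)

Section Convolution.
Context {R : realType}.
Variables (r : R) (r0 : 0 < r).
Notation mu := (@lebesgue_measure R).
Notation D := (`[0, 2 * pi[%classic : set (measurableTypeR R)).
Notation R2 := (measurableTypeR R * measurableTypeR R)%type.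
Notation tm := (@torus_measure R).
Local Open Scope complex_scope.

(** The Fourier coefficient of [F1 r] at a positive frequency. *)
Definition F1_coef (k : nat) : R[i] := (k%:R `^ (- r))%:C * cis (- (r * pi / 2)).

Let U k b x y : R := cos (k%:R * y + b) * F1 r (x - y).

Let measurable_U k b x : measurable_fun [set: measurableTypeR R] (U k b x).
Proof.
apply: measurable_funM.
  by apply: continuous_measurable_fun; exact: continuous_cos_affine.
by apply: (measurableT_comp (measurable_F1 r0)); exact: measurable_funB.
Qed.

Let integral_UU (k1 k2 : nat) (b1 b2 x1 x2 : R) : (0 < k1)%N -> (0 < k2)%N ->
    D x1 -> D x2 ->
  tm.-integrable [set: R2] (fun y => (U k1 b1 x1 y.1 * U k2 b2 x2 y.2)%:E) /\
  \int[tm]_y (U k1 b1 x1 y.1 * U k2 b2 x2 y.2) =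
    (k1%:R `^ (- r) * k2%:R `^ (- r)) *
    (cos (k1%:R * x1 - r * pi / 2 + b1) * cos (k2%:R * x2 - r * pi / 2 + b2)).
Proof.
move=> k10 k20 Dx1 Dx2.
have [i1 e1] := integral_cos_F1 r0 b1 k10 Dx1.
have [i2 e2] := integral_cos_F1 r0 b2 k20 Dx2.
have [h1 h2] := integral_tensor (@measurable_U k1 b1 x1) (@measurable_U k2 b2 x2) i1 i2.
split => //; rewrite h2 /Rintegral e1 e2 /=.
have p : (pi : R) != 0 by rewrite gt_eqF// pi_gt0.
by move: p; move: (pi : R) => P p; field.
Qed.

Lemma cintegral_char_F2 (k1 k2 : nat) (x : R * R) : (0 < k1)%N -> (0 < k2)%N ->
    D x.1 -> D x.2 ->
  let g y := (cis (k1%:R * y.1) * cis (k2%:R * y.2)) * F2 r (x.1 - y.1, x.2 - y.2) in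
  cintegrable g /\
  cintegral g = F1_coef k1 * F1_coef k2 * (cis (k1%:R * x.1) * cis (k2%:R * x.2)).
Proof.
move=> k10 k20 D1 D2 g.
pose h := - (pi / 2) : R.
have [icc ecc] := integral_UU 0 0 k10 k20 D1 D2.
have [iss ess] := integral_UU h h k10 k20 D1 D2.
have [ics ecs] := integral_UU 0 h k10 k20 D1 D2.
have [isc esc] := integral_UU h 0 k10 k20 D1 D2.
have [ir er] := integrable_lin 1 (-1) icc iss.
have [ii ei] := integrable_lin 1 1 ics isc.
have sinE (t : R) : sin t = cos (t + h) by rewrite /h cosBpihalf.
have gR : (fun y : R2 => complex.Re (g y)) = (fun y =>
    1 * (U k1 0 x.1 y.1 * U k2 0 x.2 y.2) + -1 * (U k1 h x.1 y.1 * U k2 h x.2 y.2)).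
  apply/funext => y; rewrite /U -!sinE !addr0 /g /F2 /cis /=; ring.
have gI : (fun y : R2 => complex.Im (g y)) = (fun y =>
    1 * (U k1 0 x.1 y.1 * U k2 h x.2 y.2) + 1 * (U k1 h x.1 y.1 * U k2 0 x.2 y.2)).
  apply/funext => y; rewrite /U -!sinE !addr0 /g /F2 /cis /=; ring.
have e (u v : R2 -> R) : u = v -> (fun x => (u x)%:E) = (fun x => (v x)%:E) by move=> ->.
split; first by split; [rewrite (e _ _ gR)|rewrite (e _ _ gI)].
have -> : F1_coef k1 * F1_coef k2 * (cis (k1%:R * x.1) * cis (k2%:R * x.2)) =
    (k1%:R `^ (- r) * k2%:R `^ (- r))%:C *
    (cis (k1%:R * x.1 - r * pi / 2) * cis (k2%:R * x.2 - r * pi / 2)).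
  by rewrite /F1_coef !cisD rmorphM /=; ring.
rewrite /cintegral gR gI er ei ecc ess ecs esc -!sinE !addr0.
by apply/eqP; rewrite eq_complex /=; apply/andP; split; apply/eqP; ring.
Qed.

(** Convolution with [F2 r] multiplies the Fourier coefficients at positive
    frequencies by [F1_coef] in each variable. *)
Lemma convolution_F2 (I : Type) (s : seq I) (c : I -> R[i]) (k1 k2 : I -> nat)
    (x : R * R) : (forall i, (0 < k1 i)%N) -> (forall i, (0 < k2 i)%N) ->
    D x.1 -> D x.2 ->
  convolution (fun y => \sum_(i <- s) c i * (cis ((k1 i)%:R * y.1) * cis ((k2 i)%:R * y.2)))
    (F2 r) x =
  \sum_(i <- s) c i * (F1_coef (k1 i) * F1_coef (k2 i) *
    (cis ((k1 i)%:R * x.1) * cis ((k2 i)%:R * x.2))).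
Proof.
move=> k10 k20 D1 D2; rewrite /convolution.
under eq_fun do rewrite big_distrl /=.
have H i := cintegral_char_F2 (k10 i) (k20 i) D1 D2.
have E i : cintegrable (fun y => c i * (cis ((k1 i)%:R * y.1) * cis ((k2 i)%:R * y.2)) *
    F2 r (x.1 - y.1, x.2 - y.2)) /\ cintegral (fun y => c i * (cis ((k1 i)%:R * y.1) * cis ((k2 i)%:R * y.2)) *
    F2 r (x.1 - y.1, x.2 - y.2)) = c i * (F1_coef (k1 i) * F1_coef (k2 i) *
    (cis ((k1 i)%:R * x.1) * cis ((k2 i)%:R * x.2))).
  under eq_fun do rewrite -mulrA.
  have [h1 h2] := cintegralZ (c i) (H i).1.
  by split => //; rewrite h2 (H i).2.
rewrite (cintegral_sum s (fun i => (E i).1)).2.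
by apply: eq_bigr => i _; exact: (E i).2.
Qed.

End Convolution.

(** * Uniform grids and flat kernels on the circle *)

Section Grid.
Context {R : realType}.
Local Open Scope complex_scope.
Implicit Types (x : R) (A L k j : nat).

(** The [j]-th point of the uniform grid with [A] points on the circle. *)
Definition node A j : R := 2 * pi * j%:R / A%:R.

Lemma cis_nodeM A j k : cis (k%:R * node A j) = cis (node A k) ^+ j.
Proof. by rewrite -cisMn; congr cis; rewrite /node; ring. Qed.

Lemma cis_node_modn A k : (0 < A)%N -> cis (node A (k %% A)) = cis (node A k).
Proof.
move=> A0; rewrite [in RHS](divn_eq k A).
have -> : node A (k %/ A * A + k %% A) = node A (k %% A) + (k %/ A)%:R * (2 * pi).
  by rewrite /node natrD natrM; field; rewrite pnatr_eq0 -lt0n.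
by rewrite cisD cisMn cis2pi expr1n mulr1.
Qed.

Lemma cis_node_neq1 A k : (0 < A)%N -> ~~ (A %| k)%N -> cis (node A k) != 1.
Proof.
move=> A0 Ak; rewrite -cis_node_modn//; apply: cis_neq1.
have p0 : 0 < 2 * pi :> R by rewrite mulr_gt0// pi_gt0.
have A0' : 0 < A%:R :> R by rewrite ltr0n.
rewrite /node; apply/andP; split.
  by rewrite divr_gt0// mulr_gt0// ltr0n lt0n.
by rewrite ltr_pdivrMr// ltr_pM2l// ltr_nat ltn_mod.
Qed.

Lemma cis_node_expn A k : (0 < A)%N -> cis (node A k) ^+ A = 1.
Proof.
move=> A0; rewrite -cisMn (_ : A%:R * _ = k%:R * (2 * pi)); last first.
  by rewrite /node; field; rewrite pnatr_eq0 -lt0n.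
by rewrite cisMn cis2pi expr1n.
Qed.

(** Orthogonality of the characters on a grid. *)
Lemma sum_cis_node A k : (0 < A)%N ->
  \sum_(j < A) cis (k%:R * node A j) = (if (A %| k)%N then A%:R else 0) :> R[i].
Proof.
move=> A0; under eq_bigr do rewrite cis_nodeM.
have E := cis_node_expn k A0.
case: ifPn => Ak; last first.
  have := cis_node_neq1 A0 Ak; rewrite -subr_eq0 => n0.
  by apply: (mulfI n0); rewrite -subrX1 E subrr mulr0.
have -> : cis (node A k) = 1.
  rewrite -cis_node_modn// (eqP Ak) (_ : node A 0 = 0) ?cis0//.
  by rewrite /node mulr0 mul0r.
by under eq_bigr do rewrite expr1n; rewrite sumr_const card_ord.
Qed.

Lemma sum_cis_node_diff A k l : (0 < A)%N ->
  \sum_(j < A) cis (k%:R * node A j) * conjc (cis (l%:R * node A j)) =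
  (if (k == l %[mod A])%N then A%:R else 0) :> R[i].
Proof.
move=> A0.
have G (m n : nat) : (n <= m)%N -> \sum_(j < A) cis (m%:R * node A j) * conjc (cis (n%:R * node A j)) =
  (if (m == n %[mod A])%N then A%:R else 0) :> R[i].
  move=> nm; rewrite eqn_mod_dvd// -sum_cis_node//; apply: eq_bigr => j _.
  by rewrite -cisN -cisD; congr cis; rewrite natrB//; ring.
have [/G//|/ltnW/G E] := leqP l k.
transitivity (conjc (if (l == k %[mod A])%N then A%:R else 0 : R[i])).
  rewrite -E conjc_sum; apply: eq_bigr => j _.
  by rewrite conjcM conjcK mulrC.
by rewrite eq_sym; case: ifP => _; rewrite ?conjc_nat ?conjc0.
Qed.

End Grid.

Section Kernel.
Context {R : realType}.
Local Open Scope complex_scope.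
Implicit Types (x : R) (A k j : nat).

(** The analytic Dirichlet kernel, with frequencies [0], ..., [A - 1]. *)
Definition Dirichlet A x : R[i] := \sum_(k < A) cis (k%:R * x).

Lemma sum_Dirichlet_sq A x : (0 < A)%N ->
  \sum_(j < A) (cmod (Dirichlet A (x - node A j))) ^+ 2 = A%:R ^+ 2.
Proof.
move=> A0; apply: complexI; rewrite rmorph_sum rmorphXn rmorph_nat /=.
have E j : (cmod (Dirichlet A (x - node A j)) ^+ 2)%:C =
  \sum_(k < A) \sum_(l < A) cis (k%:R * x) * conjc (cis (l%:R * x)) *
     (cis (l%:R * node A j) * conjc (cis (k%:R * node A j))).
  rewrite -mulc_conj conjc_sum big_distrl /=; apply: eq_bigr => k _.
  rewrite big_distrr /=; apply: eq_bigr => l _.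
  by rewrite !mulrBr !cisD !cisN conjcM conjcK; ring.
under eq_bigr do rewrite E.
rewrite exchange_big /= expr2 mulr_natl -[X in _ = _ *+ X]card_ord -sumr_const.
apply: eq_bigr => k _; rewrite exchange_big /=.
rewrite (bigD1 k)//= [X in _ + X]big1 ?addr0.
  by rewrite -mulr_sumr sum_cis_node_diff// eqxx mulc_conj cmod_cis expr1n mul1r.
move=> l lk; rewrite -mulr_sumr sum_cis_node_diff// !modn_small// ifN ?mulr0//.
Qed.

Lemma Dirichlet_double A x :
  Dirichlet (A + A) x = Dirichlet A x * (1 + cis (A%:R * x)).
Proof.
rewrite /Dirichlet big_split_ord /= mulrDr mulr1 big_distrl /=; congr (_ + _).
by apply: eq_bigr => k _; rewrite -cisD natrD; congr cis; ring.
Qed.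

(** Coefficient of [X ^+ k] in the trapezoid polynomial
    [(1 + .. + X ^+ (A - 1)) * (1 + .. + X ^+ (2 A - 1)) / (2 A ^ 2)]. *)
Definition trapezoid A k : R :=
  (\sum_(a < A) \sum_(b < A + A) (a + b == k)%N)%:R / (2 * A%:R ^+ 2).

Lemma trapezoid_ge0 A k : 0 <= trapezoid A k.
Proof. by rewrite divr_ge0// mulr_ge0// exprn_ge0. Qed.

Lemma sum_trapezoid A (F : nat -> R[i]) :
  \sum_(k < 3 * A) (trapezoid A k)%:C * F k =
  (2 * A%:R ^+ 2)^-1%:C * \sum_(a < A) \sum_(b < A + A) F (a + b)%N.
Proof.
have T k z : (trapezoid A k)%:C * z = (2 * A%:R ^+ 2)^-1%:C *
    (z *+ (\sum_(a < A) \sum_(b < A + A) (a + b == k))%N).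
  by rewrite /trapezoid rmorphM rmorph_nat -mulrA mulrCA; congr (_ * _); rewrite mulr_natl.
under eq_bigr do rewrite T.
rewrite -mulr_sumr; congr (_ * _).
under eq_bigr => k _.
  rewrite -sumrMnr; under eq_bigr do rewrite -sumrMnr.
  over.
rewrite exchange_big /=; apply: eq_bigr => a _.
rewrite exchange_big /=; apply: eq_bigr => b _.
have ab : (a + b < 3 * A)%N by have := ltn_ord a; have := ltn_ord b; lia.
rewrite (bigD1 (Ordinal ab))//= eqxx mulr1n [X in _ + X]big1 ?addr0// => k kab.
by rewrite (_ : (a + b == k)%N = false) //; apply: contraNF kab => /eqP E; apply/eqP/val_inj.
Qed.

(** The trapezoid is flat on [A - 1, 2 A - 1]. *)
Lemma trapezoid_plateau A k : (0 < A)%N -> (A.-1 <= k < A + A)%N ->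
  trapezoid A k = (2 * A%:R)^-1.
Proof.
move=> A0 /andP[k1 k2]; rewrite /trapezoid.
have -> : (\sum_(a < A) \sum_(b < A + A) (a + b == k)%N = A)%N.
  rewrite -[RHS]card_ord -sum1_card; apply: eq_bigr => a _.
  have ka : (k - a < A + A)%N by lia.
  rewrite (bigD1 (Ordinal ka))//= [X in (_ + X)%N]big1 ?addn0.
    by rewrite subnKC ?eqxx//; have := ltn_ord a; lia.
  move=> b; apply: contraNeq; rewrite eqb0 negbK => /eqP E.
  by apply/eqP/val_inj => /=; rewrite -E addKn.
by field; rewrite pnatr_eq0 -lt0n.
Qed.

Lemma sum_trapezoid1 A : (0 < A)%N -> \sum_(k < 3 * A) trapezoid A k = 1.
Proof.
move=> A0; apply: complexI; rewrite rmorph_sum /=.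
transitivity (\sum_(k < 3 * A) (trapezoid A k)%:C * 1).
  by apply: eq_bigr => k _; rewrite mulr1.
rewrite (sum_trapezoid A (fun=> 1)).
under eq_bigr do rewrite sumr_const card_ord.
rewrite sumr_const card_ord -mulrnA -(rmorph_nat (real_complex R)) -rmorphM.
congr (_%:C); rewrite natrM natrD.
by field; rewrite pnatr_eq0 -lt0n.
Qed.

(** The kernel attached to the [j]-th node; [w] is a Fourier multiplier. *)
Definition ker (w : nat -> R[i]) A j x : R[i] :=
  \sum_(k < 3 * A) (trapezoid A k)%:C * conjc (cis (k%:R * node A j)) *
     (w (A + k)%N * cis ((A + k)%:R * x)).

(** Product formula: without multiplier the kernel is a modulated product of
    two Dirichlet kernels, of lengths [A] and [2 A]. *)
Lemma ker1E A j x : ker (fun=> 1) A j x = 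
  ((2 * A%:R ^+ 2)^-1)%:C * (cis (A%:R * x) *
    (Dirichlet A (x - node A j) * Dirichlet (A + A) (x - node A j))).
Proof.
rewrite /ker.
have E (k : nat) : (trapezoid A k)%:C * conjc (cis (k%:R * node A j)) *
     (1 * cis ((A + k)%:R * x)) =
   (trapezoid A k)%:C * (cis (A%:R * x) * cis (k%:R * (x - node A j))).
  by rewrite mul1r mulrBr natrD mulrDl !cisD cisN; ring.
under eq_bigr do rewrite E.
rewrite (sum_trapezoid A (fun k => cis (A%:R * x) * cis (k%:R * (x - node A j)))).
congr (_ * _); rewrite [X in cis _ * (X * _)]/Dirichlet big_distrl mulr_sumr /=.
apply: eq_bigr => a _; rewrite /Dirichlet !mulr_sumr; apply: eq_bigr => b _.
by rewrite natrD mulrDl cisD.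
Qed.

(** The kernels at the nodes are uniformly flat: their moduli sum up to at
    most one at every point. *)
Lemma sum_cmod_ker1 A x : (0 < A)%N -> \sum_(j < A) cmod (ker (fun=> 1) A j x) <= 1.
Proof.
move=> A0; have A0' : 0 < A%:R :> R by rewrite ltr0n.
have -> : 1 = A%:R ^- 2 * A%:R ^+ 2 :> R by rewrite mulVf// expf_neq0// gt_eqF.
rewrite -[X in _ * X](sum_Dirichlet_sq x A0) mulr_sumr; apply: ler_sum => j _.
rewrite ker1E Dirichlet_double !cmodM cmod_cis mul1r cmod_real.
have h : cmod (1 + cis (A%:R * (x - node A j))) <= 2.
  by apply: le_trans (cmodD _ _) _; rewrite -{1}cis0 !cmod_cis; lra.
rewrite ger0_norm; last by rewrite invr_ge0 mulr_ge0// exprn_ge0.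
rewrite invfM -mulrA mulrCA; apply: ler_wpM2l; first by rewrite invr_ge0 exprn_ge0.
have h0 := cmod_ge0 (Dirichlet A (x - node A j)).
have := ler_wpM2l (mulr_ge0 h0 h0) h; lra.
Qed.

End Kernel.

(** * Two-dimensional blocks *)

Section Parseval.
Context {R : realType}.
Local Open Scope complex_scope.

Lemma grid_parseval (L A K : nat) (a b : 'I_K -> R[i]) : (0 < L)%N -> (A + K <= L)%N ->
  \sum_(i < L) (\sum_(k < K) a k * cis ((A + k)%:R * node L i)) *
     conjc (\sum_(k < K) b k * cis ((A + k)%:R * node L i)) =
  L%:R * \sum_(k < K) a k * conjc (b k) :> R[i].
Proof.
move=> L0 AKL.
transitivity (\sum_(i < L) \sum_(k < K) \sum_(l < K) (a k * conjc (b l)) *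
    (cis ((A + k)%:R * node L i) * conjc (cis ((A + l)%:R * node L i)))).
  apply: eq_bigr => i _; rewrite conjc_sum mulr_suml; apply: eq_bigr => k _.
  rewrite mulr_sumr; apply: eq_bigr => l _; rewrite conjcM; ring.
rewrite exchange_big mulr_sumr /=; apply: eq_bigr => k _.
rewrite exchange_big /= (bigD1 k)//= [X in _ + X]big1 ?addr0.
  by rewrite -mulr_sumr sum_cis_node_diff// eqxx mulrC.
move=> l lk; rewrite -mulr_sumr sum_cis_node_diff// !modn_small ?eqn_add2l; last 2 first.
- by have := ltn_ord l; lia.
- by have := ltn_ord k; lia.
by rewrite ifN ?mulr0// eq_sym.
Qed.

(** Plancherel identity for the discrete Fourier transform on [A] nodes,
    over any [A] consecutive frequencies. *)
Lemma dft_plancherel (A c : nat) (v : 'I_A -> R[i]) : (0 < A)%N ->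
  \sum_(i < A) cmod (\sum_(j < A) v j * conjc (cis ((c + i)%:R * node A j))) ^+ 2 =
  A%:R * \sum_(j < A) cmod (v j) ^+ 2 :> R.
Proof.
move=> A0; apply: complexI; rewrite rmorph_sum rmorphM rmorph_nat rmorph_sum /=.
pose b j := conjc (v j) * cis (c%:R * node A j).
transitivity (\sum_(i < A) (\sum_(j < A) b j * cis ((0 + j)%:R * node A i)) *
     conjc (\sum_(j < A) b j * cis ((0 + j)%:R * node A i))).
  apply: eq_bigr => i _; rewrite mulc_conj -(cmod_conj (\sum_(j < A) v j * _)).
  congr ((cmod _ ^+ 2)%:C); rewrite conjc_sum; apply: eq_bigr => j _.
  rewrite conjcM conjcK /b -mulrA -cisD; congr (_ * cis _).
  by rewrite /node natrD; ring.
rewrite grid_parseval//; congr (_ * _); apply: eq_bigr => j _.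
by rewrite mulc_conj /b cmodM cmod_conj cmod_cis mulr1.
Qed.

End Parseval.

Section Block.
Context {R : realType}.
Local Open Scope complex_scope.
Implicit Types (w : nat -> R[i]) (x : R * R).

(** Discrete Fourier transform of coefficients on the A x B nodes. *)
Definition hat A B (d : 'I_A -> 'I_B -> R) (k1 k2 : nat) : R[i] :=
  \sum_(j1 < A) \sum_(j2 < B) (d j1 j2)%:C *
    (conjc (cis (k1%:R * node A j1)) * conjc (cis (k2%:R * node B j2))).

(** The combination, with coefficients [d], of the products of kernels at the
    A x B nodes, with Fourier multiplier [w] in each variable.  It is defined
    by its Fourier expansion, whose spectrum lies in [A, 4A) x [B, 4B);
    [blockE] is the expansion in kernels. *)
Definition block w A B (d : 'I_A -> 'I_B -> R) x : R[i] :=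
  \sum_(k1 < 3 * A) \sum_(k2 < 3 * B)
    ((trapezoid A k1 * trapezoid B k2)%:C * hat d k1 k2) *
    ((w (A + k1)%N * w (B + k2)%N) *
     (cis ((A + k1)%:R * x.1) * cis ((B + k2)%:R * x.2))).

Lemma blockE w A B (d : 'I_A -> 'I_B -> R) x :
  block w d x = \sum_(j1 < A) \sum_(j2 < B) (d j1 j2)%:C * (ker w A j1 x.1 * ker w B j2 x.2).
Proof.
transitivity (\sum_(k1 < 3 * A) \sum_(k2 < 3 * B) \sum_(j1 < A) \sum_(j2 < B)
  (d j1 j2)%:C * (((trapezoid A k1)%:C * conjc (cis (k1%:R * node A j1)) *
     (w (A + k1)%N * cis ((A + k1)%:R * x.1))) *
     ((trapezoid B k2)%:C * conjc (cis (k2%:R * node B j2)) *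
     (w (B + k2)%N * cis ((B + k2)%:R * x.2))))).
  apply: eq_bigr => k1 _; apply: eq_bigr => k2 _.
  rewrite /hat mulr_sumr mulr_suml; apply: eq_bigr => j1 _.
  rewrite mulr_sumr mulr_suml; apply: eq_bigr => j2 _.
  rewrite rmorphM /=; ring.
under eq_bigr do rewrite exchange_big /=.
rewrite exchange_big /=; apply: eq_bigr => j1 _.
under eq_bigr do rewrite exchange_big /=.
rewrite exchange_big /=; apply: eq_bigr => j2 _.
rewrite /ker [X in _ = _ * X]mulr_suml mulr_sumr; apply: eq_bigr => k1 _.
by rewrite [X in _ = _ * X]mulr_sumr mulr_sumr; apply: eq_bigr => k2 _.
Qed.

Lemma sum_cmod_ker_prod A B x : (0 < A)%N -> (0 < B)%N ->
  \sum_(j1 < A) \sum_(j2 < B) cmod (ker (fun=> 1) A j1 x.1 * ker (fun=> 1) B j2 x.2) <= 1.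
Proof.
move=> A0 B0; rewrite (eq_bigr (fun j1 : 'I_A => cmod (ker (fun=> 1) A j1 x.1) *
    \sum_(j2 < B) cmod (ker (fun=> 1) B j2 x.2))); last first.
  by move=> j1 _; rewrite mulr_sumr; apply: eq_bigr => j2 _; rewrite cmodM.
rewrite -mulr_suml -[leRHS]mulr1; apply: ler_pM; rewrite ?sum_cmod_ker1//.
  by apply: sumr_ge0 => *; exact: cmod_ge0.
by apply: sumr_ge0 => *; exact: cmod_ge0.
Qed.

Lemma cmod_block1_le1 A B (d : 'I_A -> 'I_B -> R) x : (0 < A)%N -> (0 < B)%N ->
  (forall j1 j2, `|d j1 j2| <= 1) -> cmod (block (fun=> 1) d x) <= 1.
Proof.
move=> A0 B0 d1; rewrite blockE; apply: le_trans (sum_cmod_ker_prod x A0 B0).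
apply: le_trans (cmod_sum _ _ _) _; apply: ler_sum => j1 _.
apply: le_trans (cmod_sum _ _ _) _; apply: ler_sum => j2 _.
by rewrite cmodM cmod_real ler_piMl ?cmod_ge0.
Qed.

Lemma hat_plancherel A B (d : 'I_A -> 'I_B -> R) (c1 c2 : nat) : (0 < A)%N -> (0 < B)%N ->
  \sum_(i1 < A) \sum_(i2 < B) cmod (hat d (c1 + i1) (c2 + i2)) ^+ 2 =
  (A * B)%:R * \sum_(j1 < A) \sum_(j2 < B) (d j1 j2) ^+ 2.
Proof.
move=> A0 B0; rewrite exchange_big /=.
transitivity (\sum_(i2 < B) A%:R * \sum_(j1 < A)
   cmod (\sum_(j2 < B) (d j1 j2)%:C * conjc (cis ((c2 + i2)%:R * node B j2))) ^+ 2).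
  apply: eq_bigr => i2 _; rewrite -(dft_plancherel c1)//; apply: eq_bigr => i1 _.
  congr (cmod _ ^+ 2); apply: eq_bigr => j1 _; rewrite mulr_suml.
  apply: eq_bigr => j2 _; ring.
rewrite -mulr_sumr exchange_big /= natrM -mulrA; congr (_ * _).
rewrite mulr_sumr; apply: eq_bigr => j1 _.
rewrite (dft_plancherel c2)//; congr (_ * _); apply: eq_bigr => j2 _.
by rewrite cmod_real real_normK ?num_real.
Qed.

Lemma ler_sum_shift (n m c : nat) (F : nat -> R) : (c + n <= m)%N ->
  (forall k, 0 <= F k) -> \sum_(i < n) F (c + i)%N <= \sum_(k < m) F k.
Proof.
move=> cnm F0.
rewrite -(big_mkord xpredT F) -(big_mkord xpredT (fun i => F (c + i)%N)).
rewrite (@big_cat_nat _ _ _ c 0 m)//=; last by lia.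
rewrite (@big_cat_nat _ _ _ (c + n) c m)//= ?leq_addr//.
have -> : \sum_(c <= i < c + n) F i = \sum_(0 <= i < n) F (c + i)%N.
  by rewrite -{1}[c]add0n big_addn addKn; apply: eq_bigr => i _; rewrite addnC.
by rewrite addrCA lerDl addr_ge0//; apply: sumr_ge0.
Qed.

(** The energy of a block controls that of its coefficients: keep only the
    frequencies in the plateau of both trapezoids. *)
Lemma block_energy_ge A B (d : 'I_A -> 'I_B -> R) : (0 < A)%N -> (0 < B)%N ->
  (\sum_(j1 < A) \sum_(j2 < B) (d j1 j2) ^+ 2) / (16 * (A * B)%:R) <=
  \sum_(k1 < 3 * A) \sum_(k2 < 3 * B)
    ((trapezoid A k1 * trapezoid B k2) * cmod (hat d k1 k2)) ^+ 2.
Proof.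
move=> A0 B0.
have F0 k1 k2 : 0 <= (trapezoid A k1 * trapezoid B k2 * cmod (hat d k1 k2)) ^+ 2.
  exact: sqr_ge0.
apply: (@le_trans _ _ (\sum_(i1 < A) \sum_(k2 < 3 * B)
    ((trapezoid A (A.-1 + i1) * trapezoid B k2) * cmod (hat d (A.-1 + i1) k2)) ^+ 2)); last first.
  apply: (@ler_sum_shift _ _ _ (fun k1 => \sum_(k2 < 3 * B)
    ((trapezoid A k1 * trapezoid B k2) * cmod (hat d k1 k2)) ^+ 2)); first by lia.
  by move=> k; apply: sumr_ge0.
apply: (@le_trans _ _ (\sum_(i1 < A) \sum_(i2 < B)
    ((trapezoid A (A.-1 + i1) * trapezoid B (B.-1 + i2)) * cmod (hat d (A.-1 + i1) (B.-1 + i2))) ^+ 2)); last first.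
  apply: ler_sum => i1 _; apply: (@ler_sum_shift _ _ _ (fun k2 => 
    ((trapezoid A (A.-1 + i1) * trapezoid B k2) * cmod (hat d (A.-1 + i1) k2)) ^+ 2)) => //.
  by lia.
have nA : A%:R != 0 :> R by rewrite pnatr_eq0 -lt0n.
have nB : B%:R != 0 :> R by rewrite pnatr_eq0 -lt0n.
rewrite le_eqVlt; apply/orP; left; apply/eqP.
transitivity (\sum_(i1 < A) \sum_(i2 < B) (16 * (A * B)%:R ^+ 2)^-1 * cmod (hat d (A.-1 + i1) (B.-1 + i2)) ^+ 2).
  apply/esym; under eq_bigr do rewrite -mulr_sumr.
  rewrite -mulr_sumr hat_plancherel// natrM; field.
  by rewrite nA nB.
apply: eq_bigr => i1 _; apply: eq_bigr => i2 _.
rewrite !trapezoid_plateau//; last 2 first.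
- by have := ltn_ord i2; lia.
- by have := ltn_ord i1; lia.
by rewrite exprMn natrM; congr (_ * _); field; rewrite nA nB.
Qed.

(** Discrete inner product of two blocks. *)
Lemma block_grid_inner w A B (d : 'I_A -> 'I_B -> R) (L : nat) :
    (4 * A <= L)%N -> (4 * B <= L)%N -> (0 < L)%N ->
  \sum_(i1 < L) \sum_(i2 < L) block w d (node L i1, node L i2) *
     conjc (block (fun=> 1) d (node L i1, node L i2)) =
  (L * L)%:R * \sum_(k1 < 3 * A) \sum_(k2 < 3 * B)
    (((trapezoid A k1 * trapezoid B k2) * cmod (hat d k1 k2)) ^+ 2)%:C *
      (w (A + k1)%N * w (B + k2)%N).
Proof.
move=> AL BL L0.
pose c w k1 k2 := ((trapezoid A k1 * trapezoid B k2)%:C * hat d k1 k2) *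
    (w (A + k1)%N * w (B + k2)%N).
pose c2 w i2 k1 := \sum_(k2 < 3 * B) c w k1 k2 * cis ((B + k2)%:R * node L i2).
have E w' i1 i2 : block w' d (node L i1, node L i2) =
    \sum_(k1 < 3 * A) c2 w' i2 k1 * cis ((A + k1)%:R * node L i1).
  apply: eq_bigr => k1 _; rewrite /c2 mulr_suml; apply: eq_bigr => k2 _.
  rewrite /c /=; ring.
under eq_bigr => i1 _.
  under eq_bigr do rewrite !E.
  over.
rewrite /= exchange_big /=.
have AL' : (A + 3 * A <= L)%N by lia.
have BL' : (B + 3 * B <= L)%N by lia.
under eq_bigr do rewrite grid_parseval//.
rewrite -mulr_sumr exchange_big /= natrM -mulrA; congr (_ * _).
rewrite mulr_sumr; apply: eq_bigr => k1 _.
rewrite grid_parseval//; congr (_ * _); apply: eq_bigr => k2 _.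
rewrite /c mulr1 mulr1 mulrAC mulc_conj cmodM cmod_real ger0_norm//.
by rewrite mulr_ge0// trapezoid_ge0.
Qed.

End Block.

(** * Spectra of one-variable trigonometric polynomials *)

Section Spectrum.
Context {R : realType}.
Local Open Scope complex_scope.
Implicit Types (u v : R -> R[i]) (lo : int) (len W L : nat).

(** [spec lo len u]: [u] is a trigonometric polynomial with frequencies in
    the integer interval [lo, lo + len]. *)
Definition spec lo len u : Prop := exists2 p : {poly R[i]},
  (size p <= len.+1)%N & forall x, u x = cis x ^ lo * p.[cis x].

(** Trigonometric polynomials of degree at most [W]. *)
Definition band W u : Prop := spec (- W%:Z) (W + W) u.

Lemma specM lo1 len1 lo2 len2 u v : spec lo1 len1 u -> spec lo2 len2 v ->
  spec (lo1 + lo2) (len1 + len2) (fun x => u x * v x).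
Proof.
move=> [p sp up] [q sq vq]; exists (p * q).
  by apply: leq_trans (size_polyMleq _ _) _; lia.
move=> x; rewrite up vq hornerM expfzDr ?cis_neq0//; ring.
Qed.

Lemma specD lo len u v : spec lo len u -> spec lo len v ->
  spec lo len (fun x => u x + v x).
Proof.
move=> [p sp up] [q sq vq]; exists (p + q).
  by apply: leq_trans (size_polyD _ _) _; rewrite geq_max sp.
by move=> x; rewrite up vq hornerD mulrDr.
Qed.

Lemma specZ lo len (c : R[i]) u : spec lo len u -> spec lo len (fun x => c * u x).
Proof.
move=> [p sp up]; exists (c *: p); first by apply: leq_trans (size_scale_leq _ _) _.
by move=> x; rewrite up hornerZ mulrCA.
Qed.

Lemma spec_sum lo len (I : Type) (s : seq I) (F : I -> R -> R[i]) :
  (forall i, spec lo len (F i)) -> spec lo len (fun x => \sum_(i <- s) F i x).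
Proof.
move=> hF; elim: s => [|i s IH].
  exists 0; first by rewrite size_poly0.
  by move=> x; rewrite big_nil horner0 mulr0.
case: (specD (hF i) IH) => p sp hp; exists p => // x.
by rewrite big_cons hp.
Qed.

Lemma spec_widen lo len lo' len' u : lo' <= lo ->
  lo + len%:Z <= lo' + len'%:Z -> spec lo len u -> spec lo' len' u.
Proof.
move=> h1 h2 [p sp up].
have [n En] : exists n : nat, lo = lo' + n%:Z.
  by exists `|lo - lo'|%N; lia.
exists ('X^n * p).
  apply: leq_trans (size_polyMleq _ _) _; rewrite size_polyXn /=. move: sp; move: (size p) => sz sp; lia.
move=> x; by rewrite up hornerM hornerXn En expfzDr ?cis_neq0// -mulrA.
Qed.

Lemma spec_conj lo len u : spec lo len u ->
  spec (- (lo + len%:Z)) len (fun x => conjc (u x)).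
Proof.
move=> [p sp up].
exists (\poly_(k < len.+1) conjc p`_(len - k)); first exact: size_poly.
move=> x; rewrite up conjcM.
have -> : conjc (cis x ^ lo) = cis x ^ (- lo).
  by rewrite -!cisMz mulrNz mulNr cisN.
rewrite opprD expfzDr ?cis_neq0// -mulrA; congr (_ * _).
rewrite (horner_coef_wide _ sp) conjc_sum horner_poly mulr_sumr.
rewrite (reindex_inj rev_ord_inj) /=; apply: eq_bigr => k _.
rewrite conjcM subSS mulrCA; congr (_ * _).
rewrite -!cisMn -cisN -cisMz -cisD; congr cis.
have kl : (k <= len)%N by have := ltn_ord k; lia.
by rewrite mulrNz -pmulrn natrB//; ring.
Qed.

Lemma spec_band lo len W u : spec lo len u -> - W%:Z <= lo ->
  lo + len%:Z <= W%:Z -> band W u.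
Proof. by move=> h h1 h2; apply: spec_widen h; lia. Qed.

Lemma bandM W1 W2 u v : band W1 u -> band W2 v -> band (W1 + W2) (fun x => u x * v x).
Proof. by move=> h1 h2; have := specM h1 h2; apply: spec_widen; lia. Qed.

Lemma bandD W u v : band W u -> band W v -> band W (fun x => u x + v x).
Proof. exact: specD. Qed.

Lemma band_conj W u : band W u -> band W (fun x => conjc (u x)).
Proof. by move/spec_conj; apply: spec_widen; lia. Qed.

Lemma band_cst W (c : R[i]) : band W (fun=> c).
Proof.
apply: (@spec_widen 0 0); [lia|lia|exists c%:P].
  by rewrite size_polyC; case: (_ != _).
by move=> x; rewrite hornerC expr0z mul1r.
Qed.

Lemma sum_node_spec L (lo len : nat) u : (0 < lo)%N -> (lo + len < L)%N ->
  spec lo len u -> \sum_(i < L) u (node L i) = 0.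
Proof.
move=> lo0 loL [p sp up].
under eq_bigr do rewrite up (horner_coef_wide _ sp) mulr_sumr.
rewrite exchange_big /=; apply: big1 => k _.
transitivity (p`_k * \sum_(i < L) cis ((lo + k)%:R * node L i)).
  rewrite mulr_sumr; apply: eq_bigr => i _.
  by rewrite mulrCA -exprnP -exprD cisMn.
have kl := ltn_ord k.
rewrite sum_cis_node; last by lia.
by rewrite gtnNdvd ?mulr0//; lia.
Qed.

(** A polynomial whose frequencies all exceed [W] is orthogonal to the
    polynomials of degree at most [W]. *)
Lemma sum_node_gap L (lo len W : nat) u v : (W < lo)%N -> (lo + len + W < L)%N ->
  spec lo len u -> band W v -> \sum_(i < L) u (node L i) * v (node L i) = 0.
Proof.
move=> h1 h2 hu hv; have h := specM hu hv.
apply: (@sum_node_spec L (lo - W) (len + (W + W)) (fun x => u x * v x)); [lia|lia|].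
by apply: spec_widen h; lia.
Qed.

Lemma sum_node_gap_conj L (lo len W : nat) u v : (W < lo)%N -> (lo + len + W < L)%N ->
  spec lo len u -> band W v -> \sum_(i < L) conjc (u (node L i)) * v (node L i) = 0.
Proof.
move=> h1 h2 hu hv; have := sum_node_gap h1 h2 hu (band_conj hv).
move/(congr1 conjc); rewrite conjc_sum conjc0 => E; rewrite -[RHS]E.
by apply: eq_bigr => i _; rewrite conjcM conjcK.
Qed.

Lemma block_spec1 (w : nat -> R[i]) A B (d : 'I_A -> 'I_B -> R) x2 :
  spec A (3 * A) (fun x1 => block w d (x1, x2)).
Proof.
apply: spec_sum => k1; apply: spec_sum => k2 /=.
exists ((((trapezoid A k1 * trapezoid B k2)%:C * hat d k1 k2 *
    (w (A + k1)%N * w (B + k2)%N)) * cis ((B + k2)%:R * x2)) *: 'X^k1).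
  apply: leq_trans (size_scale_leq _ _) _; rewrite size_polyXn.
  by have := ltn_ord k1; lia.
by move=> x; rewrite hornerZ hornerXn (natrD _ A k1) mulrDl cisD !cisMn -exprnP /=; ring.
Qed.

Lemma block_spec2 (w : nat -> R[i]) A B (d : 'I_A -> 'I_B -> R) x1 :
  spec B (3 * B) (fun x2 => block w d (x1, x2)).
Proof.
apply: spec_sum => k1; apply: spec_sum => k2 /=.
exists ((((trapezoid A k1 * trapezoid B k2)%:C * hat d k1 k2 *
    (w (A + k1)%N * w (B + k2)%N)) * cis ((A + k1)%:R * x1)) *: 'X^k2).
  apply: leq_trans (size_scale_leq _ _) _; rewrite size_polyXn.
  by have := ltn_ord k2; lia.
by move=> x; rewrite hornerZ hornerXn (natrD _ B k2) mulrDl cisD !cisMn -exprnP /=; ring.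
Qed.

End Spectrum.

(** * Riesz products over hyperbolic blocks *)

Section RieszProduct.
Context {R : realType}.
Local Open Scope complex_scope.
Variables (n : nat) (H : nat -> R * R -> R[i]).
Let L := (16 ^ n.+1)%N.
Let sc (s : nat) := (16 ^ s)%N.
Hypothesis H1 : forall s x2, (s <= n)%N ->
  spec (sc s) (3 * sc s) (fun x1 => H s (x1, x2)).
Hypothesis H2 : forall s x1, (s <= n)%N ->
  spec (sc (n - s)) (3 * sc (n - s)) (fun x2 => H s (x1, x2)).

(** The factors of the Riesz product are [1 + Re (H s)]. *)
Definition riesz_re s x : R[i] := 2^-1 * (H s x + conjc (H s x)).

(** The part of the Riesz product with indices in [a, b). *)
Definition riesz_prod (a b : nat) x : R[i] :=
  \prod_(a <= s < b) (1 + riesz_re s x).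

(** Sum over the [L x L] grid of the torus. *)
Definition grid_sum (L : nat) (u : R * R -> R[i]) : R[i] :=
  \sum_(i1 < L) \sum_(i2 < L) u (node L i1, node L i2).

Lemma grid_sumD N u v : grid_sum N (fun x => u x + v x) = grid_sum N u + grid_sum N v.
Proof.
rewrite /grid_sum -big_split /=; apply: eq_bigr => i _.
by rewrite -big_split.
Qed.

Lemma grid_sum_sum N (I : Type) (s : seq I) (F : I -> R * R -> R[i]) :
  grid_sum N (fun x => \sum_(i <- s) F i x) = \sum_(i <- s) grid_sum N (F i).
Proof.
by rewrite /grid_sum; under eq_bigr do rewrite exchange_big /=; rewrite exchange_big.
Qed.

Lemma grid_sumZ N (c : R[i]) u : grid_sum N (fun x => c * u x) = c * grid_sum N u.
Proof.
by rewrite /grid_sum mulr_sumr; apply: eq_bigr => i _; rewrite mulr_sumr.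
Qed.

Lemma eq_grid_sum N u v : u =1 v -> grid_sum N u = grid_sum N v.
Proof. by move=> uv; rewrite /grid_sum; under eq_bigr do under eq_bigr do rewrite uv. Qed.

(** Expansion of the product according to its largest index. *)
Lemma riesz_prod_max b x :
  riesz_prod 0 b x = 1 + \sum_(0 <= t < b) riesz_re t x * riesz_prod 0 t x.
Proof.
elim: b => [|b IH]; first by rewrite /riesz_prod !big_geq ?addr0.
rewrite {1}/riesz_prod !big_nat_recr//= -/(riesz_prod 0 b x) mulrDr mulr1.
by rewrite addrA -IH; congr (_ + _); exact: mulrC.
Qed.

(** Expansion of the product according to its smallest index. *)
Lemma riesz_prod_min b x :
  riesz_prod 0 b x = 1 + \sum_(0 <= t < b) riesz_re t x * riesz_prod t.+1 b x.
Proof.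
elim: b => [|b IH]; first by rewrite /riesz_prod !big_geq ?addr0.
have E t : (t <= b)%N -> riesz_prod t b.+1 x = riesz_prod t b x * (1 + riesz_re b x).
  by move=> tb; rewrite /riesz_prod big_nat_recr.
rewrite E// IH big_nat_recr//= mulrDl mul1r -addrA; congr (1 + _).
have -> : riesz_prod b.+1 b.+1 x = 1 by rewrite /riesz_prod big_geq.
rewrite mulr1 addrC; congr (_ + _).
rewrite mulr_suml !big_mkord; apply: eq_bigr => t _.
by rewrite E ?ltn_ord// mulrA.
Qed.

Lemma band_re1 s x2 : (s <= n)%N -> band (4 * sc s) (fun x1 => riesz_re s (x1, x2)).
Proof.
move=> sn; have h := H1 x2 sn; apply: specZ; apply: bandD.
  by apply: spec_band h _ _; lia.
by apply: band_conj; apply: spec_band h _ _; lia.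
Qed.

Lemma band_re2 s x1 : (s <= n)%N -> band (4 * sc (n - s)) (fun x2 => riesz_re s (x1, x2)).
Proof.
move=> sn; have h := H2 x1 sn; apply: specZ; apply: bandD.
  by apply: spec_band h _ _; lia.
by apply: band_conj; apply: spec_band h _ _; lia.
Qed.

Lemma band_prod (W : nat -> nat) (G : nat -> R -> R[i]) a b :
    (forall s, (a <= s < b)%N -> band (W s) (G s)) ->
  band (\sum_(a <= s < b) W s) (fun x => \prod_(a <= s < b) (1 + G s x)).
Proof.
elim: b => [|b IH] hG.
  rewrite big_geq// (_ : (fun x => _) = fun=> 1); first exact: band_cst.
  by apply/funext => x; rewrite big_geq.
have [ba|ab] := ltnP b a.
  rewrite big_geq// (_ : (fun x => _) = fun=> 1); first exact: band_cst.
  by apply/funext => x; rewrite big_geq.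
rewrite big_nat_recr//= (_ : (fun x => _) = fun x => (\prod_(a <= s < b) (1 + G s x)) * (1 + G b x)).
  apply: bandM; first by apply: IH => s /andP[as_ sb]; apply: hG; lia.
  by apply: bandD; [exact: band_cst|apply: hG; lia].
by apply/funext => x; rewrite big_nat_recr.
Qed.

(** Lacunarity: the frequencies of a level dominate those of all smaller
    levels together. *)
Lemma sc_sum_lt t : (15 * \sum_(0 <= s < t) sc s < sc t)%N.
Proof.
elim: t => [|t IH]; first by rewrite big_geq.
have E : sc t.+1 = (16 * sc t)%N by rewrite /sc expnS.
by rewrite big_nat_recr//= E; move: IH; lia.
Qed.

Lemma sc_sum_rev t s : (t < s <= n)%N ->
  (15 * \sum_(t.+1 <= k < s) sc (n - k) + 16 * sc (n - s) <= sc (n - t))%N.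
Proof.
elim: s => [|s IH]; first by [].
rewrite ltnS => /andP[ts sn].
have E : sc (n - s) = (16 * sc (n - s.+1))%N.
  by rewrite /sc -expnS; congr (16 ^ _)%N; lia.
move: ts; rewrite leq_eqVlt => /orP[/eqP->|ts].
  by rewrite big_geq//; lia.
rewrite big_nat_recr//=; have := IH; rewrite ts (ltnW sn) => /(_ isT).
move: (\sum_(_ <= k < s) _)%N E => S; move: (sc _) (sc _) (sc _) => a b c; lia.
Qed.

Lemma sc_lt s : (s <= n)%N -> (sc s <= sc n)%N.
Proof. by move=> sn; rewrite /sc leq_exp2l. Qed.

Lemma gap1 t W v x2 : (t <= n)%N -> (W < sc t)%N -> band W v ->
  \sum_(i < L) riesz_re t (node L i, x2) * v (node L i) = 0.
Proof.
move=> tn Wt hv; have h := H1 x2 tn; have := sc_lt tn => st.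
have LE : L = (16 * sc n)%N by rewrite /L /sc expnS.
transitivity (2^-1 * (\sum_(i < L) H t (node L i, x2) * v (node L i) +
   \sum_(i < L) conjc (H t (node L i, x2)) * v (node L i))).
  rewrite -big_split mulr_sumr /=; apply: eq_bigr => i _.
  by rewrite /riesz_re -mulrA mulrDl.
rewrite (sum_node_gap Wt _ h hv); last by lia.
by rewrite (sum_node_gap_conj Wt _ h hv) ?addr0 ?mulr0//; lia.
Qed.

Lemma gap2 t W v x1 : (t <= n)%N -> (W < sc (n - t))%N -> band W v ->
  \sum_(i < L) riesz_re t (x1, node L i) * v (node L i) = 0.
Proof.
move=> tn Wt hv; have h := H2 x1 tn; have := @sc_lt (n - t) (leq_subr _ _) => st.
have LE : L = (16 * sc n)%N by rewrite /L /sc expnS.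
transitivity (2^-1 * (\sum_(i < L) H t (x1, node L i) * v (node L i) +
   \sum_(i < L) conjc (H t (x1, node L i)) * v (node L i))).
  rewrite -big_split mulr_sumr /=; apply: eq_bigr => i _.
  by rewrite /riesz_re -mulrA mulrDl.
rewrite (sum_node_gap Wt _ h hv); last by lia.
by rewrite (sum_node_gap_conj Wt _ h hv) ?addr0 ?mulr0//; lia.
Qed.

Lemma riesz_prod_band1 t x2 : (t <= n.+1)%N ->
  band (4 * \sum_(0 <= s < t) sc s) (fun x1 => riesz_prod 0 t (x1, x2)).
Proof.
move=> tn; rewrite big_distrr /=; apply: (@band_prod (fun s => 4 * sc s)%N (fun s x1 => riesz_re s (x1, x2))).
by move=> s /andP[_ st]; apply: band_re1; lia.
Qed.

Lemma riesz_prod_band2 a b x1 : (b <= n.+1)%N ->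
  band (4 * \sum_(a <= s < b) sc (n - s)) (fun x2 => riesz_prod a b (x1, x2)).
Proof.
move=> tn; rewrite big_distrr /=; apply: (@band_prod (fun s => 4 * sc (n - s))%N (fun s x2 => riesz_re s (x1, x2))).
by move=> s /andP[_ st]; apply: band_re2; lia.
Qed.

(** The Riesz product has mean one over the grid. *)
Lemma grid_sum_riesz : grid_sum L (riesz_prod 0 n.+1) = (L * L)%:R.
Proof.
rewrite (eq_grid_sum L (riesz_prod_max n.+1)) grid_sumD grid_sum_sum.
rewrite {1}/grid_sum !(sumr_const, card_ord) -mulrnA big_nat big1 ?addr0//.
move=> t /andP[_ tn]; rewrite /grid_sum exchange_big /=; apply: big1 => i2 _.
have tn' : (t <= n.+1)%N by lia.
apply: (gap1 _ _ _ (riesz_prod_band1 (node L i2) tn')); first by lia.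
by have := sc_sum_lt t; lia.
Qed.

Variable (s : nat) (sn : (s <= n)%N) (f : R * R -> R[i]).
Hypothesis f1 : forall x2, spec (sc s) (3 * sc s) (fun x1 => f (x1, x2)).
Hypothesis f2 : forall x1, spec (sc (n - s)) (3 * sc (n - s)) (fun x2 => f (x1, x2)).

(** Only the first-order term of the Riesz product correlates with a
    polynomial living on one of its blocks.  In the first variable a product
    of several factors lives near the frequencies of its largest index, in the
    second variable near those of its smallest index; both must be [s]. *)
Lemma grid_sum_block_riesz :
  grid_sum L (fun x => f x * riesz_prod 0 n.+1 x) =
  2^-1 * grid_sum L (fun x => f x * conjc (H s x)).
Proof.
have LE : L = (16 * sc n)%N by rewrite /L /sc expnS.
have scs := sc_lt sn; have scs' := @sc_lt (n - s) (leq_subr _ _).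
have sc0 k : (0 < sc k)%N by rewrite expn_gt0.
have f0 W v x2 : (W < sc s)%N -> band W v ->
    \sum_(i < L) f (node L i, x2) * v (node L i) = 0.
  by move=> Ws hv; apply: (sum_node_gap Ws _ (f1 x2) hv); lia.
transitivity (\sum_(0 <= t < n.+1) grid_sum L (fun x => f x * riesz_re t x * riesz_prod 0 t x)).
  rewrite -grid_sum_sum -[RHS]add0r.
  have Z : grid_sum L (fun x => f x * 1) = 0.
    rewrite /grid_sum exchange_big /=; apply: big1 => i2 _.
    exact: (f0 0%N _ _ (sc0 s) (band_cst 0 1)).
  rewrite -[X in _ = X + _]Z -grid_sumD; apply: eq_grid_sum => x.
  rewrite riesz_prod_max mulrDr mulr_sumr; congr (_ + _).
  by apply: eq_bigr => t _; rewrite mulrA.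
rewrite (bigD1_seq s) ?iota_uniq//=; last by rewrite mem_index_iota; lia.
rewrite [X in _ + X]big_seq_cond [X in _ + X]big1 ?addr0; last first.
  move=> t /andP[]; rewrite mem_index_iota => /andP[_ tn] ts.
  rewrite /grid_sum exchange_big /=; apply: big1 => i2 _.
  move: ts; rewrite neq_ltn => /orP[ts|st].
  - have tn' : (t <= n)%N by lia.
    have hb : band (4 * sc t + 4 * \sum_(0 <= k < t) sc k)
        (fun x1 => riesz_re t (x1, node L i2) * riesz_prod 0 t (x1, node L i2)).
      apply: bandM; first exact: band_re1.
      by apply: riesz_prod_band1; lia.
    under eq_bigr do rewrite -mulrA.
    apply: (f0 _ _ _ _ hb).
    have := sc_sum_lt t.+1; rewrite big_nat_recr//=.
    have : (sc t.+1 <= sc s)%N by rewrite /sc leq_exp2l.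
    lia.
  - have hb : band (4 * sc s + 4 * \sum_(0 <= k < t) sc k)
        (fun x1 => f (x1, node L i2) * riesz_prod 0 t (x1, node L i2)).
      apply: bandM; first by apply: (spec_band (f1 _)); lia.
      by apply: riesz_prod_band1; lia.
    under eq_bigr do rewrite mulrAC mulrC.
    apply: (gap1 _ _ _ hb); first by lia.
    have := sc_sum_lt t.
    have : (sc s <= \sum_(0 <= k < t) sc k)%N.
      by rewrite (bigD1_seq s) ?iota_uniq//= ?leq_addr// mem_index_iota.
    lia.
transitivity (grid_sum L (fun x => f x * riesz_re s x)).
  rewrite -[RHS]addr0.
  have Z : grid_sum L (fun x => \sum_(0 <= t < s) riesz_re t x * (f x * riesz_re s x * riesz_prod t.+1 s x)) = 0.
    rewrite grid_sum_sum big_nat; apply: big1 => t /andP[_ ts].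
    rewrite /grid_sum; apply: big1 => i1 _.
    have hb : band (4 * sc (n - s) + 4 * sc (n - s) + 4 * \sum_(t.+1 <= k < s) sc (n - k))
        (fun x2 => f (node L i1, x2) * riesz_re s (node L i1, x2) * riesz_prod t.+1 s (node L i1, x2)).
      apply: bandM; last by apply: riesz_prod_band2; lia.
      apply: bandM; first by apply: (spec_band (f2 _)); lia.
      exact: band_re2.
    apply: (gap2 _ _ _ hb); first by lia.
    have := @sc_sum_rev t s; rewrite ts sn => /(_ isT); have := sc0 (n - s)%N; lia.
  rewrite -[X in _ = _ + X]Z -grid_sumD; apply: eq_grid_sum => x.
  rewrite riesz_prod_min mulrDr mulr1 mulr_sumr; congr (_ + _).
  by apply: eq_bigr => t _; rewrite mulrCA.
rewrite -grid_sumZ.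
have Z : grid_sum L (fun x => 2^-1 * (f x * H s x)) = 0.
  rewrite grid_sumZ /grid_sum exchange_big /= big1 ?mulr0// => i2 _.
  apply: (@sum_node_spec _ L (sc s + sc s) (3 * sc s + 3 * sc s)
    (fun x1 => f (x1, node L i2) * H s (x1, node L i2))).
  - by have := sc0 s; lia.
  - by have := sc0 s; lia.
  - have h := specM (f1 (node L i2)) (H1 (node L i2) sn).
    by apply: spec_widen h; lia.
rewrite -[RHS]add0r -[X in _ = X + _]Z -grid_sumD; apply: eq_grid_sum => x; rewrite /riesz_re; ring.
Qed.

End RieszProduct.

(** * Rademacher sums *)

Section Rademacher.
Context {R : realType}.

(** Signs are encoded by booleans. *)
Definition sgn (b : bool) : R := if b then 1 else -1.

Lemma expR_ge_pow (q y : R) : 1 <= q -> 0 <= y -> y `^ q <= q `^ q * expR y.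
Proof.
move=> q1 y0; have q0 : 0 < q by exact: lt_le_trans q1.
have -> : y = q * (y / q) by field; rewrite gt_eqF.
have yq : 0 <= y / q by rewrite divr_ge0// ltW.
rewrite powRM// ?(ltW q0)//; apply: ler_wpM2l; first exact: powR_ge0.
have -> : expR (q * (y / q)) = expR (y / q) `^ q.
  by rewrite /powR gt_eqF ?expR_gt0// expRK mulrC.
apply: ge0_ler_powR; rewrite ?nnegrE ?expR_ge0 ?(ltW q0)//.
by apply: le_trans (expR_ge1Dx _); rewrite lerDr.
Qed.

Lemma expR_cosh_le (x : R) : `|x| <= 2^-1 ->
  expR x + expR (- x) <= 2 * expR (2 * x ^+ 2).
Proof.
rewrite ler_norml => /andP[x1 x2].
have h1 : expR x <= (1 - x)^-1.
  rewrite -[x in expR x]opprK expRN lef_pV2 ?posrE ?expR_gt0//; last by lra.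
  by have := expR_ge1Dx (- x); lra.
have h2 : expR (- x) <= (1 + x)^-1.
  rewrite expRN lef_pV2 ?posrE ?expR_gt0//; last by lra.
  exact: expR_ge1Dx.
apply: le_trans (lerD h1 h2) _.
have h3 := expR_ge1Dx (2 * x ^+ 2).
apply: (@le_trans _ _ (2 * (1 + 2 * x ^+ 2))); last by rewrite ler_pM2l.
have -> : (1 - x)^-1 + (1 + x)^-1 = 2 / (1 - x ^+ 2).
  by field; apply/and3P; split; apply/negP => /eqP; nra.
have xx : x ^+ 2 <= 4^-1 by nra.
have x0 : 0 <= x ^+ 2 by exact: sqr_ge0.
by rewrite ler_pdivrMr; nra.
Qed.

Lemma sum_sign_expR (T : finType) (v : T -> R) : (forall t, `|v t| <= 2^-1) ->
  \sum_(e : {ffun T -> bool}) expR (\sum_t sgn (e t) * v t) <=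
  2 ^+ #|T| * expR (2 * \sum_t v t ^+ 2).
Proof.
move=> v1.
have E (w : T -> R) : expR (\sum_t w t) = \prod_t expR (w t).
  by apply: (big_morph expR); [exact: expRD|exact: expR0].
under eq_bigr do rewrite E.
rewrite -(bigA_distr_bigA (fun t b => expR (sgn b * v t))).
rewrite mulr_sumr E -prodr_const -big_split /=.
apply: ler_prod => t _; rewrite big_bool /= mul1r mulN1r.
by rewrite addr_ge0 ?expR_ge0//= expR_cosh_le.
Qed.

(** Khinchine-type bound for the moments of complex Rademacher sums, deduced
    from the exponential moments of the real and imaginary parts. *)
Lemma sum_sign_powR (T : finType) (v : T -> R[i]) (M q : R) :
    1 <= M -> 1 <= q -> (forall t, cmod (v t) <= 1) -> \sum_t cmod (v t) ^+ 2 <= M ->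
  \sum_(e : {ffun T -> bool})
     ((4 * Num.sqrt M)^-1 * cmod (\sum_t (sgn (e t))%:C%C * v t)) `^ q <=
  2 ^+ #|T| * (q `^ q * (4 * expR 2^-1)).
Proof.
move=> M1 q1 v1 vM; set la := (4 * _)^-1.
have s1 : 1 <= Num.sqrt M by rewrite -sqrtr1 ler_wsqrtr.
have sM : Num.sqrt M ^+ 2 = M by rewrite sqr_sqrtr//; lra.
have la0 : 0 < la by rewrite invr_gt0; lra.
have la2 : 2 * la <= 2^-1.
  have : la <= 4^-1 by rewrite /la lef_pV2 ?posrE//; lra.
  by lra.
have laM : (2 * la) ^+ 2 * M = 4^-1.
  rewrite -[X in _ * X = _]sM /la; field.
  by rewrite gt_eqF//; lra.
have key (g : T -> R) : (forall t, `|g t| <= cmod (v t)) ->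
    \sum_(e : {ffun T -> bool}) expR (\sum_t sgn (e t) * (2 * la * g t)) <=
    2 ^+ #|T| * expR 2^-1.
  move=> hg; apply: le_trans (sum_sign_expR _) _.
    move=> t; rewrite normrM ger0_norm; last by rewrite mulr_ge0// ltW.
    rewrite -[leRHS]mulr1 ler_pM//; first by rewrite mulr_ge0// ltW.
    exact: le_trans (hg t) (v1 t).
  apply: ler_wpM2l; first exact: exprn_ge0.
  rewrite ler_expR.
  have : \sum_t (2 * la * g t) ^+ 2 <= (2 * la) ^+ 2 * M.
    apply: le_trans (ler_wpM2l (sqr_ge0 _) vM); rewrite mulr_sumr.
    apply: ler_sum => t _; rewrite exprMn ler_wpM2l ?sqr_ge0//.
    rewrite -(real_normK (num_real (g t))) ler_pXn2r ?nnegrE ?cmod_ge0//.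
  by rewrite laM; lra.
pose re t := complex.Re (v t); pose im t := complex.Im (v t).
have ReE (e : {ffun T -> bool}) : complex.Re (\sum_t (sgn (e t))%:C%C * v t) = \sum_t sgn (e t) * re t.
  rewrite (raddf_sum (@complex.Re R : Rcomplex R -> R)); apply: eq_bigr => t _.
  by rewrite /re; case: (v t) => a b /=; rewrite mul0r subr0.
have ImE (e : {ffun T -> bool}) : complex.Im (\sum_t (sgn (e t))%:C%C * v t) = \sum_t sgn (e t) * im t.
  rewrite (raddf_sum (@complex.Im R : Rcomplex R -> R)); apply: eq_bigr => t _.
  by rewrite /im; case: (v t) => a b /=; rewrite mul0r addr0.
have pull (e : {ffun T -> bool}) (g : T -> R) :
    \sum_t sgn (e t) * (2 * la * g t) = 2 * la * \sum_t sgn (e t) * g t.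
  by rewrite mulr_sumr; apply: eq_bigr => t _; rewrite mulrCA.
apply: (@le_trans _ _ (\sum_(e : {ffun T -> bool}) q `^ q *
  ((expR (\sum_t sgn (e t) * (2 * la * re t)) + expR (\sum_t sgn (e t) * (2 * la * - re t))) +
   (expR (\sum_t sgn (e t) * (2 * la * im t)) + expR (\sum_t sgn (e t) * (2 * la * - im t)))))).
  apply: ler_sum => e _.
  set z := \sum_t _.
  have y0 : 0 <= la * cmod z by rewrite mulr_ge0 ?cmod_ge0// ltW.
  apply: le_trans (expR_ge_pow q1 y0) _; apply: ler_wpM2l; first exact: powR_ge0.
  rewrite !pull.
  have Npull (g : T -> R) : \sum_t sgn (e t) * - g t = - \sum_t sgn (e t) * g t.
    by rewrite -sumrN; apply: eq_bigr => t _; rewrite mulrN.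
  rewrite !Npull -ReE -ImE -/z.
  set a := complex.Re z; set b := complex.Im z.
  have zab : cmod z <= `|a| + `|b| by exact: cmod_le_ReIm.
  have E (c : R) : expR (2 * la * `|c|) <= expR (2 * la * c) + expR (2 * la * - c).
    by have [_|_] := ger0P c; rewrite ?lerDl ?lerDr expR_ge0.
  have [ab|ba] := leP `|a| `|b|.
    apply: (@le_trans _ _ (expR (2 * la * `|b|))).
      by rewrite ler_expR; have := ler_wpM2l (ltW la0) zab; have := ler_wpM2l (ltW la0) ab; lra.
    apply: le_trans (E b) _; rewrite lerDr addr_ge0// expR_ge0.
  apply: (@le_trans _ _ (expR (2 * la * `|a|))).
    by rewrite ler_expR; have := ler_wpM2l (ltW la0) zab; have := ler_wpM2l (ltW la0) (ltW ba); lra.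
  apply: le_trans (E a) _; rewrite lerDl addr_ge0// expR_ge0.
rewrite -mulr_sumr !big_split /= mulrCA ler_wpM2l ?powR_ge0//.
have h1 := @key re (fun t => ler_Re_cmod _).
have h2 := @key im (fun t => ler_Im_cmod _).
have h3 := @key (fun t => - re t) (fun t => eq_ind_r (fun x => x <= _) (ler_Re_cmod _) (normrN _)).
have h4 := @key (fun t => - im t) (fun t => eq_ind_r (fun x => x <= _) (ler_Im_cmod _) (normrN _)).
lra.
Qed.

End Rademacher.

(** * The random family of test functions *)

Section ComplexMeasurable.
Context {R : realType}.
Notation R2 := (measurableTypeR R * measurableTypeR R)%type.
Local Open Scope complex_scope.
Implicit Types f g : R * R -> R[i].

Lemma cmeasurableD f g : cmeasurable f -> cmeasurable g -> cmeasurable (fun x => f x + g x).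
Proof.
move=> [f1 f2] [g1 g2]; split.
- rewrite (_ : (fun _ => _) = (fun x => complex.Re (f x) + complex.Re (g x))).
    exact: measurable_funD.
  by apply/funext => x; rewrite ReD.
- rewrite (_ : (fun _ => _) = (fun x => complex.Im (f x) + complex.Im (g x))).
    exact: measurable_funD.
  by apply/funext => x; rewrite ImD.
Qed.

Lemma cmeasurableM f g : cmeasurable f -> cmeasurable g -> cmeasurable (fun x => f x * g x).
Proof.
move=> [f1 f2] [g1 g2]; split.
- rewrite (_ : (fun _ => _) = (fun x => complex.Re (f x) * complex.Re (g x) - complex.Im (f x) * complex.Im (g x))).
    by apply: measurable_funB; exact: measurable_funM.
  by apply/funext => x; rewrite ReM mulNr.
- rewrite (_ : (fun _ => _) = (fun x => complex.Re (f x) * complex.Im (g x) + complex.Im (f x) * complex.Re (g x))).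
    by apply: measurable_funD; exact: measurable_funM.
  by apply/funext => x; rewrite ImM.
Qed.

Lemma cmeasurable_cst (c : R[i]) : cmeasurable (fun=> c).
Proof. by split. Qed.

Lemma cmeasurable_sum (I : Type) (s : seq I) (F : I -> R * R -> R[i]) :
  (forall i, cmeasurable (F i)) -> cmeasurable (fun x => \sum_(i <- s) F i x).
Proof.
move=> hF; elim: s => [|i s IH].
  by under eq_fun do rewrite big_nil; exact: cmeasurable_cst.
by under eq_fun do rewrite big_cons; exact: cmeasurableD.
Qed.

Lemma cmeasurable_cis (k : R) (p : R2 -> measurableTypeR R) :
  measurable_fun [set: R2] p -> cmeasurable (fun x => cis (k * p x)).
Proof.
move=> mp; split => /=.
- apply: (measurableT_comp (f := cos)).
    by apply: continuous_measurable_fun; exact: continuous_cos.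
  exact: measurable_funM.
- apply: (measurableT_comp (f := sin)).
    by apply: continuous_measurable_fun; exact: continuous_sin.
  exact: measurable_funM.
Qed.

Lemma measurable_cmod f : cmeasurable f -> measurable_fun [set: R2] (fun x => cmod (f x)).
Proof.
move=> [f1 f2].
rewrite (_ : (fun _ => _) = (fun x => Num.sqrt (complex.Re (f x) ^+ 2 + complex.Im (f x) ^+ 2))).
  have mS : measurable_fun [set: measurableTypeR R] (fun y : R => Num.sqrt y).
    by apply: continuous_measurable_fun => y; exact: sqrt_continuous.
  have mF : measurable_fun [set: R2] (fun x => complex.Re (f x) ^+ 2 + complex.Im (f x) ^+ 2).
    by apply: measurable_funD; exact: measurable_funX.
  exact: (measurableT_comp mS mF).
by apply/funext => x; rewrite /cmod normc_def.
Qed.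

Lemma cmeasurable_block (w : nat -> R[i]) A B (d : 'I_A -> 'I_B -> R) :
  cmeasurable (block w d).
Proof.
apply: cmeasurable_sum => k1; apply: cmeasurable_sum => k2.
apply: cmeasurableM; first exact: cmeasurable_cst.
apply: cmeasurableM; first exact: cmeasurable_cst.
apply: cmeasurableM; apply: cmeasurable_cis; [exact: measurable_fst|exact: measurable_snd].
Qed.

Lemma cis_nat_period (k : nat) (x : R) : cis (k%:R * (x + 2 * pi)) = cis (k%:R * x).
Proof. by rewrite mulrDr cisD [cis (k%:R * (2 * pi))]cisMn cis2pi expr1n mulr1. Qed.

Lemma periodic2_block (w : nat -> R[i]) A B (d : 'I_A -> 'I_B -> R) :
  periodic2 (block w d).
Proof.
move=> x1 x2; split; apply: eq_bigr => k1 _; apply: eq_bigr => k2 _ /=;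
  by rewrite cis_nat_period.
Qed.

Lemma torus_measureT : @torus_measure R [set: R2] = 1%E.
Proof.
have p0 : 0 < 2 * pi :> R by rewrite mulr_gt0// pi_gt0.
have E : (@lebesgue_measure R \x @lebesgue_measure R)%E (@torus R) = ((2 * pi) * (2 * pi))%:E.
  have mD : measurable (`[0, 2 * pi[%classic : set (measurableTypeR R)) by exact: measurable_itv.
  have muD : @lebesgue_measure R `[0, 2 * pi[%classic = (2 * pi)%:E.
    by rewrite lebesgue_measure_itv/= lte_fin p0 -EFinB subr0.
  by rewrite EFinM -muD; exact: product_measure1E.
transitivity (((2 * pi) ^- 2)%:E * (@lebesgue_measure R \x @lebesgue_measure R)%E ([set: R2] `&` @torus R))%E.
  by [].
rewrite setTI E -EFinM; congr (_%:E).
by move: (gt_eqF p0); move: (2 * pi) => P P0; field; rewrite P0.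
Qed.

End ComplexMeasurable.

Section Family.
Context {R : realType}.
Variable n : nat.
Local Open Scope complex_scope.

(** The nodes of the block of level [s]: there are [16 ^ n] of them, whatever
    the level. *)
Definition blockJ (s : 'I_n.+1) := ('I_(16 ^ s) * 'I_(16 ^ (n - s)))%type.

(** A level together with one of its nodes. *)
Definition blockT := {s : 'I_n.+1 & blockJ s}.

(** The coefficients of level [s]. *)
Definition block_coef (a : blockT -> R) (s : 'I_n.+1) : 'I_(16 ^ s) -> 'I_(16 ^ (n - s)) -> R :=
  fun j1 j2 => a (Tagged blockJ (j1, j2)).

(** Sum of the blocks at all levels, with multiplier [w]. *)
Definition trig (w : nat -> R[i]) (a : blockT -> R) x : R[i] :=
  \sum_(s < n.+1) block w (@block_coef a s) x.

(** The two-variable kernel attached to a level and a node. *)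
Definition ker2 (w : nat -> R[i]) (t : blockT) (x : R * R) : R[i] :=
  ker w (16 ^ tag t) (tagged t).1 x.1 * ker w (16 ^ (n - tag t)) (tagged t).2 x.2.

Lemma sum_blockT (V : nmodType) (F : blockT -> V) :
  \sum_t F t = \sum_(s < n.+1) \sum_(j1 : 'I_(16 ^ s)) \sum_(j2 : 'I_(16 ^ (n - s)))
    F (Tagged blockJ (j1, j2)).
Proof.
transitivity (\sum_(s < n.+1) \sum_(p : blockJ s) F (Tagged blockJ p)).
  by rewrite (sig_big_dep xpredT (fun s _ => true) (fun s (p : blockJ s) => F (Tagged blockJ p)));
    apply: eq_bigr => -[s p].
apply: eq_bigr => s _; rewrite pair_big /=; apply: eq_bigr => -[j1 j2] _ //.
Qed.

Lemma card_blockT : #|{: blockT}| = (n.+1 * 16 ^ n)%N.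
Proof.
rewrite -sum1_card (sum_blockT (fun=> 1%N)).
rewrite (eq_bigr (fun=> 16 ^ n)%N); first by rewrite sum_nat_const card_ord.
move=> s _; rewrite !sum_nat_const !card_ord muln1 -expnD subnKC//.
by have := ltn_ord s.
Qed.

Lemma trigE w a x : trig w a x = \sum_t (a t)%:C * ker2 w t x.
Proof.
rewrite sum_blockT; apply: eq_bigr => s _; rewrite blockE.
by [].
Qed.

Lemma sum_cmod_ker2 x : \sum_t cmod (ker2 (fun=> 1) t x) <= n.+1%:R.
Proof.
rewrite sum_blockT -[leRHS]mulr1 mulr_natl -[X in _ <= _ *+ X]card_ord -sumr_const.
apply: ler_sum => s _.
by apply: sum_cmod_ker_prod; rewrite expn_gt0.
Qed.

Lemma cmod_ker2_le1 t x : cmod (ker2 (fun=> 1) t x) <= 1.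
Proof.
have h := @sum_cmod_ker_prod R (16 ^ tag t) (16 ^ (n - tag t)) x.
apply: le_trans (h _ _); rewrite ?expn_gt0//.
rewrite (bigD1 (tagged t).1)//= (bigD1 (tagged t).2)//= -addrA lerDl.
by apply: addr_ge0; repeat (apply: sumr_ge0 => ? _); exact: cmod_ge0.
Qed.

Lemma sum_cmod_ker2_sq x : \sum_t cmod (ker2 (fun=> 1) t x) ^+ 2 <= n.+1%:R.
Proof.
apply: le_trans (sum_cmod_ker2 x); apply: ler_sum => t _.
by rewrite expr2 ler_piMl ?cmod_ge0 ?cmod_ker2_le1.
Qed.

Lemma cmeasurable_trig w a : cmeasurable (trig w a).
Proof. by apply: cmeasurable_sum => s; exact: cmeasurable_block. Qed.

Lemma periodic2_trig w a : periodic2 (trig w a).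
Proof.
by move=> x1 x2; split; apply: eq_bigr => s _; have [] := periodic2_block w (@block_coef a s) x1 x2.
Qed.

End Family.

Section GoodSigns.
Context {R : realType}.
Notation R2 := (measurableTypeR R * measurableTypeR R)%type.
Notation tm := (@torus_measure R).
Local Open Scope complex_scope.

Lemma Lq_norm_le1 (q : R) (f : R * R -> R[i]) : 1 <= q ->
  (\int[tm]_x (cmod (f x) `^ q)%:E <= 1)%E -> (Lq_norm q f <= 1)%E.
Proof.
move=> q1 h; have q0 : 0 < q by exact: lt_le_trans q1.
rewrite /Lq_norm unlock.
rewrite -[leRHS](@poweR1r R q^-1).
apply: gt0_ler_poweR; rewrite ?invr_ge0 ?(ltW q0)// ?in_itv /=.
- by rewrite leey andbT integral_ge0// => x _; rewrite poweR_ge0.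
- by rewrite leey andbT lee01.
apply: le_trans h; rewrite le_eqVlt; apply/orP; left; apply/eqP.
by apply: eq_integral => x _ /=; rewrite ger0_norm ?cmod_ge0.
Qed.

(** Markov inequality: a nonnegative functional of the signs is at most twice
    its mean for at least half of the sign choices. *)
Lemma card_good_signs (T : finType) (I : {ffun T -> bool} -> \bar R) (K : R) :
    0 < K -> (forall e, 0 <= I e)%E ->
    (\sum_(e : {ffun T -> bool}) I e <= (2 ^+ #|T| * K)%:E)%E ->
  (2 ^ #|T| <= 2 * #|[pred e : {ffun T -> bool} | (I e <= (2 * K)%:E)%E]|)%N.
Proof.
move=> K0 I0 hI; set G := [pred e | _].
have cardT : #|{ffun T -> bool}| = (2 ^ #|T|)%N by rewrite card_ffun card_bool.
have cardG := cardC G; rewrite cardT in cardG.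
suff bad : (2 * #|[predC G]| <= 2 ^ #|T|)%N.
  rewrite -cardG in bad *; move: bad; move: #|G| #|[predC G]| => a b; lia.
have h : ((2 * K *+ #|[predC G]|)%:E <= (2 ^+ #|T| * K)%:E)%E.
  apply: le_trans hI; rewrite (bigID (mem [predC G])) /=.
  rewrite -[leLHS]adde0; apply: leeD; last by apply: sume_ge0.
  rewrite -sumr_const -sumEFin; apply: lee_sum => e.
  by rewrite !inE -ltNge => /ltW.
move: h; rewrite lee_fin -mulr_natr -mulrA [K * _]mulrC mulrA ler_pM2r//.
by rewrite -natrM -natrX ler_nat.
Qed.

(** For at least half of the sign choices, the random polynomial has
    [L_q] norm of order [sqrt (n + 1)], with a constant that depends on [q]
    only. *)
Lemma good_signs (q : R) : 1 <= q -> exists2 C : R, 0 < C & forall n : nat,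
  (2 ^ #|{: blockT n}| <= 2 * #|[pred e : {ffun blockT n -> bool} |
     (Lq_norm q (fun x => ((C / Num.sqrt n.+1%:R)%:C *
        trig (fun=> 1) (fun t => sgn (e t)) x)%R) <= 1)%E]|)%N.
Proof.
move=> q1; have q0 : 0 < q by exact: lt_le_trans q1.
pose K := q `^ q * (4 * expR 2^-1).
have K0 : 0 < K by rewrite !mulr_gt0 ?powR_gt0 ?expR_gt0.
pose ka := (2 * K)^-1 `^ q^-1.
have K20 : 0 < (2 * K)^-1 by rewrite invr_gt0 mulr_gt0.
have ka0 : 0 < ka by rewrite powR_gt0.
have kaq : ka `^ q = (2 * K)^-1 by rewrite /ka -powRrM mulVf ?gt_eqF// powRr1// ltW.
exists (4^-1 * ka) => [|n]; first by rewrite mulr_gt0.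
pose la : R := (4 * Num.sqrt n.+1%:R)^-1.
have la0 : 0 <= la by rewrite invr_ge0 mulr_ge0// sqrtr_ge0.
pose phi (e : {ffun blockT n -> bool}) x : R[i] := trig (fun=> 1) (fun t => sgn (e t)) x.
pose F e x := (la * cmod (phi e x)) `^ q.
have mF e : measurable_fun [set: R2] (EFin \o F e).
  apply/measurable_EFinP; apply: (measurableT_comp (measurable_powR q)).
  by apply: measurable_funM => //; apply: measurable_cmod; exact: cmeasurable_trig.
have F0 e x : (0 <= (F e x)%:E)%E by rewrite lee_fin powR_ge0.
have := @card_good_signs _ (fun e => \int[tm]_x (F e x)%:E)%E K K0.
have I0 e : (0 <= \int[tm]_x (F e x)%:E)%E by exact: integral_ge0.
move=> /(_ I0) H; apply: leq_trans (H _) _; last first.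
  rewrite leq_mul2l /=; apply: subset_leq_card; apply/fintype.subsetP => e; rewrite !inE => he.
  apply: Lq_norm_le1 => //.
  have E x : (cmod ((4^-1 * ka / Num.sqrt n.+1%:R)%:C * trig (fun=> 1) (fun t => sgn (e t)) x) `^ q)%:E =
      ((2 * K)^-1%:E * (F e x)%:E)%E.
    rewrite -EFinM; congr (_%:E).
    rewrite cmodM cmod_real ger0_norm; last first.
      by rewrite divr_ge0 ?sqrtr_ge0// mulr_ge0// ltW.
    have -> : 4^-1 * ka / Num.sqrt n.+1%:R = ka * la by rewrite /la invfM; ring.
    by rewrite -mulrA powRM ?(ltW ka0) ?mulr_ge0 ?cmod_ge0// kaq.
  under eq_integral do rewrite E.
  rewrite ge0_integralZl//; [|exact: mF|by rewrite lee_fin ltW].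
  apply: (@le_trans _ _ ((2 * K)^-1%:E * (2 * K)%:E)%E).
    by apply: lee_wpmul2l => //; rewrite lee_fin ltW.
  by rewrite -EFinM mulVf// gt_eqF// mulr_gt0.
apply: (@le_trans _ _ (\int[tm]_x (\sum_(e : {ffun blockT n -> bool}) (F e x)%:E))%E).
  by rewrite ge0_integral_sum.
apply: (@le_trans _ _ (\int[tm]_x (cst (2 ^+ #|{: blockT n}| * K)%:E x))%E).
  apply: ge0_le_integral => //.
  - by move=> x _; apply: sume_ge0.
  - by apply: emeasurable_sum.
  move=> x _; rewrite sumEFin lee_fin /F /phi.
  have := @sum_sign_powR R (blockT n) (fun t => ker2 (fun=> 1) t x) n.+1%:R q _ q1
    (fun t => cmod_ker2_le1 _ _) (sum_cmod_ker2_sq n x).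
  rewrite ler1n => /(_ isT); apply: le_trans.
  by under eq_bigr do rewrite trigE.
by rewrite integral_cst// torus_measureT mule1.
Qed.

End GoodSigns.

(** * The dual function of a choice of coefficients *)

Section Linear.
Context {R : realType}.
Variable n : nat.
Local Open Scope complex_scope.
Implicit Types (a : blockT n -> R) (w : nat -> R[i]).

Lemma trigB w a a' x : trig w (fun t => a t - a' t) x = trig w a x - trig w a' x.
Proof.
rewrite !trigE -sumrB; apply: eq_bigr => t _.
by rewrite rmorphB mulrBl.
Qed.

Lemma trigZ w (c : R) a x : trig w (fun t => c * a t) x = c%:C * trig w a x.
Proof.
rewrite !trigE mulr_sumr; apply: eq_bigr => t _.
by rewrite rmorphM mulrA.
Qed.

Lemma cmod_ker_le1 w A j (x : R) : (0 < A)%N -> (forall k, (A <= k)%N -> cmod (w k) <= 1) ->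
  cmod (ker w A j x) <= 1.
Proof.
move=> A0 w1; rewrite -(sum_trapezoid1 A0).
apply: le_trans (cmod_sum _ _ _) _; apply: ler_sum => k _.
rewrite !cmodM cmod_conj !cmod_cis !mulr1 cmod_real ger0_norm ?trapezoid_ge0//.
by rewrite ler_piMr ?trapezoid_ge0// w1// leq_addr.
Qed.

Lemma cmod_F1_coef (r : R) (k : nat) : cmod (F1_coef r k) = k%:R `^ (- r).
Proof. by rewrite cmodM cmod_cis mulr1 cmod_real ger0_norm ?powR_ge0. Qed.

Lemma cmod_F1_coef_le1 (r : R) (k : nat) : 0 < r -> (0 < k)%N -> cmod (F1_coef r k) <= 1.
Proof.
move=> r0 k0; rewrite cmod_F1_coef -[leRHS](powRr0 k%:R) ler_powR ?ler1n//.
by rewrite oppr_le0 ltW.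
Qed.

Lemma cmod_trig_le (r : R) a x : 0 < r -> (forall t, `|a t| <= 1) ->
  cmod (trig (F1_coef r) a x) <= (n.+1 * 16 ^ n)%:R.
Proof.
move=> r0 a1; rewrite trigE -card_blockT -[X in _ <= X%:R]sum1_card natr_sum.
apply: le_trans (cmod_sum _ _ _) _; apply: ler_sum => t _.
rewrite /ker2 !cmodM cmod_real -[leRHS]mulr1 ler_pM ?mulr_ge0 ?cmod_ge0//.
have h A j y : (0 < A)%N -> cmod (ker (F1_coef r) A j y) <= 1.
  move=> A0; apply: cmod_ker_le1 => // k Ak; apply: cmod_F1_coef_le1 => //.
  exact: leq_trans A0 Ak.
by rewrite -[leRHS]mulr1 ler_pM ?cmod_ge0// h// expn_gt0.
Qed.

Lemma convolution_trig (r rho : R) a x : 0 < r -> torus x ->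
  convolution (fun y => rho%:C * trig (fun=> 1) a y) (F2 r) x =
  rho%:C * trig (F1_coef r) a x.
Proof.
move=> r0 [D1 D2].
pose J (s : 'I_n.+1) := ('I_(3 * 16 ^ s) * 'I_(3 * 16 ^ (n - s)))%type.
pose S := {s : 'I_n.+1 & J s}.
pose k1 (i : S) := (16 ^ tag i + (tagged i).1)%N.
pose k2 (i : S) := (16 ^ (n - tag i) + (tagged i).2)%N.
pose c (i : S) := rho%:C * ((trapezoid (16 ^ tag i) (tagged i).1 * trapezoid (16 ^ (n - tag i)) (tagged i).2)%:C *
  hat (@block_coef R n a (tag i)) (tagged i).1 (tagged i).2).
have E w y : rho%:C * trig w a y = \sum_(i : S) c i * (w (k1 i) * w (k2 i) *
    (cis ((k1 i)%:R * y.1) * cis ((k2 i)%:R * y.2))).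
  rewrite /trig mulr_sumr.
  transitivity (\sum_(s < n.+1) \sum_(p : J s) c (Tagged J p) * (w (k1 (Tagged J p)) * w (k2 (Tagged J p)) *
    (cis ((k1 (Tagged J p))%:R * y.1) * cis ((k2 (Tagged J p))%:R * y.2)))).
    apply: eq_bigr => s _.
    rewrite -(pair_bigA _ (fun p1 p2 => c (Tagged J (p1, p2)) * (w (k1 (Tagged J (p1, p2))) * w (k2 (Tagged J (p1, p2))) *
    (cis ((k1 (Tagged J (p1, p2)))%:R * y.1) * cis ((k2 (Tagged J (p1, p2)))%:R * y.2))))) /=.
    rewrite /block mulr_sumr; apply: eq_bigr => p1 _.
    rewrite mulr_sumr; apply: eq_bigr => p2 _.
    by rewrite /c /k1 /k2 /= mulrA.
  rewrite (sig_big_dep xpredT (fun s _ => true) (fun s (p : J s) => c (Tagged J p) * (w (k1 (Tagged J p)) * w (k2 (Tagged J p)) *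
    (cis ((k1 (Tagged J p))%:R * y.1) * cis ((k2 (Tagged J p))%:R * y.2))))) /=.
  by apply: eq_bigr => -[s p].
rewrite E -(convolution_F2 r0 (index_enum S) c (k1 := k1) (k2 := k2))//; last 2 first.
- by move=> i; rewrite addn_gt0 expn_gt0.
- by move=> i; rewrite addn_gt0 expn_gt0.
congr (convolution _ _ _); apply/funext => y; rewrite E.
by apply: eq_bigr => i _; rewrite !mul1r.
Qed.

End Linear.

Section Dual.
Context {R : realType}.
Variables (r : R) (r0 : 0 < r) (n : nat) (a : blockT n -> R).
Hypothesis a1 : forall t, `|a t| <= 1.
Local Open Scope complex_scope.
Let L := (16 ^ n.+1)%N.
Let zeta : R[i] := cis (- (r * pi / 2)) ^+ 2.

(** The blocks with coefficients [a], rotated by the phase of the Fourier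
    coefficients of the kernel; levels are natural numbers, and those above
    [n] get [0]. *)
Definition dual_block (s : nat) x : R[i] :=
  if insub s is Some s' then zeta * block (fun=> 1) (@block_coef R n a s') x else 0.

(** The Riesz product over the blocks of all levels. *)
Definition dual := riesz_prod dual_block 0 n.+1.

Lemma dual_blockE (s : 'I_n.+1) : dual_block s = (fun x => zeta * block (fun=> 1) (@block_coef R n a s) x).
Proof. by apply/funext => x; rewrite /dual_block valK. Qed.

Lemma dual_block_spec1 s x2 : (s <= n)%N ->
  spec (16 ^ s)%N (3 * 16 ^ s) (fun x1 => dual_block s (x1, x2)).
Proof.
move=> sn; have -> : s = Ordinal (sn : (s < n.+1)%N) by [].
by rewrite dual_blockE; apply: specZ; exact: block_spec1.
Qed.

Lemma dual_block_spec2 s x1 : (s <= n)%N ->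
  spec (16 ^ (n - s))%N (3 * 16 ^ (n - s)) (fun x2 => dual_block s (x1, x2)).
Proof.
move=> sn; have -> : s = Ordinal (sn : (s < n.+1)%N) by [].
by rewrite dual_blockE; apply: specZ; exact: block_spec2.
Qed.

Lemma cmod_dual_block s x : cmod (dual_block s x) <= 1.
Proof.
rewrite /dual_block; case: insubP => [s' _ _|_]; last by rewrite cmod0.
rewrite cmodM /zeta -cisMn cmod_cis mul1r.
by apply: cmod_block1_le1; rewrite ?expn_gt0// => j1 j2; exact: a1.
Qed.

Lemma dual_ge0 x : 0 <= dual x.
Proof.
apply: prodr_ge0 => s _; rewrite /riesz_re addcJ mulrA mulVf ?mul1r//.
rewrite -[1]/(1%:C) -rmorphD /= ler0c.
have := ler_Re_cmod (dual_block s x); have := cmod_dual_block s x.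
by rewrite ler_norml => h /andP[h1 _]; lra.
Qed.

Lemma grid_sum_dual : grid_sum L dual = (L * L)%:R.
Proof. exact: (grid_sum_riesz dual_block_spec1). Qed.

(** The dual function is normalized, so integrating against it does not
    increase the uniform norm over the grid. *)
Lemma grid_sum_dual_le (u : R * R -> R[i]) (c : R) :
    (forall i1 i2 : 'I_L, cmod (u (node L i1, node L i2)) <= c) ->
  cmod (grid_sum L (fun x => u x * dual x)) <= c * (L * L)%:R.
Proof.
move=> hu; rewrite -lecR rmorphM rmorph_nat /= -grid_sum_dual -cmodE.
rewrite /grid_sum mulr_sumr; apply: le_trans (ler_norm_sum _ _ _) _.
apply: ler_sum => i1 _; rewrite mulr_sumr; apply: le_trans (ler_norm_sum _ _ _) _.
apply: ler_sum => i2 _; rewrite normrM (ger0_norm (dual_ge0 _)).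
by apply: ler_wpM2r; [exact: dual_ge0|rewrite cmodE lecR].
Qed.

(** Correlation of the dual function with the convolved polynomial that has
    the same coefficients: the phases cancel, and the frequencies [k1], [k2] of
    all blocks satisfy [k1 * k2 <= 16 * 16 ^ n]. *)
Lemma grid_sum_dual_trig : exists2 V : R,
  (16 * (16 ^ n)%:R) `^ (- r) * ((\sum_t a t ^+ 2) / (32 * (16 ^ n)%:R)) <= V &
  grid_sum L (fun x => trig (F1_coef r) a x * dual x) = (L * L)%:R * V%:C.
Proof.
pose Q : R := (16 ^ n)%:R.
have Q0 : 0 < Q by rewrite ltr0n expn_gt0.
pose e (s : 'I_n.+1) k1 k2 : R :=
  ((trapezoid (16 ^ s) k1 * trapezoid (16 ^ (n - s)) k2) * cmod (hat (@block_coef R n a s) k1 k2)) ^+ 2.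
exists (2^-1 * \sum_(s < n.+1) \sum_(k1 < (3 * 16 ^ s)%N) \sum_(k2 < (3 * 16 ^ (n - s))%N)
   e s k1 k2 * ((16 ^ s + k1)%:R `^ (- r) * (16 ^ (n - s) + k2)%:R `^ (- r))).
  rewrite sum_blockT mulr_suml !mulr_sumr; apply: ler_sum => s _.
  have sn : (s <= n)%N by have := ltn_ord s.
  have En : (16 ^ s * 16 ^ (n - s))%N = (16 ^ n)%N by rewrite -expnD subnKC.
  have := @block_energy_ge R (16 ^ s) (16 ^ (n - s)) (@block_coef R n a s).
  rewrite !expn_gt0 /= En => /(_ isT isT) h.
  apply: (@le_trans _ _ (2^-1 * ((16 * Q) `^ (- r) * \sum_(k1 < (3 * 16 ^ s)%N) \sum_(k2 < (3 * 16 ^ (n - s))%N) e s k1 k2))).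
    have P0 : 0 <= (16 * Q) `^ (- r) by exact: powR_ge0.
    have := ler_wpM2l P0 h; rewrite -/Q /block_coef.
    have -> (S : R) : S / (32 * Q) = 2^-1 * (S / (16 * Q)) by field; rewrite gt_eqF.
    by lra.
  rewrite ler_pM2l//; rewrite mulr_sumr; apply: ler_sum => k1 _.
  rewrite mulr_sumr; apply: ler_sum => k2 _.
  rewrite mulrC; apply: ler_wpM2l; first exact: sqr_ge0.
  rewrite -powRM ?ler0n//.
  rewrite !powRN lef_pV2 ?posrE ?powR_gt0 ?mulr_gt0 ?ltr0n ?addn_gt0 ?expn_gt0//.
  apply: ge0_ler_powR; rewrite ?nnegrE ?mulr_ge0 ?ler0n ?(ltW r0) ?(ltW Q0)//.
  rewrite /Q -En -!natrM ler_nat.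
  have l1 : (16 ^ s + k1 <= 4 * 16 ^ s)%N by have := ltn_ord k1; lia.
  have l2 : (16 ^ (n - s) + k2 <= 4 * 16 ^ (n - s))%N by have := ltn_ord k2; lia.
  by apply: leq_trans (leq_mul l1 l2) _; rewrite mulnACA.
transitivity (\sum_(s < n.+1) grid_sum L (fun x => block (F1_coef r) (@block_coef R n a s) x * dual x)).
  rewrite -grid_sum_sum; apply: eq_grid_sum => x; rewrite /trig mulr_suml.
  by apply: eq_bigr.
pose W s k1 k2 : R := e s k1 k2 * ((16 ^ s + k1)%:R `^ (- r) * (16 ^ (n - s) + k2)%:R `^ (- r)).
transitivity (\sum_(s < n.+1) 2^-1 * ((L * L)%:R *
    \sum_(k1 < (3 * 16 ^ s)%N) \sum_(k2 < (3 * 16 ^ (n - s))%N) (W s k1 k2)%:C)); last first.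
  have half : (2^-1 : R)%:C = 2^-1.
    by rewrite (fmorphV (real_complex R)) (rmorph_nat (real_complex R)).
  have CM (x y : R) : (x * y)%:C = x%:C * y%:C by rewrite rmorphM.
  rewrite -mulr_sumr -mulr_sumr mulrCA CM half; congr (_ * (_ * _)).
  rewrite rmorph_sum; apply: eq_bigr => s _; rewrite rmorph_sum; apply: eq_bigr => k1 _.
  by rewrite rmorph_sum.
apply: eq_bigr => s _.
have sn : (s <= n)%N by have := ltn_ord s.
rewrite (@grid_sum_block_riesz R n dual_block dual_block_spec1 dual_block_spec2 s sn); last 2 first.
- by move=> x2; exact: block_spec1.
- by move=> x1; exact: block_spec2.
have AL k : (k <= n)%N -> (4 * 16 ^ k <= L)%N.
  move=> kn; have : (16 ^ k <= 16 ^ n)%N by rewrite leq_exp2l.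
  by rewrite /L expnS; lia.
rewrite dual_blockE; congr (_ * _).
transitivity (conjc zeta * grid_sum L (fun x => block (F1_coef r) (@block_coef R n a s) x *
    conjc (block (fun=> 1) (@block_coef R n a s) x))).
  by rewrite -grid_sumZ; apply: eq_grid_sum => x; rewrite conjcM; ring.
rewrite /grid_sum block_grid_inner ?AL ?leq_subr ?expn_gt0//.
rewrite mulrCA; congr (_ * _); rewrite mulr_sumr; apply: eq_bigr => k1 _.
rewrite mulr_sumr; apply: eq_bigr => k2 _.
have zz : conjc zeta * zeta = 1 by rewrite mulrC mulc_conj /zeta -cisMn cmod_cis expr1n.
have WE : (W s k1 k2)%:C = (e s k1 k2)%:C *
    (((16 ^ s + k1)%:R `^ (- r))%:C * ((16 ^ (n - s) + k2)%:R `^ (- r))%:C).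
  by rewrite /W !rmorphM.
rewrite WE /F1_coef -/(e s k1 k2) -[RHS]mul1r -zz; move: (conjc zeta) => cz.
rewrite /zeta; ring.
Qed.

End Dual.

(** * Sign vectors sharing a code word *)

Section Counting.
Variable T : finType.
Implicit Types e : {ffun T -> bool}.

(** Hamming distance. *)
Definition hamming e e' : nat := #|[pred t | e t != e' t]|.

Lemma sum_exp_hamming (e0 : {ffun T -> bool}) :
  (\sum_(e : {ffun T -> bool}) 4 ^ (#|T| - hamming e e0) = 5 ^ #|T|)%N.
Proof.
transitivity (\prod_(t : T) \sum_(b : bool) (if b == e0 t then 4 else 1))%N; last first.
  rewrite (eq_bigr (fun=> 5%N)); first by rewrite prod_nat_const.
  by move=> t _; rewrite big_bool /=; case: (e0 t).
rewrite bigA_distr_bigA /=; apply: eq_bigr => e _.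
rewrite -big_mkcond /= prod_nat_const; congr (4 ^ _)%N.
have := cardC [pred t | e t != e0 t]; rewrite -/(hamming e e0) => <-.
by rewrite addKn; apply: eq_card => t; rewrite !inE negbK.
Qed.

(** Chernoff bound for the size of a Hamming ball, with parameter [1 / 4]. *)
Lemma card_hamming_ball (M : nat) (e0 : {ffun T -> bool}) : (#|T| = 16 * M)%N ->
  (#|[pred e | (hamming e e0 <= M)%N]| <= 2 ^ (8 * M))%N.
Proof.
move=> cT; have E := sum_exp_hamming e0.
have h : (#|[pred e | (hamming e e0 <= M)%N]| * 4 ^ (15 * M) <= 5 ^ #|T|)%N.
  rewrite -E -sum_nat_const (bigID (mem [pred e | (hamming e e0 <= M)%N]) predT) /=.
  apply: leq_trans (leq_addr _ _); apply: leq_sum => e; rewrite inE => he.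
  by rewrite leq_exp2l// cT; lia.
(* 5 ^ 16 <= 2 ^ 38 because 5 ^ 3 <= 2 ^ 7 *)
have h2 : (5 ^ (16 * M) <= 2 ^ (8 * M) * 4 ^ (15 * M))%N.
  rewrite (_ : 16 * M = 3 * (5 * M) + M)%N; last by lia.
  rewrite expnD expnM.
  have -> : (2 ^ (8 * M) * 4 ^ (15 * M) = (2 ^ 7) ^ (5 * M) * (2 ^ 3) ^ M)%N.
    by rewrite -[4%N]/(2 ^ 2)%N -!expnM -!expnD; congr expn; lia.
  by apply: leq_mul; case: (M) => // k; rewrite leq_exp2r// mulnS.
rewrite cT in h; have := leq_trans h h2.
by rewrite leq_pmul2r// expn_gt0.
Qed.

(** If at least half of the sign vectors are encoded with few code words, two
    of them at large Hamming distance share a code word. *)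
Lemma far_pair (M : nat) (C : finType) (G : pred {ffun T -> bool})
    (code : {ffun T -> bool} -> C) :
    (#|T| = 16 * M)%N -> (0 < M)%N -> (#|C| <= 2 ^ (6 * M))%N ->
    (2 ^ #|T| <= 2 * #|G|)%N ->
  exists e e', [/\ G e, G e', code e = code e' & (M <= hamming e e')%N].
Proof.
move=> cT M0 cC cG; apply: contrapT => H.
have fiber c : (#|[pred e | G e && (code e == c)]| <= 2 ^ (8 * M))%N.
  case: (pickP [pred e | G e && (code e == c)]) => [e0 /andP[Ge0 /eqP ce0]|h0]; last first.
    by rewrite (eq_card0 h0).
  apply: leq_trans (card_hamming_ball e0 cT).
  apply: subset_leq_card; apply/fintype.subsetP => e; rewrite !inE => /andP[Ge /eqP ce].
  rewrite leqNgt; apply/negP => lt; apply: H; exists e, e0; split => //.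
    by rewrite ce ce0.
  exact: ltnW.
have : (#|G| <= 2 ^ (6 * M) * 2 ^ (8 * M))%N.
  rewrite -sum1_card (partition_big code xpredT)//=.
  apply: (@leq_trans (\sum_(c : C) 2 ^ (8 * M))%N).
    by apply: leq_sum => c _; rewrite sum1_card; exact: fiber.
  by rewrite sum_nat_const leq_mul2r cC orbT.
rewrite -expnD => h.
have : (2 ^ (16 * M) <= 2 ^ (14 * M).+1)%N.
  rewrite -cT; apply: leq_trans cG _; rewrite expnS leq_mul2l /=.
  by apply: leq_trans h _; rewrite leq_exp2l//; lia.
by rewrite leq_exp2l//; lia.
Qed.

End Counting.

(** * Sparse trigonometric polynomials on the grid *)

Section GridCharacters.
Context {R : realType}.
Variables (L : nat) (L0 : (0 < L)%N).
Local Open Scope complex_scope.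
Implicit Types (x : R * R).

(** The characters of the group Z/L x Z/L, extended to the torus. *)
Definition chr (k : 'I_L * 'I_L) x : R[i] := cis (k.1%:R * x.1) * cis (k.2%:R * x.2).

Lemma modz_lt (z : int) : (`|(z %% L)%Z|%N < L)%N.
Proof. by have := ltz_pmod z (_ : 0 < L%:Z); have := modz_ge0 z (_ : L%:Z != 0); lia. Qed.

(** Reduction of a frequency modulo [L]. *)
Definition freq_mod (k : int * int) : 'I_L * 'I_L :=
  (Ordinal (modz_lt k.1), Ordinal (modz_lt k.2)).

Lemma cis_int_node (z : int) (i : nat) :
  cis (z%:~R * node L i) = cis (`|(z %% L)%Z|%N%:R * node L i) :> R[i].
Proof.
have r0 : 0 <= (z %% L)%Z by apply: modz_ge0; lia.
have E : z = (z %/ L)%Z * L%:Z + `|(z %% L)%Z|%N%:Z.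
  by rewrite gez0_abs//; exact: divz_eq.
rewrite {1}E intrD mulrDl cisD intrM -!pmulrn.
have -> : (z %/ L)%Z%:~R * L%:R * node L i = (z %/ L)%Z%:~R * (i%:R * (2 * pi)) :> R.
  rewrite -mulrA; congr (_ * _); rewrite mulrC divfK; first exact: mulrC.
  by rewrite pnatr_eq0 -lt0n.
by rewrite cisMz cisMn cis2pi expr1n exp1rz mul1r.
Qed.

(** On the grid frequencies matter only modulo [L]. *)
Lemma character_node (k : int * int) (i1 i2 : nat) :
  character k (node L i1, node L i2) = chr (freq_mod k) (node L i1, node L i2).
Proof.
by rewrite /character -/(cis _) cisD /= !cis_int_node.
Qed.

Lemma grid_sum_chr (k l : 'I_L * 'I_L) :
  grid_sum L (fun x => chr k x * conjc (chr l x)) = (if k == l then (L * L)%:R else 0).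
Proof.
transitivity ((\sum_(i < L) cis (k.1%:R * node L i) * conjc (cis (l.1%:R * node L i))) *
  (\sum_(i < L) cis (k.2%:R * node L i) * conjc (cis (l.2%:R * node L i)) : R[i])).
  rewrite /grid_sum mulr_suml; apply: eq_bigr => i1 _.
  rewrite mulr_sumr; apply: eq_bigr => i2 _.
  rewrite /chr conjcM /=; ring.
rewrite !sum_cis_node_diff// !modn_small//.
case: k l => [k1 k2] [l1 l2] /=.
rewrite -[(_, _) == _]/((k1 == l1) && (k2 == l2)) natrM.
rewrite -!(inj_eq val_inj) /=.
by case: (_ == _); case: (_ == _); rewrite ?mulr0 ?mul0r.
Qed.

(** A combination of [m] characters with small Fourier coefficients on the
    grid correlates little with a function whose Fourier coefficients are at
    most one. *)
Lemma sparse_grid_sum_le (m : nat) (kap : 'I_m -> 'I_L * 'I_L) (b : 'I_m -> R[i])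
    (psi : R * R -> R[i]) (de : R) :
    let u := fun x => \sum_(j < m) b j * chr (kap j) x in
    (forall j, cmod (grid_sum L (fun x => u x * conjc (chr (kap j) x))) <= de * (L * L)%:R) ->
    (forall k, cmod (grid_sum L (fun x => chr k x * psi x)) <= (L * L)%:R) ->
  cmod (grid_sum L (fun x => u x * psi x)) <= m%:R * de * (L * L)%:R.
Proof.
move=> u hu hpsi.
have LL0 : 0 < (L * L)%:R :> R by rewrite ltr0n muln_gt0 L0.
(* frequencies may be repeated: [be k] collects the coefficients of [chr k] *)
pose be k := \sum_(j < m | kap j == k) b j.
have uE x : u x = \sum_k be k * chr k x.
  rewrite /u (partition_big kap xpredT)//=; apply: eq_bigr => k _.
  rewrite mulr_suml; apply: eq_bigr => j /eqP <- //.
have coefE k : grid_sum L (fun x => u x * conjc (chr k x)) = (L * L)%:R * be k.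
  transitivity (\sum_l be l * grid_sum L (fun x => chr l x * conjc (chr k x))).
    rewrite (eq_bigr (fun l => grid_sum L (fun x => be l * (chr l x * conjc (chr k x))))); last first.
      by move=> l _; rewrite grid_sumZ.
    rewrite -grid_sum_sum; apply: eq_grid_sum => x; rewrite uE mulr_suml.
    by apply: eq_bigr => l _; rewrite mulrA.
  rewrite (bigD1 k)//= grid_sum_chr eqxx [X in _ + X]big1 ?addr0 1?mulrC// => l lk.
  by rewrite grid_sum_chr (negPf lk) mulr0.
have beb j : cmod (be (kap j)) <= de.
  have := hu j; rewrite coefE cmodM mulrC.
  have -> : cmod (L * L)%:R = (L * L)%:R :> R.
    by rewrite -(rmorph_nat (real_complex R)) cmod_real ger0_norm.
  by rewrite ler_pM2r.
have sumbe : \sum_k cmod (be k) <= m%:R * de.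
  apply: (@le_trans _ _ (\sum_k \sum_(j < m | kap j == k) cmod (be (kap j)))).
    apply: ler_sum => k _.
    case: (pickP (fun j => kap j == k)) => [j jk|h].
      rewrite (bigD1 j)//= (eqP jk) lerDl; apply: sumr_ge0 => *; exact: cmod_ge0.
    by rewrite /be !big_pred0 ?cmod0.
  have <- : \sum_(j < m) cmod (be (kap j)) = \sum_k \sum_(j < m | kap j == k) cmod (be (kap j)).
    by rewrite (partition_big kap xpredT).
  by rewrite -[X in X%:R * _]card_ord mulr_natl -sumr_const; exact: ler_sum.
have -> : grid_sum L (fun x => u x * psi x) = \sum_k be k * grid_sum L (fun x => chr k x * psi x).
  rewrite (eq_bigr (fun l => grid_sum L (fun x => be l * (chr l x * psi x)))); last first.
    by move=> l _; rewrite grid_sumZ.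
  rewrite -grid_sum_sum; apply: eq_grid_sum => x; rewrite uE mulr_suml.
  by apply: eq_bigr => l _; rewrite mulrA.
apply: le_trans (ler_wpM2r (ltW LL0) sumbe); rewrite mulr_suml.
apply: le_trans (cmod_sum _ _ _) _; apply: ler_sum => k _.
by rewrite cmodM ler_wpM2l ?cmod_ge0.
Qed.

Lemma cmod_grid_sum_le (u : R * R -> R[i]) (c : R) :
    (forall i1 i2 : 'I_L, cmod (u (node L i1, node L i2)) <= c) ->
  cmod (grid_sum L u) <= c * (L * L)%:R.
Proof.
move=> hu; apply: le_trans (cmod_sum _ _ _) _.
apply: (@le_trans _ _ (\sum_(i1 < L) \sum_(i2 < L) c)).
  by apply: ler_sum => i1 _; apply: le_trans (cmod_sum _ _ _) _; exact: ler_sum.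
by rewrite !(sumr_const, card_ord) -mulrnA mulr_natr.
Qed.

Lemma node_torus (i1 i2 : 'I_L) : torus (node L i1 : R, node L i2 : R).
Proof.
have h (i : 'I_L) : (node L i : R) \in `[0, 2 * pi[%R.
  have p0 : 0 < 2 * pi :> R by rewrite mulr_gt0// pi_gt0.
  have L0' : 0 < L%:R :> R by rewrite ltr0n.
  rewrite in_itv /= /node; apply/andP; split.
    by rewrite divr_ge0// mulr_ge0// ltW.
  by rewrite ltr_pdivrMr// ltr_pM2l// ltr_nat.
by split; exact: h.
Qed.

End GridCharacters.

Section Quantize.
Context {R : realType}.
Variables (K : nat) (K0 : (0 < K)%N) (F h : R).

(** Index of the cell of length [h] that contains a point of [- F, F].  The
    reduction modulo [K] is the identity on that interval as soon as
    [2 F / h < K]. *)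
Definition quant (y : R) : 'I_K := Ordinal (ltn_pmod (Num.truncn ((y + F) / h)) K0).

Lemma quant_close (y z : R) : 0 < h -> 2 * F / h < K%:R ->
  `|y| <= F -> `|z| <= F -> quant y = quant z -> `|y - z| <= h.
Proof.
move=> h0 hK yF zF /(congr1 val) /=.
have T w : `|w| <= F -> 0 <= (w + F) / h /\ (Num.truncn ((w + F) / h) %% K = Num.truncn ((w + F) / h))%N.
  rewrite ler_norml => /andP[w1 w2].
  have p : 0 <= (w + F) / h by apply: divr_ge0; [lra|exact: ltW].
  split=> //; apply: modn_small; rewrite -(ltr_nat R).
  apply: le_lt_trans hK; apply: (@le_trans _ _ ((w + F) / h)).
    by rewrite truncn_le.
  by apply: ler_wpM2r; [rewrite invr_ge0 ltW|lra].
have [y0 ->] := T y yF; have [z0 ->] := T z zF => E.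
have := truncn_itv y0; have := truncn_itv z0; rewrite E -natr1.
move: (Num.truncn _)%:R => t /andP[a1 a2] /andP[b1 b2].
have : `|(y + F) / h - (z + F) / h| <= 1 by rewrite ler_norml; lra.
have -> : (y + F) / h - (z + F) / h = (y - z) / h by field; rewrite gt_eqF.
by rewrite normrM normfV (gtr0_norm h0) ler_pdivrMr// mul1r.
Qed.

End Quantize.

(** * Lower bound for random polynomials *)

Section Core.
Context {R : realType}.
Local Open Scope complex_scope.

(** Half the difference of two sign vectors, valued in {-1, 0, 1}. *)
Definition half_diff (T : finType) (e e' : {ffun T -> bool}) (t : T) : R :=
  2^-1 * (sgn (e t) - sgn (e' t)).

Lemma half_diff_le1 (T : finType) (e e' : {ffun T -> bool}) t : `|half_diff e e' t| <= 1.
Proof. by rewrite /half_diff /sgn ler_norml; case: (e t); case: (e' t); lra. Qed.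

Lemma sum_half_diff_sq (T : finType) (e e' : {ffun T -> bool}) :
  \sum_t half_diff e e' t ^+ 2 = (hamming e e')%:R.
Proof.
rewrite /hamming -sum1_card natr_sum [RHS]big_mkcond; apply: eq_bigr => t _.
by rewrite inE /half_diff /sgn; case: (e t); case: (e' t) => /=; field.
Qed.

(** The distance that is out of reach of sparse approximation. *)
Definition threshold (r : R) (n : nat) : R :=
  (16 * (16 ^ n)%:R) `^ (- r) * n.+1%:R / (4 * (16 * 32)).

Lemma threshold_gt0 r n : 0 < threshold r n.
Proof.
have Q0 : 0 < (16 ^ n)%:R :> R by rewrite ltr0n expn_gt0.
by rewrite /threshold !(divr_gt0, mulr_gt0, powR_gt0, ltr0Sn).
Qed.

(** Two far sign choices give convolved polynomials that are far apart, as
    seen by the Riesz product attached to their difference. *)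
Lemma far_grid_sum (r : R) (n M : nat) (e e' : {ffun blockT n -> bool}) : 0 < r ->
    (16 * M = n.+1 * 16 ^ n)%N -> (M <= hamming e e')%N ->
  8 * threshold r n * (16 ^ n.+1 * 16 ^ n.+1)%:R <=
  cmod (grid_sum (16 ^ n.+1) (fun x =>
    (trig (F1_coef r) (fun t => sgn (e t)) x - trig (F1_coef r) (fun t => sgn (e' t)) x) *
    dual r (half_diff e e') x)).
Proof.
move=> r0 EM hM; set L := (16 ^ n.+1)%N.
have [V hV EV] := grid_sum_dual_trig r0 (half_diff e e').
have -> : grid_sum L (fun x =>
    (trig (F1_coef r) (fun t => sgn (e t)) x - trig (F1_coef r) (fun t => sgn (e' t)) x) *
    dual r (half_diff e e') x) = 2%:C * ((L * L)%:R * V%:C).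
  rewrite -EV -grid_sumZ; apply: eq_grid_sum => x; rewrite mulrA; congr (_ * _).
  rewrite -trigZ -trigB; apply: eq_bigr => s _.
  congr (block _ _ _); apply/funext => j1; apply/funext => j2.
  by rewrite /block_coef /half_diff mulrA mulfV// mul1r.
have -> : cmod (2%:C * ((L * L)%:R * V%:C)) = 2 * `|V| * (L * L)%:R.
  rewrite !cmodM !cmod_real -(rmorph_nat (real_complex R)) cmod_real.
  rewrite (ger0_norm (ler0n R 2)) (ger0_norm (ler0n R (L * L))).
  by move: (L * L)%:R => x; ring.
apply: ler_wpM2r; first exact: ler0n.
apply: (@le_trans _ _ (2 * V)); last by rewrite ler_pM2l// ler_norm.
rewrite sum_half_diff_sq in hV.
set Q : R := (16 ^ n)%:R in hV *; have Q0 : 0 < Q by rewrite ltr0n expn_gt0.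
set P := (16 * Q) `^ (- r) in hV *; have P0 : 0 <= P by exact: powR_ge0.
have MR : 16 * M%:R = n.+1%:R * Q :> R by rewrite /Q -!natrM EM.
have h1 : M%:R / (32 * Q) = n.+1%:R / (16 * 32).
  have -> : M%:R = n.+1%:R * Q / 16 by rewrite -MR mulrC mulKf.
  by field; rewrite gt_eqF.
have h2 : M%:R / (32 * Q) <= (hamming e e')%:R / (32 * Q).
  by rewrite ler_pM2r ?invr_gt0 ?mulr_gt0// ler_nat.
rewrite h1 in h2; have h3 := ler_wpM2l P0 h2.
rewrite /threshold -/Q -/P; lra.
Qed.

(** Among any half of the sign choices, one gives a convolved polynomial at
    uniform distance at least [threshold r n] from all sums of [m] characters.
    Otherwise each sign choice would come with an approximant, and reducing its
    frequencies modulo the grid and rounding its Fourier coefficients on the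
    grid would encode the sign choices with too few code words. *)
Lemma sparse_lower_bound (r : R) (rr n m : nat) (G : pred {ffun blockT n -> bool}) :
    0 < r -> r <= rr%:R -> (0 < n)%N -> (0 < m)%N ->
    ((26 + 4 * rr) * m <= 3 * 16 ^ n.-1)%N -> (2 ^ #|{: blockT n}| <= 2 * #|G|)%N ->
  exists2 e, G e & forall (k : 'I_m -> int * int) (c : 'I_m -> R[i]),
    exists2 x : R * R, torus x & threshold r n <=
      cmod (trig (F1_coef r) (fun t => sgn (e t)) x - \sum_(j < m) c j * character (k j) x).
Proof.
move=> r0 hr n0 m0 hm hG; apply: contrapT => H.
set th := threshold r n; have th0 : 0 < th by exact: threshold_gt0.
pose f (e : {ffun blockT n -> bool}) x : R[i] := trig (F1_coef r) (fun t => sgn (e t)) x.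
have ex (e : {ffun blockT n -> bool}) : exists kc : ('I_m -> int * int) * ('I_m -> R[i]),
    G e -> forall x, torus x ->
      cmod (f e x - \sum_(j < m) kc.2 j * character (kc.1 j) x) < th.
  have [Ge|nGe] := boolP (G e); last by exists (fun=> (0, 0), fun=> 0).
  apply: contrapT => H2; apply: H; exists e => // k c.
  apply: contrapT => H3; apply: H2; exists (k, c) => _ x tx /=.
  by rewrite ltNge; apply/negP => H4; apply: H3; exists x.
have [kc hkc] := choice ex.
pose L := (16 ^ n.+1)%N.
have L0 : (0 < L)%N by rewrite expn_gt0.
have LL0 : 0 < (L * L)%:R :> R by rewrite ltr0n muln_gt0 L0.
pose kap e j := freq_mod L0 ((kc e).1 j).
(* the approximants, with reduced frequencies; the values on the grid are the
   same *)
pose tt e x := \sum_(j < m) (kc e).2 j * chr (kap e j) x.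
have ttE e (i1 i2 : 'I_L) : G e ->
    cmod (f e (node L i1, node L i2) - tt e (node L i1, node L i2)) <= th.
  move=> Ge; apply/ltW; have := hkc e Ge _ (node_torus L0 i1 i2).
  by rewrite /tt; under eq_bigr do rewrite (character_node L0).
pose N : R := (n.+1 * 16 ^ n)%:R.
have Q1 : 1 <= (16 ^ n)%:R :> R by rewrite ler1n expn_gt0.
have n1 : 1 <= n.+1%:R :> R by rewrite ler1n.
have NE : N = n.+1%:R * (16 ^ n)%:R by rewrite /N natrM.
have thN : th <= N.
  have P1 : (16 * (16 ^ n)%:R) `^ (- r) <= 1 :> R.
    rewrite -[leRHS](powRr0 (16 * (16 ^ n)%:R)) ler_powR ?oppr_le0 ?(ltW r0)//.
    by lra.
  rewrite NE /th /threshold.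
  have := ler_wpM2r (ler0n R n.+1) P1; have := ler_wpM2l (ler0n R n.+1) Q1; lra.
pose F := 2 * N.
have ttF e (i1 i2 : 'I_L) : G e -> cmod (tt e (node L i1, node L i2)) <= F.
  move=> Ge; have h1 := ttE e i1 i2 Ge.
  have h2 : cmod (f e (node L i1, node L i2)) <= N.
    by apply: cmod_trig_le => // t; rewrite /sgn; case: (e t); rewrite ?normrN1 ?normr1.
  rewrite (_ : tt e _ = f e (node L i1, node L i2) + - (f e (node L i1, node L i2) - tt e (node L i1, node L i2))); last by ring.
  by apply: le_trans (cmodD _ _) _; rewrite cmodN /F; lra.
(* Fourier coefficients on the grid, which unlike the coefficients [(kc e).2]
   are bounded even when reduced frequencies are repeated *)
pose co e j : R[i] := (L * L)%:R^-1 * grid_sum L (fun x => tt e x * conjc (chr (kap e j) x)).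
have cmodLL : cmod (L * L)%:R^-1 = (L * L)%:R^-1 :> R.
  by rewrite -(rmorph_nat (real_complex R)) -fmorphV cmod_real ger0_norm ?invr_ge0.
have coF e j : G e -> cmod (co e j) <= F.
  move=> Ge; rewrite cmodM cmodLL mulrC ler_pdivrMr//.
  apply: cmod_grid_sum_le => // i1 i2.
  by rewrite cmodM cmod_conj cmodM !cmod_cis !mulr1; exact: ttF.
pose h := th / m%:R.
have m0R : 0 < m%:R :> R by rewrite ltr0n.
have h0 : 0 < h by rewrite divr_gt0.
pose K := (2 ^ ((22 + 4 * rr) * n.+1))%N.
have K0 : (0 < K)%N by rewrite expn_gt0.
have hK : 2 * F / h < K%:R.
  pose B : R := 2 ^+ (4 * n.+1).
  have B1 : 1 <= B by rewrite exprn_ege1// ler1n.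
  have BQ : 16 * (16 ^ n)%:R = B.
    by rewrite /B exprM -[2 ^+ 4]natrX -[X in X * _]/((2 ^ 4)%:R) -natrM -expnS natrX.
  have QB : (16 ^ n)%:R <= B by rewrite -BQ; lra.
  have mB : m%:R <= B.
    apply: le_trans QB; rewrite ler_nat.
    have : (16 ^ n = 16 * 16 ^ n.-1)%N by rewrite -expnS prednK.
    by move: hm; lia.
  have Br : B `^ r <= 2 ^+ (4 * n.+1 * rr).
    by rewrite [leRHS]exprM -powR_mulrn ?(le_trans ler01)// ler_powR.
  have -> : 2 * F / h = (2 * 2 * (4 * (16 * 32))) * ((16 ^ n)%:R * m%:R * B `^ r).
    have nn : n.+1%:R != 0 :> R by rewrite pnatr_eq0.
    have BB : B `^ r != 0 by rewrite gt_eqF// powR_gt0// (lt_le_trans ltr01).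
    have mm := lt0r_neq0 m0R.
    rewrite /F NE /h /th /threshold BQ powRN; clear -nn BB mm.
    move: (n.+1%:R : R) (B `^ r) (m%:R : R) ((16 ^ n)%:R : R) nn BB mm => a b c q nn BB mm.
    by field; rewrite nn BB mm.
  apply: (@le_lt_trans _ _ (2 ^+ (13 * n.+1) * (B * B * 2 ^+ (4 * n.+1 * rr)))).
    apply: ler_pM => //.
    - by rewrite mulr_ge0 ?powR_ge0// mulr_ge0.
    - have -> : 2 * 2 * (4 * (16 * 32)) = 2 ^+ 13 :> R by ring.
      have c1 : 1 <= 2 ^+ 13 :> R by apply: exprn_ege1; rewrite ler1n.
      by rewrite exprM; move: (2 ^+ 13) c1 => c c1; rewrite ler_eXnr.
    apply: ler_pM; rewrite ?powR_ge0 ?mulr_ge0//; exact: ler_pM.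
  have e2 : (13 * n.+1 + (4 * n.+1 + 4 * n.+1 + 4 * n.+1 * rr) < (22 + 4 * rr) * n.+1)%N.
    by clear; rewrite mulnDl -!mulnA [(n.+1 * rr)%N]mulnC; lia.
  have gen (u v : nat) : (u < v)%N -> 2 ^+ u < 2 ^+ v :> R.
    by move=> uv; rewrite ltr_eXn2l ?ltr1n.
  by rewrite /B -!exprD /K natrX; apply: gen.
pose code e : {ffun 'I_m -> ('I_L * 'I_L) * ('I_K * 'I_K)} :=
  [ffun j => (kap e j, (quant K0 F h (complex.Re (co e j)), quant K0 F h (complex.Im (co e j))))].
pose M := (n.+1 * 16 ^ n.-1)%N.
have EM : (16 * M = n.+1 * 16 ^ n)%N.
  by rewrite /M mulnCA -expnS prednK.
have cC : (#|{: {ffun 'I_m -> ('I_L * 'I_L) * ('I_K * 'I_K)}}| <= 2 ^ (6 * M))%N.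
  rewrite card_ffun !card_prod !card_ord.
  have -> : L = (2 ^ (4 * n.+1))%N by rewrite /L -[16%N]/(2 ^ 4)%N -expnM.
  rewrite /K -!expnD -expnM leq_exp2l// /M.
  have -> : (((4 * n.+1 + 4 * n.+1) + ((22 + 4 * rr) * n.+1 + (22 + 4 * rr) * n.+1)) * m =
      2 * n.+1 * ((26 + 4 * rr) * m))%N by clear; ring.
  have -> : (6 * (n.+1 * 16 ^ n.-1) = 2 * n.+1 * (3 * 16 ^ n.-1))%N.
    by clear; move: (16 ^ _)%N => x; ring.
  by rewrite leq_mul2l hm orbT.
have cT : #|{: blockT n}| = (16 * M)%N by rewrite card_blockT EM.
have M0 : (0 < M)%N by rewrite /M muln_gt0 expn_gt0.
have [e [e' [Ge Ge' ec hd]]] := far_pair code cT M0 cC hG.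
have kapE j : kap e j = kap e' j.
  by have := congr1 (fun g : {ffun _ -> _} => (g j).1) ec; rewrite !ffunE.
have coE j : cmod (co e j - co e' j) <= 2 * h.
  have hR : quant K0 F h (complex.Re (co e j)) = quant K0 F h (complex.Re (co e' j)).
    by have := congr1 (fun g : {ffun _ -> _} => (g j).2.1) ec; rewrite !ffunE.
  have hI : quant K0 F h (complex.Im (co e j)) = quant K0 F h (complex.Im (co e' j)).
    by have := congr1 (fun g : {ffun _ -> _} => (g j).2.2) ec; rewrite !ffunE.
  have R1 := le_trans (ler_Re_cmod (co e j)) (coF e j Ge).
  have R2 := le_trans (ler_Re_cmod (co e' j)) (coF e' j Ge').
  have I1 := le_trans (ler_Im_cmod (co e j)) (coF e j Ge).
  have I2 := le_trans (ler_Im_cmod (co e' j)) (coF e' j Ge').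
  have qR := quant_close h0 hK R1 R2 hR; have qI := quant_close h0 hK I1 I2 hI.
  apply: le_trans (cmod_le_ReIm _) _.
  have -> : complex.Re (co e j - co e' j) = complex.Re (co e j) - complex.Re (co e' j).
    by case: (co e j) (co e' j) => [? ?] [? ?].
  have -> : complex.Im (co e j - co e' j) = complex.Im (co e j) - complex.Im (co e' j).
    by case: (co e j) (co e' j) => [? ?] [? ?].
  by lra.
pose D := dual r (half_diff e e').
have d1 := @half_diff_le1 (blockT n) e e'.
pose u x : R[i] := \sum_(j < m) ((kc e).2 j - (kc e').2 j) * chr (kap e j) x.
have uE x : u x = tt e x - tt e' x.
  rewrite /u /tt -sumrB; apply: eq_bigr => j _.
  by rewrite -kapE mulrBl.
have bu : cmod (grid_sum L (fun x => u x * D x)) <= m%:R * (2 * h) * (L * L)%:R.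
  apply: sparse_grid_sum_le => // [j|k]; last first.
    rewrite -[leRHS]mul1r; apply: (@grid_sum_dual_le _ r n _ d1 (chr k)) => i1 i2.
    by rewrite cmodM !cmod_cis mulr1.
  have -> : grid_sum L (fun x => u x * conjc (chr (kap e j) x)) = (L * L)%:R * (co e j - co e' j).
    have LLc : (L * L)%:R != 0 :> R[i] by rewrite pnatr_eq0 -lt0n muln_gt0 L0.
    rewrite mulrBr /co !mulrA !mulfV// !mul1r -kapE.
    rewrite -[X in _ = _ + X]mulN1r -grid_sumZ -grid_sumD.
    by apply: eq_grid_sum => x; rewrite uE; ring.
  rewrite cmodM mulrC -(rmorph_nat (real_complex R)) cmod_real (ger0_norm (ler0n _ _)).
  by rewrite ler_pM2r.
have b1 : cmod (grid_sum L (fun x => (f e x - tt e x) * D x)) <= th * (L * L)%:R.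
  by apply: (@grid_sum_dual_le _ r n _ d1 (fun x => f e x - tt e x)) => i1 i2; exact: ttE.
have b2 : cmod (grid_sum L (fun x => (f e' x - tt e' x) * D x)) <= th * (L * L)%:R.
  by apply: (@grid_sum_dual_le _ r n _ d1 (fun x => f e' x - tt e' x)) => i1 i2; exact: ttE.
have low := far_grid_sum r0 EM hd; rewrite -/th -/L -/D in low.
have up : cmod (grid_sum L (fun x => (f e x - f e' x) * D x)) <= 4 * th * (L * L)%:R.
  have -> : grid_sum L (fun x => (f e x - f e' x) * D x) =
      grid_sum L (fun x => (f e x - tt e x) * D x) +
      (- 1 * grid_sum L (fun x => (f e' x - tt e' x) * D x) + grid_sum L (fun x => u x * D x)).
    rewrite -grid_sumZ -!grid_sumD; apply: eq_grid_sum => x; rewrite uE; ring.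
  apply: le_trans (cmodD _ _) _.
  have := cmodD (- 1 * grid_sum L (fun x => (f e' x - tt e' x) * D x)) (grid_sum L (fun x => u x * D x)).
  rewrite mulN1r cmodN.
  have mh : m%:R * (2 * h) = 2 * th by rewrite mulrCA [m%:R * _]mulrC /h divfK// gt_eqF.
  rewrite mh in bu; lra.
have := le_trans low up; rewrite ler_pM2r//; lra.
Qed.

End Core.

(** * The lower bound for the class *)

Lemma ln_nat_le (R : realType) (m n : nat) : (0 < m)%N -> (m <= 16 ^ n)%N ->
  ln (m%:R : R) <= 16 * n%:R.
Proof.
move=> m0 mn; have m0R : 0 < m%:R :> R by rewrite ltr0n.
rewrite -ler_expR lnK ?posrE// mulrC expRM_natl.
apply: (@le_trans _ _ (16 ^+ n)); first by rewrite -natrX ler_nat.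
by apply: lerXn2r; rewrite ?nnegrE ?expR_ge0//; have := expR_ge1Dx (16 : R); lra.
Qed.

(** Conversion of [threshold], normalized by [sqrt (n + 1)], into the rate in
    [m], when [16 ^ n] and [m] are comparable. *)
Lemma threshold_ge (R : realType) (r : R) (m n k0 : nat) : 0 < r -> (0 < m)%N ->
    (16 ^ n.+1 <= m * 16 ^ k0)%N -> (m <= 16 ^ n)%N ->
  (16 ^ k0)%:R `^ (- r) / (4 * (4 * (16 * 32))) * (m%:R `^ (- r) * Num.sqrt (ln m%:R)) <=
  (Num.sqrt n.+1%:R)^-1 * threshold r n.
Proof.
move=> r0 m0 h1 h2.
have m0R : 0 < m%:R :> R by rewrite ltr0n.
have K0 : 0 < (16 ^ k0)%:R :> R by rewrite ltr0n expn_gt0.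
have s0 : 0 < Num.sqrt n.+1%:R :> R by rewrite sqrtr_gt0.
have E : (Num.sqrt n.+1%:R)^-1 * threshold r n =
    (4 * (16 * 32))^-1 * ((16 * (16 ^ n)%:R) `^ (- r) * Num.sqrt n.+1%:R).
  have nE : n.+1%:R = Num.sqrt n.+1%:R ^+ 2 :> R by rewrite sqr_sqrtr.
  rewrite /threshold [X in _ * (_ * X / _)]nE.
  have P : (4 * (16 * 32)) != 0 :> R by lra.
  move: (Num.sqrt n.+1%:R) (_ `^ _) (lt0r_neq0 s0) => s p s0'.
  by field; rewrite s0'.
have A : m%:R `^ (- r) * (16 ^ k0)%:R `^ (- r) <= (16 * (16 ^ n)%:R) `^ (- r) :> R.
  rewrite -powRM ?ler0n// !powRN lef_pV2 ?posrE ?powR_gt0 ?mulr_gt0 ?ltr0n ?expn_gt0//.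
  apply: ge0_ler_powR; rewrite ?nnegrE ?(ltW r0) ?mulr_ge0 ?ler0n//.
  by rewrite -!natrM ler_nat -expnS.
have B : 4^-1 * Num.sqrt (ln m%:R) <= Num.sqrt n.+1%:R :> R.
  have -> : 4^-1 = Num.sqrt (16^-1) :> R.
    by rewrite (_ : 16^-1 = 4^-1 ^+ 2) ?sqrtr_sqr ?ger0_norm//; field.
  rewrite -sqrtrM// ler_wsqrtr//.
  have := ln_nat_le R m0 h2; rewrite -(natr1 n); lra.
have P0 : 0 <= m%:R `^ (- r) * (16 ^ k0)%:R `^ (- r) :> R by rewrite mulr_ge0// powR_ge0.
have L0 : 0 <= 4^-1 * Num.sqrt (ln m%:R) :> R by rewrite mulr_ge0 ?sqrtr_ge0.
rewrite E; have := ler_pM P0 L0 A B.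
move: (m%:R `^ (- r)) ((16 ^ k0)%:R `^ (- r)) (Num.sqrt (ln m%:R)) => a b s h.
have -> : b / (4 * (4 * (16 * 32))) * (a * s) = (4 * (16 * 32))^-1 * (a * b * (4^-1 * s)) by field.
by apply: ler_wpM2l => //; rewrite invr_ge0; lra.
Qed.

Theorem theorem3p3 (R : realType) (q r : R) (hq : 1 <= q) (hr : 1 / q < r) :
  exists2 c : R, 0 < c &
    forall m : nat, (2 <= m)%N ->
      ((c * (m%:R `^ (- r) * ln m%:R `^ (2^-1)))%:E
         <= sigma_class m (classW r q))%E.
Proof.
have r0 : 0 < r.
  by apply: lt_trans hr; rewrite divr_gt0// (lt_le_trans ltr01 hq).
have [C C0 good] := @good_signs R q hq.
pose rr := (Num.truncn r).+1.
have hrr : r <= rr%:R by rewrite ltW// truncnS_gt.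
pose k0 := (26 + 4 * rr)%N.
exists (C * ((16 ^ (k0 + 3))%:R `^ (- r) / (4 * (4 * (16 * 32))))) => [|m m2].
  by rewrite !(mulr_gt0, divr_gt0, powR_gt0, ltr0n, expn_gt0).
have m0 : (0 < m)%N by exact: ltn_trans m2.
(* [16 ^ n] is [m] up to a constant factor, large enough for the counting *)
pose n := (trunc_log 16 m + k0 + 2)%N.
have [l1 l2] : (16 ^ trunc_log 16 m <= m)%N /\ (m < 16 ^ (trunc_log 16 m).+1)%N.
  by have /andP[] := @trunc_log_bounds 16 m isT m0.
have hm : ((26 + 4 * rr) * m <= 3 * 16 ^ n.-1)%N.
  have -> : n.-1 = (k0 + (trunc_log 16 m).+1)%N by rewrite /n; lia.
  have k1 : (26 + 4 * rr <= 16 ^ k0)%N by apply: ltnW; exact: ltn_expl.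
  by have := leq_mul k1 (ltnW l2); rewrite -expnD; lia.
have n0 : (0 < n)%N by rewrite /n addn2.
have h1 : (16 ^ n.+1 <= m * 16 ^ (k0 + 3))%N.
  have -> : n.+1 = (trunc_log 16 m + (k0 + 3))%N by rewrite /n; lia.
  by rewrite expnD leq_mul2r l1 orbT.
have h2 : (m <= 16 ^ n)%N.
  by apply: leq_trans (ltnW l2) _; rewrite leq_exp2l// /n; lia.
have [e Ge low] := sparse_lower_bound r0 hrr n0 m0 hm (good n).
pose rho := C / Num.sqrt n.+1%:R.
have s0 : 0 < Num.sqrt n.+1%:R :> R by rewrite sqrtr_gt0.
have rho0 : 0 < rho by rewrite divr_gt0.
pose a := fun t : blockT n => sgn (e t) : R.
pose phi := fun x : R * R => (rho%:C * trig (fun=> 1) a x)%C.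
have fW : classW r q (convolution phi (F2 r)).
  exists phi; split => //.
  - move=> x1 x2; have [p1 p2] := periodic2_trig (fun=> 1) a x1 x2.
    by rewrite /phi p1 p2.
  - by apply: cmeasurableM; [exact: cmeasurable_cst|exact: cmeasurable_trig].
apply: (@le_trans _ _ (rho * threshold r n)%:E).
  have h := threshold_ge r0 m0 h1 h2.
  have m1 : 0 <= ln m%:R :> R by rewrite ln_ge0// ler1n.
  rewrite powR12_sqrt// lee_fin /rho -!mulrA ler_pM2l//.
  by move: h; rewrite -!mulrA.
apply: (@le_trans _ _ (sigma m (convolution phi (F2 r)))); last first.
  by apply: ereal_sup_ubound; exists (convolution phi (F2 r)).
apply: le_ereal_inf_tmp => _ [k [c ->]].
have [x tx hx] := low k (fun j => (rho^-1)%:C%C * c j).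
apply: (@le_trans _ _ (cmod (convolution phi (F2 r) x - \sum_(j < m) c j * character (k j) x))%:E); last first.
  by apply: ereal_sup_ubound; exists x.
rewrite lee_fin /phi convolution_trig//.
have -> : \sum_(j < m) c j * character (k j) x =
    rho%:C%C * \sum_(j < m) (rho^-1)%:C%C * c j * character (k j) x.
  rewrite mulr_sumr; apply: eq_bigr => j _.
  by rewrite !mulrA -rmorphM /= mulfV ?gt_eqF// rmorph1 mul1r.
rewrite -mulrBr cmodM cmod_real (gtr0_norm rho0) ler_pM2l//.
Qed.
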